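(* Let $n\geqslant 1$, $\tau>0$, $\delta>0$, $s\in[0,\infty)$ and $(\psi_0,\psi_1,\psi_2)\in\mathcal{A}_s$. Let $\psi=\psi(t,x)$ be the solution to the Cauchy problem $$\begin{cases}\tau\psi_{ttt}+\psi_{tt}-\Delta\psi-(\delta+\tau)\Delta\psi_t=0, & x\in\mathbb{R}^n,\ t>0,\\ \psi(0,x)=\psi_0(x),\ \psi_t(0,x)=\psi_1(x),\ \psi_{tt}(0,x)=\psi_2(x), & x\in\mathbb{R}^n,\end{cases}$$ and put $\Psi_{1,2}:=\psi_1+\tau\psi_2$. Then, for $\ell=0,1,2$ and $0\leqslant k\leqslant s+2-\ell$, the following estimate holds for large time $t\gg1$: $$\left\|\partial_t^{\ell}\psi(t,\cdot)-\frac{1}{|D|}\mathrm{e}^{\frac{\delta}{2}\Delta t}\,\partial_t^{\ell}\sin(|D|t)\,\Psi_{1,2}(\cdot)\right\|_{\dot{H}^k}\lesssim(1+t)^{-\frac{n}{4}-\frac{k+\ell}{2}}\,\|(\psi_0,\psi_1,\psi_2)\|_{\mathcal{A}_{(k-2+\ell)^+}}.$$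
   Context: For $s\geqslant 0$, $\mathcal{A}_s:=(H^{s+2}\cap L^1)\times(H^{s+1}\cap L^1)\times(H^s\cap L^1)$ on $\mathbb{R}^n$, with its natural norm (sum of the $H^{s+2},H^{s+1},H^s$ norms and of the $L^1$ norms of the components). $(a)^+:=\max\{a,0\}$. $\dot H^k$ is the homogeneous Sobolev (Riesz potential) space based on $L^2$, $\|f\|_{\dot H^k}=\||D|^kf\|_{L^2}$, where $|D|^k$ is the Fourier multiplier with symbol $|\xi|^k$. The operator $\frac{1}{|D|}\mathrm{e}^{\frac{\delta}{2}\Delta t}\partial_t^\ell\sin(|D|t)$ is the Fourier multiplier with symbol $|\xi|^{-1}\mathrm{e}^{-\frac{\delta}{2}|\xi|^2t}\,\partial_t^\ell\big(\sin(|\xi|t)\big)$ (the derivative $\partial_t^\ell$ acts only on the sine). ''$f\lesssim g$ for $t\gg1$'' means there are constants $C>0$, $T\geqslant 1$, independent of $t$ and of the data (they may depend on $n,\tau,\delta,s,k,\ell$), such that $f\leqslant Cg$ for all $t\geqslant T$. *)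

(* Defs.v *)
From HB Require Import structures.
From mathcomp Require Import all_boot all_order all_algebra.
From mathcomp Require Import all_classical all_reals all_analysis.
From mathcomp Require Import complex.

Set Implicit Arguments.
Unset Strict Implicit.
Unset Printing Implicit Defensive.
Import Order.TTheory GRing.Theory Num.Theory.
Import numFieldNormedType.Exports.

Local Open Scope classical_set_scope.
Local Open Scope ring_scope.
Local Open Scope complex_scope.

(* [n.-tuple] carries the product sigma-algebra, i.e. the Borel sets of R^n. *)
Definition Rn (R : realType) (n : nat) := n.-tuple (measurableTypeR R).

Section lebesgue_measure_Rn.
Context {R : realType}.

Definition consRn n (p : measurableTypeR R * Rn R n) : Rn R n.+1 :=
  [tuple of p.1 :: p.2].

Lemma measurable_consRn n : measurable_fun setT (@consRn n).
Proof. exact: (measurable_cons measurable_fst measurable_snd). Qed.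

Definition lebesgue_step n
    (m : {sigma_finite_measure set (Rn R n) -> \bar R}) :=
  pushforward (lebesgue_measure \x m)%E (@consRn n).

Lemma lebesgue_step0 n m : @lebesgue_step n m set0 = 0%E.
Proof. by rewrite /lebesgue_step /pushforward preimage_set0 measure0. Qed.

Lemma lebesgue_step_ge0 n m A : (0 <= @lebesgue_step n m A)%E.
Proof. by rewrite /lebesgue_step /pushforward. Qed.

Lemma lebesgue_step_sigma_additive n m :
  semi_sigma_additive (@lebesgue_step n m).
Proof.
have mpre A : measurable A -> measurable (@consRn n @^-1` A).
  by move=> mA; rewrite -[X in measurable X]setTI; exact: measurable_consRn.
move=> F mF tF mUF; rewrite /lebesgue_step /pushforward preimage_bigcup.
apply: measure_semi_sigma_additive.
- by move=> k; exact: mpre.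
- apply/trivIsetP => i j _ _ ij; rewrite -preimage_setI.
  by move/trivIsetP : tF => /(_ _ _ _ _ ij) ->//; rewrite preimage_set0.
- by rewrite -preimage_bigcup; exact: mpre.
Qed.

HB.instance Definition _ n m := isMeasure.Build _ _ _ (@lebesgue_step n m)
  (lebesgue_step0 m) (@lebesgue_step_ge0 n m) (@lebesgue_step_sigma_additive n m).

Lemma lebesgue_step_sigma_finite n m : sigma_finite setT (@lebesgue_step n m).
Proof.
have /sigma_finiteP[F [TF ndF Foo]] :=
  sigma_finiteT (@lebesgue_measure R : {sigma_finite_measure set _ -> \bar R}).
have /sigma_finiteP[G [TG ndG Goo]] := sigma_finiteT m.
pose g (x : Rn R n.+1) : measurableTypeR R * Rn R n := (thead x, behead_tuple x).
have gK x : consRn (g x) = x by apply/val_inj; case/tupleP: x.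
have Kg p : g (consRn p) = p.
  by case: p => a b; rewrite /g theadE; congr pair; apply/val_inj.
have mg : measurable_fun setT g.
  apply/measurable_fun_pairP; split; last exact: measurable_behead.
  exact: measurable_tnth.
exists (fun k => g @^-1` (F k `*` G k)).
  rewrite -preimage_bigcup (_ : \bigcup_k _ = setT) ?preimage_setT//.
  rewrite -setXTT TF TG predeqE => -[x y]; split.
    by move=> [k _ []/= ? ?]; split; exists k.
  move=> [/= [i _ Fix_] [j _ Gjy]]; exists (maxn i j) => //; split.
    by move: x Fix_; exact/subsetPset/ndF/leq_maxl.
  by move: y Gjy; exact/subsetPset/ndG/leq_maxr.
move=> k; have [mFk Fk] := Foo k; have [mGk Gk] := Goo k; split.
  by rewrite -[X in measurable X]setTI; apply: mg => //; exact: measurableX.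
rewrite /lebesgue_step /pushforward -comp_preimage (_ : g \o _ = id).
  by rewrite preimage_id product_measure1E// lte_mul_pinfty// ge0_fin_numE.
exact/funext.
Qed.

HB.instance Definition _ n m := Measure_isSigmaFinite.Build _ _ _
  (@lebesgue_step n m) (@lebesgue_step_sigma_finite n m).

Fixpoint lebesgue_Rn n : {sigma_finite_measure set (Rn R n) -> \bar R} :=
  if n is m.+1 then lebesgue_step (lebesgue_Rn m) else \d_([tuple]).

End lebesgue_measure_Rn.

Section functions_on_Rn.
Context {R : realType} {n : nat}.
Implicit Types (x xi : Rn R n) (f g phi : Rn R n -> R[i]).

Definition dotp x xi : R := \sum_(i < n) (tnth x i : R) * (tnth xi i : R).

Definition enorm x : R := Num.sqrt (dotp x x).

Definition cmeasurable f :=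
  measurable_fun setT (fun x => complex.Re (f x) : R) /\
  measurable_fun setT (fun x => complex.Im (f x) : R).

Definition cintegrable f :=
  (lebesgue_Rn n).-integrable setT (fun x => (complex.Re (f x))%:E) /\
  (lebesgue_Rn n).-integrable setT (fun x => (complex.Im (f x))%:E).

Definition cintegral f : R[i] :=
  (\int[lebesgue_Rn n]_x complex.Re (f x)) +i* (\int[lebesgue_Rn n]_x complex.Im (f x)).

Definition L1norm f : \bar R :=
  Lnorm (lebesgue_Rn n) 1%E (fun x => (Normc.normc (f x))%:E).

Definition L2norm f : \bar R :=
  Lnorm (lebesgue_Rn n) 2%:E (fun x => (Normc.normc (f x))%:E).

Definition expi (theta : R) : R[i] := cos theta +i* sin theta.

(* The unitary normalization: with it, Plancherel's theorem gives
   [||u||_{L^2} = ||fourier u||_{L^2}] without a constant. *)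
Definition fourier f xi : R[i] :=
  ((2 * pi) `^ (- (n%:R / 2)))%:C *
  cintegral (fun x => expi (- dotp x xi) * f x).

Definition inv_fourier f x : R[i] :=
  ((2 * pi) `^ (- (n%:R / 2)))%:C *
  cintegral (fun xi => expi (dotp x xi) * f xi).

Definition coord_line f (i : 'I_n) x (y : R) : R[i] :=
  f [tuple if j == i then y else tnth x j | j < n].

Definition partial (i : 'I_n) f x : R[i] :=
  derive1 (fun y => complex.Re (coord_line f i x y)) (tnth x i : R) +i*
  derive1 (fun y => complex.Im (coord_line f i x y)) (tnth x i : R).

Definition has_partial (i : 'I_n) f x : Prop :=
  derivable (fun y => complex.Re (coord_line f i x y)) (tnth x i : R) 1 /\
  derivable (fun y => complex.Im (coord_line f i x y)) (tnth x i : R) 1.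

Definition iter_partial (idx : seq 'I_n) f : Rn R n -> R[i] :=
  foldr partial f idx.

Definition laplacian f x : R[i] := \sum_(i < n) partial i (partial i f) x.

(* Partial derivatives of every order exist and are rapidly decreasing. They
   are in particular bounded, so each of them is Lipschitz continuous: such a
   function is automatically C^oo. *)
Definition schwartz f : Prop :=
  forall idx : seq 'I_n,
    (forall i x, has_partial i (iter_partial idx f) x) /\
    (forall N : nat, exists M : R, forall x,
       (1 + enorm x) ^+ N * Normc.normc (iter_partial idx f x) <= M).

End functions_on_Rn.

(* A tempered distribution is represented by any functional that agrees with it
   on Schwartz functions; its values on other functions are never used.
   Linearity and continuity are not imposed here: they follow from finiteness
   of a Sobolev norm below, since [u (fourier phi)] is then the integral of
   [g * phi] and [fourier] is onto the Schwartz space. *)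
Definition distr (R : realType) (n : nat) := (Rn R n -> R[i]) -> R[i].

Section distributions.
Context {R : realType} {n : nat}.
Implicit Types (f g phi : Rn R n -> R[i]) (u v : distr R n).

Definition distr_eq u v := forall phi, schwartz phi -> u phi = v phi.

Definition distr_of f : distr R n :=
  fun phi => cintegral (fun x => f x * phi x).

Definition distr_fourier u : distr R n := fun phi => u (fourier phi).

Definition distr_inv_fourier u : distr R n := fun phi => u (inv_fourier phi).

Definition distr_laplacian u : distr R n := fun phi => u (laplacian phi).

Definition fourier_is u g :=
  [/\ cmeasurable g,
      forall phi, schwartz phi -> cintegrable (fun xi => g xi * phi xi) &
      distr_eq (distr_fourier u) (distr_of g)].

(* The L^2 norm of [w] times the Fourier transform of [u]. All the functions
   [g] such that [fourier_is u g] agree almost everywhere, so the infimum ranges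
   over at most one value; it is [+oo] if the Fourier transform of [u] is not
   a function. *)
Definition fourier_weighted_norm (w : Rn R n -> R) u : \bar R :=
  ereal_inf [set L2norm (fun xi => (w xi)%:C * g xi) | g in fourier_is u].

Definition sobolev_norm (sigma : R) : distr R n -> \bar R :=
  fourier_weighted_norm (fun xi => (1 + enorm xi ^+ 2) `^ (sigma / 2)).

Definition homogeneous_sobolev_norm (k : R) : distr R n -> \bar R :=
  fourier_weighted_norm (fun xi => enorm xi `^ k).

(* m(D) f = F^-1 (m F f), for an integrable f. *)
Definition fourier_multiplier (m : Rn R n -> R) f : distr R n :=
  distr_inv_fourier (distr_of (fun xi => (m xi)%:C * fourier f xi)).

Definition A_norm (sigma : R) (f0 f1 f2 : Rn R n -> R[i]) : \bar R :=
  (sobolev_norm (sigma + 2)%R (distr_of f0) +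
   sobolev_norm (sigma + 1)%R (distr_of f1) +
   sobolev_norm sigma (distr_of f2) +
   L1norm f0 + L1norm f1 + L1norm f2)%E.

Definition A_space (sigma : R) (f0 f1 f2 : Rn R n -> R[i]) : Prop :=
  [/\ cintegrable f0, cintegrable f1 & cintegrable f2] /\
  [/\ (sobolev_norm (sigma + 2)%R (distr_of f0) < +oo)%E,
      (sobolev_norm (sigma + 1)%R (distr_of f1) < +oo)%E &
      (sobolev_norm sigma (distr_of f2) < +oo)%E].

End distributions.

Section cauchy_problem.
Context {R : realType} {n : nat}.
Implicit Types (u v : R -> distr R n).

Definition halfline : set R := [set t | 0 <= t].

(* u \in C([0, +oo), H^sigma) *)
Definition continuous_in_sobolev (sigma : R) u :=
  (forall t, 0 <= t -> (sobolev_norm sigma (u t) < +oo)%E) /\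
  (forall t, 0 <= t ->
     sobolev_norm sigma (u t' \- u t) @[t' --> within halfline (nbhs t)]
       --> 0%E).

(* v is the strong derivative of u in H^sigma on [0, +oo) (one-sided at 0). *)
Definition sobolev_derivative (sigma : R) u v :=
  forall t, 0 <= t ->
    sobolev_norm sigma ((((t' - t)^-1)%:C \*o (u t' \- u t)) \- v t)
      @[t' --> within halfline (t^')] --> 0%E.

(* [psi j] is the j-th time derivative of the solution [psi 0]. The solution is
   taken in the natural class of the data: [psi 0] lies in the intersection of
   the C^j([0, +oo), H^(s + 2 - j)), and the equation holds in the sense of
   tempered distributions. *)
Definition mgt_solution (tau delta s : R) (f0 f1 f2 : Rn R n -> R[i])
    (psi : nat -> R -> distr R n) : Prop :=
  [/\ forall j : nat, (j <= 3)%N ->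
        continuous_in_sobolev (s + 2 - j%:R) (psi j),
      forall j : nat, (j < 3)%N ->
        sobolev_derivative (s + 2 - j.+1%:R) (psi j) (psi j.+1),
      forall t, 0 < t ->
        distr_eq
          ((tau%:C \*o psi 3%N t) \+ psi 2%N t \- distr_laplacian (psi 0%N t)
             \- ((delta + tau)%:C \*o distr_laplacian (psi 1%N t)))
          (fun=> 0) &
      [/\ distr_eq (psi 0%N 0) (distr_of f0),
          distr_eq (psi 1%N 0) (distr_of f1) &
          distr_eq (psi 2%N 0) (distr_of f2)]].

(* At xi = 0 the convention 0^-1 = 0 applies; that point is a null set. *)
Definition wave_diffusion_symbol (delta : R) (l : nat) (t : R) (xi : Rn R n) : R :=
  (enorm xi)^-1 * expR (- (delta / 2) * enorm xi ^+ 2 * t) *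
  derive1n l (fun r => sin (enorm xi * r)) t.

End cauchy_problem.

(* Main.v *)
(* After a Fourier transform in x the equation becomes, at each frequency of
   modulus r, the ordinary differential equation
     tau y''' + y'' + (delta + tau) r^2 y' + r^2 y = 0.
   A distributional solution has this transform almost everywhere: its pairing
   with a solution of the adjoint equation run backwards in time is conserved,
   and Schwartz functions separate locally integrable functions.
   With w = y + tau y' and q = y' the equation is the system
     w'' + r^2 w + delta r^2 q = 0,  tau q' + q = w',
   for which w'^2 + r^2 w^2 + delta tau r^2 q^2, corrected by small cross terms,
   is a Lyapunov functional with rate comparable to min(1, r^2). For r >= 1 this
   gives exponential decay. For r <= 1 the same functional is applied to the
   difference with the damped wave that has symbol
   r^-1 exp(- delta r^2 t / 2) sin(r t); it solves the equation up to errors of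
   higher order in r, and one subtracts the initial layer exp(- t / tau). The
   resulting pointwise bound is of the form
     r^(k + l) exp(- c r^2 t) + exp(- c t) * (weights),
   and integrating the square of the Gaussian factor gives the decay rate. *)

Require Import Defs.
From mathcomp Require Import all_boot all_order all_algebra.
From mathcomp Require Import all_classical all_reals all_analysis.
From mathcomp Require Import measurable_realfun.
From mathcomp Require Import complex ring lra.
Set Implicit Arguments.
Unset Strict Implicit.
Unset Printing Implicit Defensive.
Import Order.TTheory GRing.Theory Num.Theory.
Import numFieldNormedType.Exports.
Local Open Scope classical_set_scope.
Local Open Scope ring_scope.
Local Open Scope complex_scope.
Local Notation cRe := complex.Re.
Local Notation cIm := complex.Im.
Local Notation normc := Normc.normc.

(** * Integration on R^n *)

(** A solution is given at each time as a functional, so its transform is a function known up to a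
    null set that varies with the time; the equation at a frequency cannot be solved point by point.
    The conserved pairing is therefore integrated over frequencies first. Its cutoff is a truncation
    of the very error to be removed, so that one vanishing integral of a nonnegative function
    suffices. The pairing must make sense in Sobolev spaces of possibly negative order, hence the
    restriction to balls of frequencies. The fundamental solutions are power series in time whose
    coefficients are polynomials in r^2. Formulas through the roots of the cubic characteristic
    polynomial would have to deal with frequencies where roots collide; the series gives
    measurability in the frequency and local bounds at once. At high frequencies the profile applied
    to tau psi_2 costs one power of r more than the norm of psi_2 pays for. The Gaussian factor
    absorbs it for t >= 1. The same restriction makes t and 1 + t comparable. *)

Section Rn_measure.
Context {R : realType}.
Local Notation mu := (@lebesgue_measure R).

Definition shiftn n (a x : Rn R n) : Rn R n :=
  [tuple (tnth a i : R) + (tnth x i : R) | i < n].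

Lemma measurable_coord n (i : 'I_n) :
  measurable_fun [set: Rn R n] (fun x : Rn R n => (tnth x i : R)).
Proof. exact: (@measurable_tnth _ (measurableTypeR R)). Qed.

Lemma measurable_tuple_fun d (T : measurableType d) n (f : T -> Rn R n) :
  (forall i, measurable_fun setT (fun x => (tnth (f x) i : R))) ->
  measurable_fun setT f.
Proof. by move=> mf; apply/measurable_fun_tnthP => i; exact: mf. Qed.

Lemma measurable_shiftn n (a : Rn R n) : measurable_fun setT (shiftn a).
Proof.
apply: measurable_tuple_fun => i.
under eq_fun do rewrite tnth_mktuple.
by apply: measurable_funD => //; exact: measurable_coord.
Qed.

Lemma measurable_dotp d (T : measurableType d) n (f g : T -> Rn R n) :
  measurable_fun setT f -> measurable_fun setT g ->
  measurable_fun setT (fun x => dotp (f x) (g x) : R).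
Proof.
move=> mf mg; rewrite /dotp; apply: measurable_sum => i.
apply: measurable_funM.
  by apply: (measurableT_comp (@measurable_coord n i)).
by apply: (measurableT_comp (@measurable_coord n i)).
Qed.

Lemma measurable_enorm n : measurable_fun setT (@enorm R n).
Proof.
have -> : @enorm R n = (@Num.sqrt R) \o (fun x => dotp x x) by [].
apply: measurableT_comp; last exact: measurable_dotp.
apply: continuous_measurable_fun; exact: sqrt_continuous.
Qed.

Lemma integral_Rn0 (f : Rn R 0 -> \bar R) : measurable_fun setT f ->
  (\int[lebesgue_Rn 0]_x f x = f [tuple])%E.
Proof.
by move=> mf; rewrite /= integral_dirac// diracT mul1e.
Qed.

Lemma ge0_integral_RnS n (f : Rn R n.+1 -> \bar R) :
  measurable_fun setT f -> (forall x, 0 <= f x)%E ->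
  (\int[lebesgue_Rn n.+1]_x f x =
   \int[mu]_x \int[lebesgue_Rn n]_y f (consRn (x, y)))%E.
Proof.
move=> mf f0.
transitivity (\int[(mu \x lebesgue_Rn n)%E]_p (f \o @consRn R n) p)%E.
  rewrite -(@ge0_integral_pushforward _ _ _ _ _ _ (@measurable_consRn R n) _ setT)//.
rewrite fubini_tonelli1//; last by move=> x; exact: f0.
by apply: measurableT_comp => //; exact: measurable_consRn.
Qed.

(** A translate of Lebesgue measure has the same mass on half-open intervals, so uniqueness of the
    measure applies. *)
Lemma ge0_integral_shift1 (a : R) (f : measurableTypeR R -> \bar R) :
  measurable_fun setT f -> (forall x, 0 <= f x)%E ->
  (\int[mu]_x f (a + x)%R = \int[mu]_x f x)%E.
Proof.
move=> mf f0.
pose sh : measurableTypeR R -> measurableTypeR R := fun x : R => a + x.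
have ms : measurable_fun setT sh.
  by apply: (@measurable_funD _ _ R) => //.
have pE A : measurable A -> pushforward mu sh A = mu A.
  move=> mA; apply/esym; apply: (@lebesgue_measure_unique _ (pushforward mu sh)) => //= _ [[b c]] _ <-.
  rewrite /pushforward (_ : _ @^-1` _ = `]b - a, c - a]%classic); last first.
    by apply/seteqP; split => x /=; rewrite !in_itv/= /sh => /andP[? ?]; apply/andP; split; lra.
  rewrite !lebesgue_measure_itv/= !lte_fin ltrD2r; case: ifPn => //= _.
  by rewrite -!EFinD; congr EFin; lra.
transitivity (\int[pushforward mu sh]_x f x)%E.
  by rewrite (ge0_integral_pushforward ms mu measurableT mf).
by apply: eq_measure_integral => //= A mA AS; exact: pE.
Qed.

Lemma shiftn_cons n (a : R) (b : Rn R n) x y :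
  shiftn (consRn (a, b)) (consRn (x, y)) = consRn (a + x, shiftn b y).
Proof.
apply: eq_from_tnth => i; rewrite tnth_mktuple /=.
by case: (unliftP ord0 i) => [j ->|->]; rewrite ?tnthS ?tnth0 //= tnth_mktuple.
Qed.

Lemma consRnP n (x : Rn R n.+1) : x = consRn (thead x, behead_tuple x).
Proof. by apply/val_inj; case/tupleP: x. Qed.

Lemma ge0_integral_shiftn n (a : Rn R n) (f : Rn R n -> \bar R) :
  measurable_fun setT f -> (forall x, 0 <= f x)%E ->
  (\int[lebesgue_Rn n]_x f (shiftn a x) = \int[lebesgue_Rn n]_x f x)%E.
Proof.
elim: n => [|n IH] in a f *; move=> mf f0.
  rewrite !integral_Rn0//; first by congr f; apply: eq_from_tnth; case.
  by apply: measurableT_comp => //; exact: measurable_shiftn.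
have mfs : measurable_fun setT (fun x => f (shiftn a x)).
  by apply: measurableT_comp => //; exact: measurable_shiftn.
rewrite (ge0_integral_RnS mfs (fun x => f0 _)) (ge0_integral_RnS mf f0).
rewrite (consRnP a); set a0 := thead a; set a' := behead_tuple a.
have mfc : measurable_fun setT (fun p => f (consRn p)).
  by apply: measurableT_comp => //; exact: measurable_consRn.
under eq_integral do under eq_integral do rewrite shiftn_cons.
transitivity (\int[mu]_x \int[lebesgue_Rn n]_y f (consRn (a0 + x, y)%R))%E.
  apply: eq_integral => x _; apply: (IH a' (fun y => f (consRn (a0 + x, y)))) => //.
  apply: (measurableT_comp mfc); exact: measurable_pair1.
apply: (ge0_integral_shift1 a0 (f := fun x => \int[lebesgue_Rn n]_y f (consRn (x, y)))%E).
- apply: (@measurable_fun_fubini_tonelli_F _ _ _ _ _ (lebesgue_Rn n) (f \o @consRn R n)).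
    exact: mfc.
  by move=> p; exact: f0.
- by move=> x; apply: integral_ge0.
Qed.

Lemma ge0_integral_prodRn n (f : 'I_n -> R -> R) (c : 'I_n -> R) :
  (forall i, measurable_fun setT (f i)) -> (forall i x, 0 <= f i x) ->
  (forall i, \int[mu]_x (f i x)%:E = (c i)%:E)%E ->
  (\int[lebesgue_Rn n]_x (\prod_(i < n) f i (tnth x i))%:E =
   (\prod_(i < n) c i)%:E)%E.
Proof.
elim: n => [|n IH] in f c *; move=> mf f0 fc.
  under eq_integral do rewrite big_ord0.
  by rewrite integral_Rn0// big_ord0.
have mP m (g : 'I_m -> R -> R) : (forall i, measurable_fun setT (g i)) ->
    measurable_fun setT (fun x : Rn R m => \prod_(i < m) g i (tnth x i)).
  move=> mg; apply: measurable_prod => i _.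
  by apply: (measurableT_comp (mg i)); exact: measurable_coord.
rewrite ge0_integral_RnS; last 2 first.
- by apply/measurable_EFinP; exact: mP.
- by move=> x; rewrite lee_fin; apply: prodr_ge0.
transitivity (\int[mu]_x ((f ord0 x)%:E * (\prod_(i < n) c (lift ord0 i))%:E))%E.
  apply: eq_integral => x _.
  rewrite -(IH (fun i => f (lift ord0 i)))//.
  rewrite -ge0_integralZl//; last 3 first.
  - by apply/measurable_EFinP; exact: (mP _ (fun i => f (lift ord0 i))).
  - by move=> y _; rewrite lee_fin; apply: prodr_ge0.
  - by rewrite lee_fin.
  apply: eq_integral => y _; rewrite -EFinM big_ord_recl tnth0.
  by congr (_ * _)%:E; apply: eq_bigr => i _; rewrite tnthS.
have pc0 : 0 <= \prod_(i < n) c (lift ord0 i).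
  apply: prodr_ge0 => i _; rewrite -lee_fin -fc; apply: integral_ge0 => x _.
  by rewrite lee_fin.
rewrite ge0_integralZr//; last by move=> x _; rewrite lee_fin.
  by rewrite fc -EFinM big_ord_recl.
by apply/measurable_EFinP; exact: (mf ord0).
Qed.

Lemma dotp_ge0 n (x : Rn R n) : 0 <= dotp x x.
Proof. by apply: sumr_ge0 => i _; rewrite -expr2 sqr_ge0. Qed.

Lemma enorm_ge0 n (x : Rn R n) : 0 <= enorm x.
Proof. exact: sqrtr_ge0. Qed.

Lemma sqr_enorm n (x : Rn R n) : enorm x ^+ 2 = dotp x x.
Proof. by rewrite sqr_sqrtr// dotp_ge0. Qed.

Lemma ler_coord_enorm n (x : Rn R n) i : `|tnth x i : R| <= enorm x.
Proof.
rewrite -sqrtr_sqr ler_wsqrtr// /dotp (bigD1 i)//= expr2 lerDl.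
by apply: sumr_ge0 => j _; rewrite -expr2 sqr_ge0.
Qed.

Lemma ler_enorm_sum n (x : Rn R n) : enorm x <= \sum_(i < n) `|tnth x i : R|.
Proof.
have S0 : 0 <= \sum_(i < n) `|tnth x i : R| by apply: sumr_ge0.
rewrite -(ger0_norm S0) -sqrtr_sqr ler_wsqrtr//.
rewrite expr2 mulr_suml; apply: ler_sum => i _.
rewrite (le_trans (ler_norm _))// normrM ler_wpM2l// (bigD1 i)//= lerDl.
by apply: sumr_ge0.
Qed.

(** The origin lies in a coordinate hyperplane, a product with a null factor. In dimension 0 it is
    the whole space and has mass one. *)
Lemma negligible_enorm0 n : (0 < n)%N ->
  (lebesgue_Rn n).-negligible [set x : Rn R n | enorm x = 0].
Proof.
case: n => // n _.
exists [set x | tnth x ord0 = 0 :> R]; split.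
- rewrite -[X in measurable X]setTI.
  by apply: (@measurable_coord n.+1 ord0 measurableT [set 0]).
- rewrite /= /lebesgue_step /pushforward.
  rewrite (_ : _ @^-1` _ = [set (0 : R)] `*` setT); last first.
    by apply/seteqP; split => [[x y]|[x y]] /=; rewrite tnth0 => // -[].
  transitivity (mu [set 0%R] * lebesgue_Rn n setT)%E.
    by apply: product_measure1E => //; exact: measurable_set1.
  by rewrite lebesgue_measure_set1 mul0e.
- move=> x /= x0; apply/eqP; rewrite -normr_le0 -x0; exact: ler_coord_enorm.
Qed.

Lemma prod_oneDsqr_le n (x : Rn R n) :
  \prod_(i < n) oneDsqr (tnth x i : R) <= (1 + enorm x) ^+ (2 * n).
Proof.
rewrite exprM; have := enorm_ge0 x => x0.
rewrite -[X in _ ^+ X](card_ord n) -prodr_const; apply: ler_prod => i _.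
rewrite (le_trans ler01 (oneDsqr_ge1 _))/= /oneDsqr.
have := ler_coord_enorm x i; have := normr_ge0 (tnth x i : R).
rewrite -[X in 1 + X <= _](@real_normK _ (tnth x i : R)) ?num_real//.
set u := `| _ |; set v := enorm x => u0 uv; nra.
Qed.

Lemma oneDsqrV_gt0 (x : R) : 0 < (oneDsqr x)^-1.
Proof. by rewrite invr_gt0 (lt_le_trans ltr01 (oneDsqr_ge1 _)). Qed.

Lemma integralT_oneDsqr :
  (\int[mu]_x ((oneDsqr x)^-1)%:E = (pi : R)%:E)%E.
Proof.
rewrite ge0_symfun_integralT//=.
- rewrite (_ : [set x | _] = `[0, +oo[%classic); last first.
    by apply/seteqP; split => x/=; rewrite in_itv/= andbT.
  by rewrite integral0y_oneDsqr -EFinM mulrCA divff// mulr1.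
- exact: continuous_oneDsqrV.
- by move=> x/=; rewrite /oneDsqr sqrrN.
Qed.

Lemma integral_prod_oneDsqr n :
  (\int[lebesgue_Rn n]_x (\prod_(i < n) (oneDsqr (tnth x i : R))^-1)%:E =
   ((pi : R) ^+ n)%:E)%E.
Proof.
rewrite (ge0_integral_prodRn (f := fun _ y => (oneDsqr y)^-1) (c := fun=> pi)).
- by rewrite prodr_const card_ord.
- move=> _; apply: continuous_measurable_fun; exact: continuous_oneDsqrV.
- by move=> _ x; exact: ltW (oneDsqrV_gt0 x).
- move=> _; exact: integralT_oneDsqr.
Qed.

(** The weight dominates the product of the [1 + x_i ^ 2], and the inverse of that product has
    integral [pi ^ n] by Tonelli. *)
Lemma integrable_decay n (f : Rn R n -> R) (M : R) :
  measurable_fun setT f ->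
  (forall x, (1 + enorm x) ^+ (2 * n) * `|f x| <= M) ->
  (lebesgue_Rn n).-integrable setT (EFin \o f).
Proof.
move=> mf fM.
have mg : measurable_fun setT
    (fun x : Rn R n => \prod_(i < n) (oneDsqr (tnth x i : R))^-1).
  apply: measurable_prod => i _.
  apply: (measurableT_comp (f := fun y : R => (oneDsqr y)^-1)); last exact: measurable_coord.
  apply: continuous_measurable_fun; exact: continuous_oneDsqrV.
have g0 (x : Rn R n) : 0 <= \prod_(i < n) (oneDsqr (tnth x i : R))^-1.
  by apply: prodr_ge0 => i _; exact: ltW (oneDsqrV_gt0 _).
have M0 : 0 <= M.
  apply: le_trans (fM [tuple 0 | i < n]); apply: mulr_ge0 => //.
  by rewrite exprn_ge0// addr_ge0// enorm_ge0.
apply: (@le_integrable _ _ _ _ setT measurableT _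
  (EFin \o (fun x : Rn R n => M * \prod_(i < n) (oneDsqr (tnth x i : R))^-1))).
- exact/measurable_EFinP.
- move=> x _ /=; rewrite lee_fin (ger0_norm (mulr_ge0 M0 (g0 x))).
  have D0 : 0 < \prod_(i < n) oneDsqr (tnth x i : R).
    by apply: prodr_gt0 => i _; rewrite (lt_le_trans _ (oneDsqr_ge1 _)).
  rewrite prodfV ler_pdivlMr// mulrC.
  apply: le_trans (fM x); rewrite ler_wpM2r//; exact: prod_oneDsqr_le.
- apply/integrableP; split.
    by apply/measurable_EFinP; apply: measurable_funM.
  under eq_integral do rewrite /= ger0_norm ?mulr_ge0// EFinM.
  rewrite ge0_integralZl//; first by rewrite integral_prod_oneDsqr ltry.
  - exact/measurable_EFinP.
  - by move=> x _; rewrite lee_fin.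
Qed.

(** Gaussian with centre [a] and standard deviation [s], normalised to have maximum 1 rather than
    mass 1. The product form gives the integral; [gaussnE] is the radial form. *)
Definition gaussn n (s : R) (a x : Rn R n) : R :=
  \prod_(i < n) normal_fun (tnth a i : R) s (tnth x i : R).

Lemma gaussn_gt0 n s (a x : Rn R n) : 0 < gaussn s a x.
Proof. by apply: prodr_gt0 => i _; exact: expR_gt0. Qed.

Lemma measurable_gaussn n s (a : Rn R n) : measurable_fun setT (gaussn s a).
Proof.
apply: measurable_prod => i _.
apply: (measurableT_comp (f := normal_fun (tnth a i : R) s)); last exact: measurable_coord.
exact: measurable_normal_fun.
Qed.

Lemma integral_normal_fun (m s : R) : s != 0 ->
  (\int[mu]_x (normal_fun m s x)%:E = ((normal_peak s)^-1)%:E)%E.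
Proof.
move=> s0; have p0 : 0 < normal_peak s by exact: normal_peak_gt0.
have := integral_normal_pdf m s; rewrite normal_pdfE//.
under eq_integral do rewrite EFinM.
rewrite ge0_integralZl//; last 3 first.
- by apply/measurable_EFinP; exact: measurable_normal_fun.
- by move=> x _; rewrite lee_fin expR_ge0.
- by rewrite lee_fin ltW.
move=> h; have : ((normal_peak s)^-1%:E * ((normal_peak s)%:E * (\int[mu]_x (normal_fun m s x)%:E)) = (normal_peak s)^-1%:E * 1)%E by rewrite h.
by rewrite muleA -EFinM mulVf ?gt_eqF// mul1e mule1.
Qed.

Lemma integral_gaussn n s (a : Rn R n) : s != 0 ->
  (\int[lebesgue_Rn n]_x (gaussn s a x)%:E = ((normal_peak s)^-1 ^+ n)%:E)%E.
Proof.
move=> s0.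
rewrite /gaussn (ge0_integral_prodRn (f := fun i y => normal_fun (tnth a i : R) s y) (c := fun=> (normal_peak s)^-1)).
- by rewrite prodr_const card_ord.
- by move=> i; exact: measurable_normal_fun.
- by move=> i x; exact: expR_ge0.
- by move=> i; exact: integral_normal_fun.
Qed.

Lemma integrable_gaussn n s (a : Rn R n) : s != 0 ->
  (lebesgue_Rn n).-integrable setT (EFin \o gaussn s a).
Proof.
move=> s0; apply/integrableP; split.
  by apply/measurable_EFinP; exact: measurable_gaussn.
under eq_integral do rewrite /= ger0_norm ?(ltW (gaussn_gt0 _ _ _))//.
by rewrite integral_gaussn// ltry.
Qed.

Lemma gaussnE n s (a x : Rn R n) :
  gaussn s a x = expR (- (\sum_(i < n) ((tnth x i : R) - (tnth a i : R)) ^+ 2) / (s ^+ 2 *+ 2)).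
Proof.
rewrite /gaussn /normal_fun -expR_sum; congr expR.
by rewrite -sumrN mulr_suml.
Qed.

End Rn_measure.

(** * Real and imaginary parts, modulus *)

Section complex_arith.
Context {R : realType}.
Implicit Types z w : R[i].

Lemma cReM z w : cRe (z * w) = cRe z * cRe w - cIm z * cIm w.
Proof. by case: z; case: w. Qed.
Lemma cImM z w : cIm (z * w) = cRe z * cIm w + cIm z * cRe w.
Proof. by case: z; case: w. Qed.
Lemma cReD z w : cRe (z + w) = cRe z + cRe w.
Proof. by case: z; case: w. Qed.
Lemma cImD z w : cIm (z + w) = cIm z + cIm w.
Proof. by case: z; case: w. Qed.
Lemma cReN z : cRe (- z) = - cRe z.
Proof. by case: z. Qed.
Lemma cImN z : cIm (- z) = - cIm z.
Proof. by case: z. Qed.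
Lemma cReB z w : cRe (z - w) = cRe z - cRe w.
Proof. by rewrite cReD cReN. Qed.
Lemma cImB z w : cIm (z - w) = cIm z - cIm w.
Proof. by rewrite cImD cImN. Qed.

Definition cE := (cReM, cImM, cReB, cImB, cReD, cImD, cReN, cImN).

Lemma complexP z w : cRe z = cRe w -> cIm z = cIm w -> z = w.
Proof. by case: z; case: w => /= ? ? ? ? -> ->. Qed.

Lemma normc_ge0 z : 0 <= normc z.
Proof. by case: z => a b; exact: sqrtr_ge0. Qed.
Lemma normcE z : normc z = Num.sqrt (cRe z ^+ 2 + cIm z ^+ 2).
Proof. by case: z. Qed.
Lemma sqr_normc z : normc z ^+ 2 = cRe z ^+ 2 + cIm z ^+ 2.
Proof. by rewrite normcE sqr_sqrtr// addr_ge0// sqr_ge0. Qed.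
Lemma ler_Re_normc z : `|cRe z| <= normc z.
Proof. by rewrite normcE -sqrtr_sqr ler_wsqrtr// lerDl sqr_ge0. Qed.
Lemma ler_Im_normc z : `|cIm z| <= normc z.
Proof. by rewrite normcE -sqrtr_sqr ler_wsqrtr// lerDr sqr_ge0. Qed.
Lemma ler_normc_ReIm z : normc z <= `|cRe z| + `|cIm z|.
Proof.
rewrite -(@ler_pXn2r _ 2)// ?nnegrE ?normc_ge0 ?addr_ge0//.
rewrite sqr_normc -(real_normK (num_real (cRe z))) -(real_normK (num_real (cIm z))).
have := normr_ge0 (cRe z); have := normr_ge0 (cIm z).
set a := `| _ |; set b := `| _ |; nra.
Qed.
Lemma ler_normcD z w : normc (z + w) <= normc z + normc w.
Proof. exact: le_normcD. Qed.
Lemma normcR (a : R) : normc a%:C = `|a|.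
Proof. by rewrite normcE /= expr0n addr0 sqrtr_sqr. Qed.
Lemma normcM z w : normc (z * w) = normc z * normc w.
Proof. exact: Normc.normcM. Qed.
Lemma normc_expi (t : R) : normc (expi t) = 1.
Proof. by rewrite normcE /= cos2Dsin2 sqrtr1. Qed.
Lemma expiD (s t : R) : expi (s + t) = expi s * expi t.
Proof. by apply: complexP; rewrite !cE /= ?cosD ?sinD //; ring. Qed.
Lemma expi0 : expi 0 = 1 :> R[i].
Proof. by rewrite /expi cos0 sin0. Qed.
Lemma real_complexM (a b : R) : (a * b)%:C = a%:C * b%:C.
Proof. by rewrite rmorphM. Qed.
Lemma real_complexD (a b : R) : (a + b)%:C = a%:C + b%:C.
Proof. by rewrite rmorphD. Qed.
Lemma real_complexN (a : R) : (- a)%:C = - a%:C.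
Proof. by rewrite rmorphN. Qed.
Lemma normcN z : normc (- z) = normc z.
Proof. by rewrite !normcE !cE !sqrrN. Qed.
Lemma cReZ (a : R) z : cRe (a%:C * z) = a * cRe z.
Proof. by rewrite cReM /= mul0r subr0. Qed.
Lemma cImZ (a : R) z : cIm (a%:C * z) = a * cIm z.
Proof. by rewrite cImM /= mul0r addr0. Qed.
Lemma cRe_increment z w v (a : R) : cRe (z - w - a%:C * v) = cRe z - cRe w - a * cRe v.
Proof. by rewrite 2!cReB cReZ. Qed.
Lemma cIm_increment z w v (a : R) : cIm (z - w - a%:C * v) = cIm z - cIm w - a * cIm v.
Proof. by rewrite 2!cImB cImZ. Qed.
Lemma real_complex_sum (I : Type) (s : seq I) (F : I -> R) :
  (\sum_(i <- s) F i)%:C = \sum_(i <- s) (F i)%:C.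
Proof.
elim: s => [|i s IH]; first by rewrite !big_nil.
by rewrite !big_cons -IH; apply: complexP; rewrite !cE //= addr0.
Qed.
End complex_arith.

(** * Integrals of complex functions *)

Section complex_integral.
Context {R : realType} {n : nat}.
Implicit Types (f g : Rn R n -> R[i]).
Local Notation mu := (@lebesgue_Rn R n).
Local Notation rintegrable f := (mu.-integrable setT (EFin \o f)).

Lemma cmeasurable_normc f : cmeasurable f -> measurable_fun setT (fun x => normc (f x)).
Proof.
move=> [mr mi]; under eq_fun do rewrite normcE.
apply: (measurableT_comp (f := @Num.sqrt R)).
  by apply: continuous_measurable_fun; exact: sqrt_continuous.
by apply: measurable_funD; apply: measurable_funX.
Qed.

Lemma cmeasurableD f g : cmeasurable f -> cmeasurable g -> cmeasurable (fun x => f x + g x).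
Proof.
move=> [fr fi] [gr gi]; split; under eq_fun do rewrite cE; exact: measurable_funD.
Qed.

Lemma cmeasurableB f g : cmeasurable f -> cmeasurable g -> cmeasurable (fun x => f x - g x).
Proof.
move=> [fr fi] [gr gi]; split; under eq_fun do rewrite cE; exact: measurable_funB.
Qed.

Lemma cmeasurableM f g : cmeasurable f -> cmeasurable g -> cmeasurable (fun x => f x * g x).
Proof.
move=> [fr fi] [gr gi]; split; under eq_fun do rewrite cE.
  by apply: measurable_funB; exact: measurable_funM.
by apply: measurable_funD; exact: measurable_funM.
Qed.

Lemma cmeasurable_cst (c : R[i]) : cmeasurable (fun _ : Rn R n => c).
Proof. by split; exact: measurable_cst. Qed.

Lemma cmeasurableR (h : Rn R n -> R) : measurable_fun setT h -> cmeasurable (fun x => (h x)%:C).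
Proof. by move=> mh; split => //=; exact: measurable_cst. Qed.

Lemma cmeasurable_expi (h : Rn R n -> R) : measurable_fun setT h ->
  cmeasurable (fun x => expi (h x)).
Proof.
move=> mh; split => /=.
  apply: (measurableT_comp (f := @cos R)) => //.
  by apply: continuous_measurable_fun; exact: continuous_cos.
apply: (measurableT_comp (f := @sin R)) => //.
by apply: continuous_measurable_fun; exact: continuous_sin.
Qed.

Lemma cintegrable_measurable f : cintegrable f -> cmeasurable f.
Proof.
by move=> [/measurable_int/measurable_EFinP ? /measurable_int/measurable_EFinP ?].
Qed.

Lemma cintegrable_le f (g : Rn R n -> R) : cmeasurable f ->
  (forall x, normc (f x) <= g x) -> rintegrable g -> cintegrable f.
Proof.
move=> [mr mi] fg ig; split.
  apply: le_integrable ig => //; first exact/measurable_EFinP.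
  move=> x _ /=; rewrite lee_fin; apply: le_trans (ler_Re_normc _) _.
  exact: le_trans (fg x) (ler_norm _).
apply: le_integrable ig => //; first exact/measurable_EFinP.
move=> x _ /=; rewrite lee_fin; apply: le_trans (ler_Im_normc _) _.
exact: le_trans (fg x) (ler_norm _).
Qed.

Lemma cintegrable_normc f : cintegrable f -> rintegrable (fun x => normc (f x)).
Proof.
move=> If; have mf := cintegrable_measurable If; case: If => ir ii.
apply: (@le_integrable _ _ _ mu setT measurableT _
   (fun x => (`|cRe (f x)| + `|cIm (f x)|)%:E)).
- apply/measurable_EFinP; exact: cmeasurable_normc.
- move=> x _; rewrite /= lee_fin ger0_norm ?normc_ge0//.
  by rewrite ger0_norm ?addr_ge0//; exact: ler_normc_ReIm.
- apply: (@eq_integrable _ _ _ mu setT measurableT ((abse \o (fun x => (cRe (f x))%:E)) \+ (abse \o (fun x => (cIm (f x))%:E)))%E).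
    by move=> x _ /=; rewrite EFinD.
  by apply: integrableD => //; apply: integrable_abse.
Qed.

Lemma cintegrableP f : cintegrable f <->
  cmeasurable f /\ rintegrable (fun x => normc (f x)).
Proof.
split; first by move=> If; split; [exact: cintegrable_measurable|exact: cintegrable_normc].
by move=> [mf nf]; exact: (cintegrable_le mf _ nf).
Qed.

Lemma cintegrableD f g : cintegrable f -> cintegrable g -> cintegrable (fun x => f x + g x).
Proof.
move=> [fr fi] [gr gi]; split; under eq_fun do rewrite cE EFinD; exact: integrableD.
Qed.

Lemma rintegrableZl (k : R) (h : Rn R n -> R) : rintegrable h -> rintegrable (fun x => k * h x).
Proof.
move=> ih; apply: (@eq_integrable _ _ _ mu setT measurableT (fun x => (k%:E * (EFin \o h) x)%E)) => //.
exact: integrableZl.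
Qed.

Lemma rintegrableD (h k : Rn R n -> R) : rintegrable h -> rintegrable k ->
  rintegrable (fun x => h x + k x).
Proof.
move=> ih ik; apply: (@eq_integrable _ _ _ mu setT measurableT ((EFin \o h) \+ (EFin \o k))%E) => //.
exact: integrableD.
Qed.

Lemma rintegrableB (h k : Rn R n -> R) : rintegrable h -> rintegrable k ->
  rintegrable (fun x => h x - k x).
Proof.
move=> ih ik; apply: (@eq_integrable _ _ _ mu setT measurableT ((EFin \o h) \- (EFin \o k))%E) => //.
exact: integrableB.
Qed.

Lemma rintegrable_le (h k : Rn R n -> R) : measurable_fun setT h ->
  (forall x, `|h x| <= k x) -> rintegrable k -> rintegrable h.
Proof.
move=> mh hk ik; apply: le_integrable ik => //; first exact/measurable_EFinP.
by move=> x _ /=; rewrite lee_fin (le_trans (hk x))// ler_norm.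
Qed.

Lemma cintegrableZl (c : R[i]) f : cintegrable f -> cintegrable (fun x => c * f x).
Proof.
move=> [ir ii]; split.
  rewrite (_ : (fun _ => _) = EFin \o (fun x => cRe c * cRe (f x) - cIm c * cIm (f x))); last first.
    by apply/funext => x /=; rewrite cE.
  by apply: rintegrableB; apply: rintegrableZl.
rewrite (_ : (fun _ => _) = EFin \o (fun x => cRe c * cIm (f x) + cIm c * cRe (f x))); last first.
  by apply/funext => x /=; rewrite cE.
by apply: rintegrableD; apply: rintegrableZl.
Qed.

Lemma cintegrableN f : cintegrable f -> cintegrable (fun x => - f x).
Proof.
move=> /(cintegrableZl (-1)); rewrite (_ : (fun _ => _) = (fun x => - f x))//.
by apply/funext => x; rewrite mulN1r.
Qed.

Lemma cintegrableB f g : cintegrable f -> cintegrable g -> cintegrable (fun x => f x - g x).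
Proof. by move=> If /cintegrableN; exact: cintegrableD. Qed.

Lemma cintegrable_bddM f g (M : R) : cintegrable f -> cmeasurable g ->
  (forall x, normc (g x) <= M) -> cintegrable (fun x => g x * f x).
Proof.
move=> If mg gM; have mf := cintegrable_measurable If.
apply: (cintegrable_le (g := fun x => M * normc (f x))).
- exact: cmeasurableM.
- by move=> x; rewrite normcM ler_wpM2r// normc_ge0.
- exact: rintegrableZl (cintegrable_normc If).
Qed.

Lemma cintegralD f g : cintegrable f -> cintegrable g ->
  cintegral (fun x => f x + g x) = cintegral f + cintegral g.
Proof.
move=> [fr fi] [gr gi]; rewrite /cintegral; apply: complexP; rewrite !cE /=.
  by under eq_Rintegral do rewrite cE; rewrite RintegralD.
by under eq_Rintegral do rewrite cE; rewrite RintegralD.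
Qed.

Lemma cintegralZl (c : R[i]) f : cintegrable f ->
  cintegral (fun x => c * f x) = c * cintegral f.
Proof.
move=> [ir ii]; rewrite /cintegral; apply: complexP; rewrite !cE /=.
  under eq_Rintegral do rewrite cE.
  rewrite RintegralB//; [|exact: rintegrableZl|exact: rintegrableZl].
  by rewrite !RintegralZl.
under eq_Rintegral do rewrite cE.
rewrite RintegralD//; [|exact: rintegrableZl|exact: rintegrableZl].
by rewrite !RintegralZl.
Qed.

Lemma cintegralN f : cintegrable f -> cintegral (fun x => - f x) = - cintegral f.
Proof.
move=> If; rewrite -mulN1r -cintegralZl//; congr cintegral.
by apply/funext => x; rewrite mulN1r.
Qed.

Lemma cintegralB f g : cintegrable f -> cintegrable g ->
  cintegral (fun x => f x - g x) = cintegral f - cintegral g.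
Proof. by move=> If Ig; rewrite cintegralD ?cintegralN//; exact: cintegrableN. Qed.

(** The factor 2 comes from bounding the real and imaginary parts separately; no later estimate
    depends on the sharp constant. *)
Lemma normc_cintegral_le f (g : Rn R n -> R) : cintegrable f -> rintegrable g ->
  (forall x, normc (f x) <= g x) -> normc (cintegral f) <= 2 * \int[mu]_x g x.
Proof.
move=> [fr fi] ig fg; apply: le_trans (ler_normc_ReIm _) _ => /=.
rewrite mulr2n mulrDl !mul1r; apply: lerD.
  apply: le_trans (le_normr_Rintegral measurableT fr) _.
  apply: le_Rintegral => //; first exact: (integrable_abse fr).
  by move=> x _; exact: le_trans (ler_Re_normc _) (fg x).
apply: le_trans (le_normr_Rintegral measurableT fi) _.
apply: le_Rintegral => //; first exact: (integrable_abse fi).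
by move=> x _; exact: le_trans (ler_Im_normc _) (fg x).
Qed.

Lemma ae_eq_Rintegral (h k : Rn R n -> R) :
  measurable_fun setT h -> measurable_fun setT k ->
  {ae mu, forall x, h x = k x} -> \int[mu]_x h x = \int[mu]_x k x.
Proof.
move=> mh mk hk; congr fine; apply: ae_eq_integral => //.
- exact/measurable_EFinP.
- exact/measurable_EFinP.
- by apply: filterS hk => x -> _.
Qed.

End complex_integral.

(** * Interchange of integrals *)

Section fubini.
Context d1 d2 (T1 : measurableType d1) (T2 : measurableType d2) {R : realType}
  (m1 : {sigma_finite_measure set T1 -> \bar R})
  (m2 : {sigma_finite_measure set T2 -> \bar R}).

(** Integrability of every section, rather than of almost every one, makes each inner real integral
    the [fine] part of a finite number, so [Fubini] can be used under [fine]. *)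
Lemma Rintegral_swap (f : T1 * T2 -> R) :
  (m1 \x m2)%E.-integrable setT (EFin \o f) ->
  (forall x, m2.-integrable setT (fun y => (f (x, y))%:E)) ->
  (forall y, m1.-integrable setT (fun x => (f (x, y))%:E)) ->
  \int[m1]_x (\int[m2]_y f (x, y)) = \int[m2]_y (\int[m1]_x f (x, y)).
Proof.
move=> If If2 If1.
have h1 x : ((\int[m2]_y f (x, y))%:E = \int[m2]_y (f (x, y))%:E)%E.
  by rewrite fineK//; apply: integrable_fin_num.
have h2 y : ((\int[m1]_x f (x, y))%:E = \int[m1]_x (f (x, y))%:E)%E.
  by rewrite fineK//; apply: integrable_fin_num.
rewrite /Rintegral; congr fine.
under eq_integral do rewrite h1.
under [RHS]eq_integral do rewrite h2.
exact: (Fubini If).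
Qed.

Lemma integrable_prod_dom (f : T1 * T2 -> R) (a : T1 -> R) (b : T2 -> R) :
  measurable_fun setT f ->
  (forall p, `|f p| <= a p.1 * b p.2) ->
  (forall x, 0 <= a x) -> (forall y, 0 <= b y) ->
  m1.-integrable setT (EFin \o a) -> m2.-integrable setT (EFin \o b) ->
  (m1 \x m2)%E.-integrable setT (EFin \o f).
Proof.
move=> mf fab a0 b0 ia ib.
have ma : measurable_fun setT a by apply/measurable_EFinP; exact: measurable_int ia.
have mb : measurable_fun setT b by apply/measurable_EFinP; exact: measurable_int ib.
apply: (@le_integrable _ _ _ _ setT measurableT _ (EFin \o (fun p => a p.1 * b p.2))).
- exact/measurable_EFinP.
- move=> p _ /=; rewrite lee_fin (le_trans (fab p))// ler_norm//.
have mab : measurable_fun setT (fun p : T1 * T2 => a p.1 * b p.2).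
  by apply: measurable_funM; apply: measurableT_comp.
apply/integrableP; split; first exact/measurable_EFinP.
under eq_integral do rewrite /= ger0_norm ?mulr_ge0//.
rewrite fubini_tonelli1; last 2 first.
- exact/measurable_EFinP.
- by move=> p; rewrite lee_fin mulr_ge0.
rewrite /fubini_F /=.
under eq_integral.
  move=> x _; under eq_integral do rewrite EFinM.
  rewrite ge0_integralZl//; last 3 first.
    - exact/measurable_EFinP.
    - by move=> y _; rewrite lee_fin.
    - by rewrite lee_fin.
  over.
rewrite ge0_integralZr//; last 3 first.
- exact/measurable_EFinP.
- by move=> y _; rewrite lee_fin.
- by apply: integral_ge0 => y _; rewrite lee_fin.
have abE d (T : measurableType d) (m : {measure set T -> \bar R}) (g : T -> R) :
    (forall x, 0 <= g x) ->
    m.-integrable setT (EFin \o g) -> (\int[m]_x (g x)%:E < +oo)%E.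
  move=> g0 /integrableP[_]; under eq_integral do rewrite /= ger0_norm//.
  by [].
have := abE _ _ _ _ a0 ia; have := abE _ _ _ _ b0 ib.
have : (0 <= \int[m1]_x (a x)%:E)%E by apply: integral_ge0 => y _; rewrite lee_fin.
have : (0 <= \int[m2]_x (b x)%:E)%E by apply: integral_ge0 => y _; rewrite lee_fin.
move: (\int[m1]_x (a x)%:E)%E (\int[m2]_x (b x)%:E)%E => [u| |] [v| |]//= _ _ _ _.
by rewrite ltry.
Qed.

End fubini.

Section cfubini.
Context {R : realType} {n : nat}.
Local Notation mu := (@lebesgue_Rn R n).
Local Notation rintegrable f := (mu.-integrable setT (EFin \o f)).

Lemma cintegral_swap (F : Rn R n -> Rn R n -> R[i]) (a b : Rn R n -> R) :
  measurable_fun setT (fun p : Rn R n * Rn R n => cRe (F p.1 p.2)) ->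
  measurable_fun setT (fun p : Rn R n * Rn R n => cIm (F p.1 p.2)) ->
  (forall x y, normc (F x y) <= a x * b y) ->
  (forall x, 0 <= a x) -> (forall y, 0 <= b y) ->
  rintegrable a -> rintegrable b ->
  cintegral (fun x => cintegral (F x)) = cintegral (fun y => cintegral (F ^~ y)).
Proof.
move=> mr mi Fab a0 b0 ia ib.
have key (G : Rn R n -> Rn R n -> R) :
    measurable_fun setT (fun p : Rn R n * Rn R n => G p.1 p.2) ->
    (forall x y, `|G x y| <= normc (F x y)) ->
    \int[mu]_x (\int[mu]_y G x y) = \int[mu]_y (\int[mu]_x G x y).
  move=> mG GF.
  apply: (@Rintegral_swap _ _ _ _ _ mu mu (fun p => G p.1 p.2)).
  - apply: (integrable_prod_dom mG _ a0 b0 ia ib) => p.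
    exact: le_trans (GF _ _) (Fab _ _).
  - move=> x; apply: (rintegrable_le (k := fun y => a x * b y)).
    + by apply: (measurableT_comp mG); exact: measurable_pair1.
    + by move=> y; exact: le_trans (GF _ _) (Fab _ _).
    + exact: rintegrableZl.
  - move=> y; apply: (rintegrable_le (k := fun x => b y * a x)).
    + by apply: (measurableT_comp mG); exact: measurable_pair2.
    + by move=> x; rewrite mulrC; exact: le_trans (GF _ _) (Fab _ _).
    + exact: rintegrableZl.
apply: complexP => /=; apply: key => // x y; [exact: ler_Re_normc|exact: ler_Im_normc].
Qed.

End cfubini.

(** * Derivatives on the real line *)

Section real_derivatives.
Context {R : realType}.
Implicit Types (f g : R -> R) (x a b d df dg h : R).

Lemma der_eq f x d d' : is_derive x 1 f d -> d = d' -> is_derive x 1 f d'.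
Proof. by move=> h <-. Qed.

Lemma der_ext f g x d : is_derive x 1 f d -> f =1 g -> is_derive x 1 g d.
Proof. by move=> h /funext <-. Qed.

Lemma der_cst (c : R) x : is_derive x 1 (fun _ : R => c) 0.
Proof. exact: is_derive_cst. Qed.

Lemma der_id x : is_derive x 1 (fun y : R => y) 1.
Proof. exact: is_derive_id. Qed.

Lemma der_D f g x df dg : is_derive x 1 f df -> is_derive x 1 g dg ->
  is_derive x 1 (fun y => f y + g y) (df + dg).
Proof. by move=> hf hg; exact: is_deriveD. Qed.

Lemma der_N f x df : is_derive x 1 f df -> is_derive x 1 (fun y => - f y) (- df).
Proof. by move=> hf; exact: is_deriveN. Qed.

Lemma der_B f g x df dg : is_derive x 1 f df -> is_derive x 1 g dg ->
  is_derive x 1 (fun y => f y - g y) (df - dg).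
Proof. by move=> hf hg; exact: is_deriveB. Qed.

Lemma der_M f g x df dg : is_derive x 1 f df -> is_derive x 1 g dg ->
  is_derive x 1 (fun y => f y * g y) (df * g x + f x * dg).
Proof.
move=> hf hg; apply: (@der_eq (f * g) x (f x *: dg + g x *: df)).
by rewrite /GRing.scale/= addrC mulrC.
Qed.

Lemma der_Zl (c : R) f x df : is_derive x 1 f df ->
  is_derive x 1 (fun y => c * f y) (c * df).
Proof.
by move=> hf; apply: der_eq (der_M (der_cst c x) hf) _; rewrite mul0r add0r.
Qed.

Lemma der_comp f g x df dg : is_derive (g x) 1 f df -> is_derive x 1 g dg ->
  is_derive x 1 (fun y => f (g y)) (df * dg).
Proof.
by move=> hf hg; exact: (@is_derive1_comp _ f g).
Qed.

Lemma der_exp f x df : is_derive x 1 f df ->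
  is_derive x 1 (fun y => expR (f y)) (expR (f x) * df).
Proof. by move=> hf; apply: (der_comp (f := expR)). Qed.

Lemma der_sin f x df : is_derive x 1 f df ->
  is_derive x 1 (fun y => sin (f y)) (cos (f x) * df).
Proof. by move=> hf; apply: (der_comp (f := sin)). Qed.

Lemma der_cos f x df : is_derive x 1 f df ->
  is_derive x 1 (fun y => cos (f y)) (- sin (f x) * df).
Proof. by move=> hf; apply: (der_comp (f := cos)). Qed.

Lemma der_sqr f x df : is_derive x 1 f df ->
  is_derive x 1 (fun y => f y ^+ 2) (2 * f x * df).
Proof.
move=> hf; apply: (@der_eq _ _ (df * f x + f x * df)); last by ring.
by apply: (der_ext (der_M hf hf)) => y; rewrite expr2.
Qed.

Lemma der_derivable f x df : is_derive x 1 f df -> derivable f x 1.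
Proof. by move=> h; exact: ex_derive. Qed.

Lemma der_cont f x df : is_derive x 1 f df -> {for x, continuous f}.
Proof. by move=> /der_derivable /derivable1_diffP/differentiable_continuous. Qed.

Lemma derE f x df : is_derive x 1 f df -> derive1 f x = df.
Proof. by move=> h; rewrite derive1E derive_val. Qed.

Lemma derP f x : derivable f x 1 -> is_derive x 1 f (derive1 f x).
Proof. by move=> h; rewrite derive1E; exact: derivableP. Qed.

Lemma MVT_der f (f' : R -> R) a b : a < b ->
  (forall z, a < z < b -> is_derive z 1 f (f' z)) ->
  {within `[a, b], continuous f} ->
  exists2 c, a < c < b & f b - f a = f' c * (b - a).
Proof.
move=> ab hf cf.
have hf' : forall z, z \in `]a, b[ -> is_derive z 1 f (f' z).
  by move=> z; rewrite in_itv/= => /hf.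
have [c] := MVT ab hf' cf; rewrite in_itv/= => cab e.
by exists c.
Qed.

Lemma MVT_derT f (f' : R -> R) a b : a < b ->
  (forall z, a <= z <= b -> is_derive z 1 f (f' z)) ->
  exists2 c, a < c < b & f b - f a = f' c * (b - a).
Proof.
move=> ab hf; apply: MVT_der => //.
  by move=> z /andP[? ?]; apply: hf; rewrite !ltW.
apply: continuous_in_subspaceT => z /[!inE]/=; rewrite in_itv/= => /hf.
exact: der_cont.
Qed.

Lemma MVT_bound f (f' : R -> R) a b (K : R) :
  (forall z, `|z - a| <= `|b - a| -> is_derive z 1 f (f' z)) ->
  (forall z, `|z - a| <= `|b - a| -> `|f' z| <= K) ->
  `|f b - f a| <= K * `|b - a|.
Proof.
move=> hf hK; have [ab|ba|->] := ltgtP a b; last by rewrite !subrr normr0 mulr0.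
- have [|c /andP[ac cb] ->] := @MVT_derT f f' a b ab.
    by move=> z /andP[az zb]; apply: hf; rewrite !ger0_norm ?subr_ge0 ?(ltW ab)// lerB.
  rewrite normrM ler_wpM2r// hK// !ger0_norm ?subr_ge0 ?(ltW ab) ?(ltW ac)//.
  by rewrite lerB// ltW.
- have [|c /andP[bc ca] e] := @MVT_derT f f' b a ba.
    by move=> z /andP[az zb]; apply: hf; rewrite !ler0_norm ?subr_le0 ?(ltW ba)// !opprB lerB.
  rewrite distrC e normrM (distrC b a) ler_wpM2r// hK// !ler0_norm ?subr_le0 ?(ltW ba) ?(ltW ca)//.
  by rewrite !opprB lerB// ltW.
Qed.

(** The mean value bound is used twice, for [f'] and for [f z - z * f' a], which yields [K] in place
    of [K / 2]. *)
Lemma taylor2_bound f (f' f'' : R -> R) a h (K : R) :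
  (forall z : R, is_derive z 1 f (f' z)) ->
  (forall z : R, is_derive z 1 f' (f'' z)) ->
  (forall z : R, `|z - a| <= `|h| -> `|f'' z| <= K) ->
  `|f (a + h) - f a - h * f' a| <= K * h ^+ 2.
Proof.
move=> hf hf' hK.
have K0 : 0 <= K by apply: le_trans (hK a _) => //; rewrite subrr normr0.
have b1 z : `|z - a| <= `|h| -> `|f' z - f' a| <= K * `|h|.
  move=> zh; apply: (@le_trans _ _ (K * `|z - a|)); last by rewrite ler_wpM2l.
  by apply: (@MVT_bound f' f'') => // w wz; apply: hK; exact: le_trans zh.
have := @MVT_bound (fun z => f z - z * f' a) (fun z => f' z - f' a) a (a + h) (K * `|h|).
rewrite addrAC subrr add0r => /(_ _ b1).
rewrite -mulrA -expr2 real_normK ?num_real// => H.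
rewrite (_ : f (a + h) - f a - h * f' a = f (a + h) - (a + h) * f' a - (f a - a * f' a)); last first.
  by ring.
apply: H => z _; apply: der_B => //.
by apply: der_eq (der_M (der_id z) (der_cst _ z)) _; rewrite mulr0 addr0 mul1r.
Qed.

(** Serves to differentiate under an integral: a second-order Taylor bound, integrated against a
    majorant, is exactly such a quadratic remainder. *)
Lemma der_quadratic f x (d C : R) : (forall h, `|h| <= 1 ->
  `|f (x + h) - f x - h * d| <= C * h ^+ 2) -> is_derive x 1 f d.
Proof.
move=> H.
have C0 : 0 <= C.
  have := H 1; rewrite normr1 expr1n mulr1 => /(_ (lexx _)); exact: le_trans.
have cv : h^-1 *: (f (h *: 1 + x) - f x) @[h --> 0^'] --> d.
  apply/cvgrPdist_le => e e0; near=> h.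
  have h0 : h != 0 by near: h; exact: nbhs_dnbhs_neq.
  have h1 : `|h| <= 1 by near: h; apply: dnbhs0_le.
  have hC : `|h| <= e / (C + 1).
    by near: h; apply: dnbhs0_le; rewrite divr_gt0// ltr_wpDl.
  have := H h h1; rewrite /GRing.scale/= mulr1 (addrC h x) => Hh.
  rewrite -(ler_pM2l (_ : 0 < `|h|)) ?normr_gt0//.
  rewrite -normrM mulrBr mulrA divff// mul1r distrC.
  apply: (le_trans Hh); rewrite -[in X in X <= _]real_normK ?num_real// expr2 mulrCA.
  rewrite ler_wpM2l//; rewrite ler_pdivlMr ?ltr_wpDl// in hC.
  apply: le_trans hC; rewrite mulrC ler_wpM2l// lerDl ler01//.
apply: DeriveDef.
  by apply/cvg_ex; exists d; exact: cv.
by apply: cvg_lim => //; exact: cv.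
Unshelve. all: by end_near.
Qed.

End real_derivatives.

(** * Partial derivatives *)

Section coordinates.
Context {R : realType} {n : nat}.
Implicit Types (x : Rn R n) (f g : Rn R n -> R[i]).

Definition setc (i : 'I_n) x (y : R) : Rn R n :=
  [tuple if j == i then y else (tnth x j : R) | j < n].

Lemma tnth_setc i x y j : tnth (setc i x y) j = (if j == i then y else tnth x j) :> R.
Proof. by rewrite tnth_mktuple. Qed.

Lemma setc_id i x : setc i x (tnth x i) = x.
Proof. by apply: eq_from_tnth => j; rewrite tnth_setc; case: eqP => [->|]. Qed.

Lemma setc_setc i x y z : setc i (setc i x y) z = setc i x z.
Proof. by apply: eq_from_tnth => j; rewrite !tnth_setc; case: eqP. Qed.

Lemma dotp_setc i x y : dotp (setc i x y) (setc i x y) =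
  dotp x x - (tnth x i : R) ^+ 2 + y ^+ 2.
Proof.
rewrite /dotp (bigD1 i)//= [in RHS](bigD1 i)//= !tnth_setc eqxx.
rewrite (eq_bigr (fun j => (tnth x j : R) * (tnth x j : R))).
  by ring.
by move=> j /negbTE ji; rewrite !tnth_setc ji.
Qed.

Lemma enorm_setc i x y : enorm x <= enorm (setc i x y) + `|y - tnth x i|.
Proof.
rewrite -(@ler_pXn2r _ 2)// ?nnegrE ?enorm_ge0 ?addr_ge0 ?enorm_ge0//.
have := ler_coord_enorm (setc i x y) i; rewrite tnth_setc eqxx.
rewrite sqrrD !sqr_enorm dotp_setc real_normK ?num_real//.
have := enorm_ge0 (setc i x y); have := normr_ge0 (y - tnth x i).
set e := enorm _; set a := (tnth x i : R) => d0 e0 ye.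
have : - (y * (y - a)) <= e * `|y - a|.
  rewrite -mulNr; apply: le_trans (ler_norm _) _.
  by rewrite normrM normrN ler_wpM2r.
rewrite -mulr_natl; nra.
Qed.

Lemma enorm_setc1 i x y : `|y - tnth x i| <= 1 ->
  1 + enorm x <= 2 * (1 + enorm (setc i x y)).
Proof.
move=> y1; have := enorm_setc i x y; have := enorm_ge0 (setc i x y); lra.
Qed.

(** A relation that carries existence together with the value. The function [partial] is total, so
    an equation for it alone would say nothing about differentiability. *)
Definition is_partial (i : 'I_n) f f' := forall x,
  is_derive (tnth x i : R) 1 (fun y => cRe (f (setc i x y))) (cRe (f' x)) /\
  is_derive (tnth x i : R) 1 (fun y => cIm (f (setc i x y))) (cIm (f' x)).

Lemma is_partial_line i f f' : is_partial i f f' -> forall x (y : R),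
  is_derive y 1 (fun y => cRe (f (setc i x y))) (cRe (f' (setc i x y))) /\
  is_derive y 1 (fun y => cIm (f (setc i x y))) (cIm (f' (setc i x y))).
Proof.
move=> H x y; have [] := H (setc i x y); rewrite tnth_setc eqxx.
by under eq_fun do rewrite setc_setc; under [X in _ -> is_derive _ _ X _ -> _]eq_fun do rewrite setc_setc.
Qed.

Lemma is_partialP i f f' : is_partial i f f' ->
  partial i f = f' /\ forall x, has_partial i f x.
Proof.
move=> H; split.
  apply/funext => x; have [hr hi] := H x; apply: complexP => /=; exact: derE.
by move=> x; have [hr hi] := H x; split; exact: der_derivable.
Qed.

Lemma has_partial_is_partial i f : (forall x, has_partial i f x) -> is_partial i f (partial i f).
Proof. by move=> H x; have [hr hi] := H x; split; [exact: (derP hr)|exact: (derP hi)]. Qed.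

Lemma is_partial_ext i f f' g' : is_partial i f f' -> f' =1 g' -> is_partial i f g'.
Proof. by move=> H /funext <-. Qed.

Lemma is_partialD i f f' g g' : is_partial i f f' -> is_partial i g g' ->
  is_partial i (fun x => f x + g x) (fun x => f' x + g' x).
Proof.
move=> Hf Hg x; have [fr fi] := Hf x; have [gr gi] := Hg x; rewrite !cE; split.
  by apply: (der_ext (der_D fr gr)) => y; rewrite cE.
by apply: (der_ext (der_D fi gi)) => y; rewrite cE.
Qed.

Lemma is_partialM i f f' g g' : is_partial i f f' -> is_partial i g g' ->
  is_partial i (fun x => f x * g x) (fun x => f' x * g x + f x * g' x).
Proof.
move=> Hf Hg x; have [fr fi] := Hf x; have [gr gi] := Hg x; split.
  apply: (@der_eq _ _ _ ((cRe (f' x) * cRe (g x) + cRe (f x) * cRe (g' x)) -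
    (cIm (f' x) * cIm (g x) + cIm (f x) * cIm (g' x)))); last by rewrite !cE; ring.
  rewrite -[in X in is_derive _ _ _ X](setc_id i x).
  have := der_B (der_M fr gr) (der_M fi gi); rewrite !setc_id => H.
  by apply: (der_ext H) => y; rewrite cE.
apply: (@der_eq _ _ _ ((cRe (f' x) * cIm (g x) + cRe (f x) * cIm (g' x)) +
    (cIm (f' x) * cRe (g x) + cIm (f x) * cRe (g' x)))); last by rewrite !cE; ring.
have := der_D (der_M fr gi) (der_M fi gr); rewrite !setc_id => H.
by apply: (der_ext H) => y; rewrite cE.
Qed.

Lemma is_partial_cst i (c : R[i]) : is_partial i (fun=> c) (fun=> 0).
Proof. by move=> x; split; exact: der_cst. Qed.

Lemma is_partialZl i (c : R[i]) f f' : is_partial i f f' ->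
  is_partial i (fun x => c * f x) (fun x => c * f' x).
Proof.
move=> H; apply: is_partial_ext (is_partialM (is_partial_cst i c) H) _ => x.
by rewrite mul0r add0r.
Qed.

Lemma is_partial_coord i j : is_partial i (fun x => (tnth x j : R)%:C) (fun=> (i == j)%:R).
Proof.
move=> x; split => /=; last first.
  by case: (i == j) => /=; exact: der_cst.
have [->|ij] := eqVneq i j.
  by apply: (der_ext (der_id _)) => y; rewrite tnth_setc eqxx.
apply: (der_ext (der_cst (tnth x j : R) (tnth x i : R))) => y.
by rewrite tnth_setc eq_sym (negbTE ij).
Qed.

Lemma is_partialR i (h h' : Rn R n -> R) :
  (forall x, is_derive (tnth x i : R) 1 (fun y => h (setc i x y)) (h' x)) ->
  is_partial i (fun x => (h x)%:C) (fun x => (h' x)%:C).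
Proof. by move=> H x; split => //=; exact: der_cst. Qed.

End coordinates.

(** * Schwartz functions and their Fourier transforms *)

Section schwartz_class.
Context {R : realType} {n : nat}.
Implicit Types (x : Rn R n) (f g phi : Rn R n -> R[i]).
Local Notation mu := (@lebesgue_Rn R n).
Local Notation rintegrable f := (mu.-integrable setT (EFin \o f)).

Definition rapid f := forall N : nat, exists M : R, forall x,
  (1 + enorm x) ^+ N * normc (f x) <= M.

Lemma enorm1_gt0 x : 0 < 1 + enorm x.
Proof. by rewrite ltr_pwDl// enorm_ge0. Qed.

(** The Schwartz functions form the largest class of rapidly decreasing functions stable under
    partial differentiation. Membership is thus proved by exhibiting a stable class [P], without
    handling iterated derivatives. *)
Lemma schwartz_coind (P : (Rn R n -> R[i]) -> Prop) :
  (forall f, P f -> rapid f /\ forall i, exists2 f', P f' & is_partial i f f') ->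
  forall f, P f -> schwartz f.
Proof.
move=> HP f Pf.
have Pit idx : P (iter_partial idx f).
  elim: idx => //= i idx IH; have [_ /(_ i)[f' Pf' /is_partialP[-> _]]] := HP _ IH.
  exact: Pf'.
move=> idx; have [rf H] := HP _ (Pit idx); split; last exact: rf.
by move=> i x; have [f' _ /is_partialP[_]] := H i.
Qed.

Lemma schwartz_rapid f : schwartz f -> rapid f.
Proof. by move=> /(_ [::])[]. Qed.

Lemma schwartz_is_partial f i : schwartz f -> is_partial i f (partial i f).
Proof. by move=> /(_ [::])[H _]; apply: has_partial_is_partial; exact: H. Qed.

Lemma schwartz_partial f i : schwartz f -> schwartz (partial i f).
Proof.
move=> Sf idx; have := Sf (rcons idx i).
by rewrite /iter_partial foldr_rcons.
Qed.

Lemma rapidD f g : rapid f -> rapid g -> rapid (fun x => f x + g x).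
Proof.
move=> rf rg N; have [A HA] := rf N; have [B HB] := rg N; exists (A + B) => x.
apply: le_trans (lerD (HA x) (HB x)); rewrite -mulrDr ler_wpM2l ?ler_normcD//.
by rewrite exprn_ge0// ltW// enorm1_gt0.
Qed.

Lemma rapidZl (c : R[i]) f : rapid f -> rapid (fun x => c * f x).
Proof.
move=> rf N; have [A HA] := rf N; exists (normc c * A) => x.
by rewrite normcM mulrCA ler_wpM2l ?normc_ge0.
Qed.

Lemma rapid_coordM i f : rapid f -> rapid (fun x => (tnth x i : R)%:C * f x).
Proof.
move=> rf N; have [A HA] := rf N.+1; exists A => x.
apply: le_trans (HA x); rewrite normcM normcR exprSr -mulrA.
rewrite ler_wpM2l ?exprn_ge0 ?(ltW (enorm1_gt0 _))// ler_wpM2r ?normc_ge0//.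
by rewrite (le_trans (ler_coord_enorm x i))// lerDr.
Qed.

Lemma schwartzD f g : schwartz f -> schwartz g -> schwartz (fun x => f x + g x).
Proof.
move=> Sf Sg.
apply: (@schwartz_coind (fun h => exists f g, [/\ schwartz f, schwartz g & h = fun x => f x + g x])).
  move=> _ [h [k [Sh Sk ->]]]; split; first by apply: rapidD; exact: schwartz_rapid.
  move=> i; exists (fun x => partial i h x + partial i k x).
    by exists (partial i h), (partial i k); split => //; exact: schwartz_partial.
  by apply: is_partialD; exact: schwartz_is_partial.
by exists f, g.
Qed.

Lemma schwartzZl (c : R[i]) f : schwartz f -> schwartz (fun x => c * f x).
Proof.
move=> Sf.
apply: (@schwartz_coind (fun h => exists2 f, schwartz f & h = fun x => c * f x)).
  move=> _ [h Sh ->]; split; first by apply: rapidZl; exact: schwartz_rapid.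
  move=> i; exists (fun x => c * partial i h x).
    by exists (partial i h) => //; exact: schwartz_partial.
  by apply: is_partialZl; exact: schwartz_is_partial.
by exists f.
Qed.

Lemma schwartz_ext f g : schwartz f -> f =1 g -> schwartz g.
Proof. by move=> Sf /funext <-. Qed.

Lemma schwartz0 : schwartz ((fun=> 0) : Rn R n -> R[i]).
Proof.
apply: (@schwartz_coind (fun h : Rn R n -> R[i] => h = fun=> 0)) => // _ ->; split.
  by move=> N; exists 0 => x; rewrite normcE /= expr0n addr0 sqrtr0 mulr0.
by move=> i; exists (fun=> 0) => //; exact: is_partial_cst.
Qed.

Lemma schwartz_coordM j f : schwartz f -> schwartz (fun x => (tnth x j : R)%:C * f x).
Proof.
move=> Sf.
(* The summand [g] makes the class stable: it absorbs the term in which the derivative falls on the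
   coordinate. *)
apply: (@schwartz_coind (fun h => exists f g, [/\ schwartz f, schwartz g &
   h = fun x => (tnth x j : R)%:C * f x + g x])).
  move=> _ [h [k [Sh Sk ->]]]; split.
    apply: rapidD; last exact: schwartz_rapid.
    by apply: rapid_coordM; exact: schwartz_rapid.
  move=> i; exists (fun x => (tnth x j : R)%:C * partial i h x +
                      ((i == j)%:R * h x + partial i k x)).
    exists (partial i h), (fun x => (i == j)%:R * h x + partial i k x); split => //.
      exact: schwartz_partial.
    by apply: schwartzD; [exact: schwartzZl|exact: schwartz_partial].
  apply: is_partial_ext (is_partialD (is_partialM (is_partial_coord i j)
    (schwartz_is_partial i Sh)) (schwartz_is_partial i Sk)) _ => x.
  by rewrite addrA; congr (_ + _); rewrite addrC.
exists f, (fun=> 0); split => //; first exact: schwartz0.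
by apply/funext => x; rewrite addr0.
Qed.

Lemma schwartz_bound f : schwartz f -> exists2 M, 0 <= M & forall x, normc (f x) <= M.
Proof.
move=> /schwartz_rapid /(_ 0%N)[M HM]; exists M.
  by apply: le_trans (HM [tuple 0 | i < n]); rewrite mul1r normc_ge0.
by move=> x; have := HM x; rewrite mul1r.
Qed.

Definition lipschitz_coord (h : Rn R n -> R) (L : R) := forall x y,
  `|h x - h y| <= L * \sum_(i < n) `|(tnth x i : R) - tnth y i|.

Lemma lipschitz_coord_setc (h : Rn R n -> R) (L : R) :
  (forall i x y z, `|h (setc i x y) - h (setc i x z)| <= L * `|y - z|) ->
  lipschitz_coord h L.
Proof.
move=> H x y.
(* The path from [x] to [y] changes one coordinate at a time; [mix k] has the first [k] coordinates
   of [y]. *)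
pose mix k : Rn R n := [tuple if (j < k)%N then (tnth y j : R) else tnth x j | j < n].
have mix0 : mix 0%N = x by apply: eq_from_tnth => j; rewrite tnth_mktuple.
have mixn : mix n = y by apply: eq_from_tnth => j; rewrite tnth_mktuple ltn_ord.
have step (k : nat) : (k <= n)%N ->
    `|h x - h (mix k)| <= L * \sum_(i < n | (i < k)%N) `|(tnth x i : R) - tnth y i|.
  elim: k => [_|k IH kn].
    by rewrite mix0 subrr normr0 big_pred0// mulr0.
  pose i := Ordinal kn.
  have -> : \sum_(j < n | (j < k.+1)%N) `|(tnth x j : R) - tnth y j| =
      `|(tnth x i : R) - tnth y i| + \sum_(j < n | (j < k)%N) `|(tnth x j : R) - tnth y j|.
    rewrite (bigD1 i)//=; congr (_ + _); apply: eq_bigl => j.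
    rewrite ltnS -(inj_eq val_inj) /= ltn_neqAle andbC; exact: erefl.
  have e1 : mix k.+1 = setc i (mix k) (tnth y i).
    apply: eq_from_tnth => j; rewrite tnth_setc !tnth_mktuple ltnS leq_eqVlt.
    by rewrite -(inj_eq val_inj) /=; case: eqP => //= jk; congr (tnth y _); exact: val_inj.
  have e2 : mix k = setc i (mix k) (tnth x i).
    apply: eq_from_tnth => j; rewrite tnth_setc !tnth_mktuple.
    by case: eqP => // ->; rewrite /= ltnn.
  rewrite (_ : h x - h (mix k.+1) = (h (mix k) - h (mix k.+1)) + (h x - h (mix k))); last by ring.
  apply: le_trans (ler_normD _ _) _; rewrite mulrDr; apply: lerD; last exact: IH (ltnW kn).
  by rewrite e1 [X in h X - _]e2.
have := step n (leqnn n); rewrite mixn.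
by rewrite (eq_bigl xpredT)// => j; rewrite ltn_ord.
Qed.

Lemma schwartz_lipschitz f : schwartz f -> exists2 L, 0 <= L &
  lipschitz_coord (fun x => cRe (f x)) L /\ lipschitz_coord (fun x => cIm (f x)) L.
Proof.
move=> Sf.
have [M HM] : {M : 'I_n -> R & forall i x, normc (partial i f x) <= M i}.
  apply: (@choice _ _ (fun i m => forall x, normc (partial i f x) <= m)) => i.
  by have [M _ HM] := schwartz_bound (schwartz_partial i Sf); exists M.
pose L := \sum_(i < n) `|M i|.
have L0 : 0 <= L by apply: sumr_ge0.
have HL i x : normc (partial i f x) <= L.
  apply: (le_trans (HM i x)); apply: (le_trans (ler_norm _)).
  by rewrite /L (bigD1 i)//= lerDl sumr_ge0.
exists L => //; split; apply: lipschitz_coord_setc => i x y z.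
  apply: (@MVT_bound _ (fun y => cRe (f (setc i x y))) (fun y => cRe (partial i f (setc i x y)))) => w _.
    by have [] := is_partial_line (schwartz_is_partial i Sf) x w.
  exact: le_trans (ler_Re_normc _) (HL _ _).
apply: (@MVT_bound _ (fun y => cIm (f (setc i x y))) (fun y => cIm (partial i f (setc i x y)))) => w _.
  by have [] := is_partial_line (schwartz_is_partial i Sf) x w.
exact: le_trans (ler_Im_normc _) (HL _ _).
Qed.

Lemma measurable_countable_range (T : countType) (k : Rn R n -> T) (g : T -> R) :
  (forall z, measurable (k @^-1` [set z])) -> measurable_fun setT (g \o k).
Proof.
move=> mk _ B mB; rewrite setTI.
have -> : (g \o k) @^-1` B = \bigcup_(z : T) (if `[<B (g z)>] then k @^-1` [set z] else set0).
  apply/seteqP; split => [x /= Bx|x [z _]].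
    by exists (k x) => //; case: asboolP.
  by case: asboolP => // Bz /= ->.
apply: countable_bigcupT_measurable; first exact: countableP.
by move=> z; case: asboolP.
Qed.

(** The function is the pointwise limit of its values on grids of mesh [1 / (m + 1)]. These depend
    only on a tuple of integer parts, so they take countably many values on measurable cells. *)
Lemma lipschitz_measurable (h : Rn R n -> R) (L : R) :
  lipschitz_coord h L -> measurable_fun setT h.
Proof.
move=> hL.
pose k (m : nat) (x : Rn R n) : n.-tuple int := [tuple Num.floor ((tnth x i : R) * m.+1%:R) | i < n].
pose g (m : nat) (z : n.-tuple int) : R := h [tuple (tnth z i)%:~R / m.+1%:R | i < n].
have mgk m : measurable_fun setT (g m \o k m).
  apply: measurable_countable_range => z.
  have -> : k m @^-1` [set z] =
      \bigcap_(i in [set: 'I_n]) ((fun x : Rn R n => (tnth x i : R) * m.+1%:R) @^-1`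
          `[(tnth z i)%:~R, (tnth z i + 1)%:~R[%classic).
    apply/seteqP; split => x /=.
      move=> <- i _ /=; rewrite in_itv /= tnth_mktuple.
      exact: floor_itv.
    move=> H; apply: eq_from_tnth => i; rewrite tnth_mktuple; apply: floor_def.
    by have := H i I; rewrite /= in_itv.
  apply: fin_bigcap_measurable => // i _; rewrite -[X in measurable X]setTI.
  suff : measurable_fun setT (fun x : Rn R n => (tnth x i : R) * m.+1%:R) by apply.
  by apply: measurable_funM => //; exact: measurable_coord.
apply: (@measurable_fun_cvg _ _ _ setT (fun m => g m \o k m) h) => //.
move=> x _.
have L0 : 0 <= `|L| * n%:R by rewrite mulr_ge0.
apply/cvgrPdist_le => e e0; near=> m.
have me : (`|L| * n%:R) / m.+1%:R <= e.
  have m0 : (`|L| * n%:R) / e <= m.+1%:R.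
    near: m; exists (Num.truncn (`|L| * n%:R / e)) => // j /= jm.
    apply: ltW; apply: (lt_le_trans (truncnS_gt _)); rewrite ler_nat ltnS//.
  by rewrite ler_pdivrMr// [e * _]mulrC -ler_pdivrMr.
apply: le_trans me => /=; rewrite /g; apply: (le_trans (hL _ _)).
apply: (@le_trans _ _ (`|L| * \sum_(i < n) m.+1%:R^-1)); last first.
  by rewrite sumr_const card_ord -[_ *+ n]mulr_natl mulrA.
apply: (@le_trans _ _ (`|L| * \sum_(i < n) `|(tnth x i : R) - tnth [tuple (tnth (k m x) i0)%:~R / m.+1%:R | i0 < n] i|)).
  by rewrite ler_wpM2r ?ler_norm// sumr_ge0.
rewrite ler_wpM2l//; apply: ler_sum => i _; rewrite !tnth_mktuple.
have := floor_itv ((tnth x i : R) * m.+1%:R).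
set z := Num.floor _; rewrite intrD => /andP[z1 z2].
have m0 : (0 : R) < m.+1%:R by [].
rewrite ger0_norm ?subr_ge0 ?ler_pdivrMr//.
rewrite -(ler_pM2r m0) mulrBl mulfVK ?gt_eqF// mulVf ?gt_eqF//.
rewrite lerBlDl ltW//.
Unshelve. all: by end_near.
Qed.

Lemma schwartz_measurable f : schwartz f -> cmeasurable f.
Proof.
by move=> /schwartz_lipschitz[L _ [Hr Hi]]; split; apply: lipschitz_measurable; [exact: Hr|exact: Hi].
Qed.

Lemma rapid_integrable f : cmeasurable f -> rapid f -> cintegrable f.
Proof.
move=> mf /(_ (2 * n)%N)[M HM]; apply/cintegrableP; split => //.
apply: (@integrable_decay _ _ _ M); first exact: cmeasurable_normc.
by move=> x; rewrite ger0_norm ?normc_ge0.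
Qed.

Lemma schwartz_integrable f : schwartz f -> cintegrable f.
Proof.
by move=> Sf; apply: rapid_integrable; [exact: schwartz_measurable|exact: schwartz_rapid].
Qed.

End schwartz_class.

(** * The Fourier transform on the Schwartz class *)

Section fourier_schwartz.
Context {R : realType} {n : nat}.
Implicit Types (x xi : Rn R n) (f g phi : Rn R n -> R[i]).
Local Notation mu := (@lebesgue_Rn R n).
Local Notation rintegrable f := (mu.-integrable setT (EFin \o f)).
Local Notation c0 := (((2 * pi) `^ (- (n%:R / 2)))%:C : R[i]).

Lemma cmeasurable_wave (h : Rn R n) (s : R) : cmeasurable (fun x : Rn R n => expi (s * dotp x h)).
Proof.
apply: cmeasurable_expi; apply: measurable_funM => //.
by apply: measurable_dotp => //; exact: measurable_cst.
Qed.

Lemma cmeasurable_waveN (h : Rn R n) : cmeasurable (fun x : Rn R n => expi (- dotp x h)).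
Proof. by have := cmeasurable_wave h (-1); under eq_fun do rewrite mulN1r. Qed.

Lemma cintegrable_wave f xi : cintegrable f -> cintegrable (fun x => expi (- dotp x xi) * f x).
Proof.
move=> If; apply: (cintegrable_bddM (M := 1)) => //; first exact: cmeasurable_waveN.
by move=> x; rewrite normc_expi.
Qed.

Lemma fourierD f g : cintegrable f -> cintegrable g ->
  fourier (fun x => f x + g x) = (fun xi => fourier f xi + fourier g xi).
Proof.
move=> If Ig; apply/funext => xi; rewrite /fourier -mulrDr -cintegralD; [|exact: cintegrable_wave..].
by congr (_ * cintegral _); apply/funext => x; rewrite mulrDr.
Qed.

Lemma fourierZl (c : R[i]) f : cintegrable f ->
  fourier (fun x => c * f x) = (fun xi => c * fourier f xi).
Proof.
move=> If; apply/funext => xi; rewrite /fourier mulrCA -[c * _]cintegralZl; last exact: cintegrable_wave.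
by congr (_ * cintegral _); apply/funext => x; rewrite mulrCA.
Qed.

Lemma cintegral0 : cintegral ((fun=> 0) : Rn R n -> R[i]) = 0.
Proof.
by apply: complexP => /=; rewrite Rintegral_cst// mul0r.
Qed.

Lemma cintegrable0 : cintegrable ((fun=> 0) : Rn R n -> R[i]).
Proof. by apply: schwartz_integrable; exact: schwartz0. Qed.

Lemma fourier0 : fourier ((fun=> 0) : Rn R n -> R[i]) = fun=> 0.
Proof.
apply/funext => xi; rewrite /fourier (_ : (fun _ => _) = fun=> 0) ?cintegral0 ?mulr0//.
by apply/funext => x; rewrite mulr0.
Qed.

Lemma cintegrable_sum (I : Type) (s : seq I) (F : I -> Rn R n -> R[i]) :
  (forall i, cintegrable (F i)) -> cintegrable (fun x => \sum_(i <- s) F i x).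
Proof.
move=> IF; elim: s => [|i s IH].
  by under eq_fun do rewrite big_nil; exact: cintegrable0.
by under eq_fun do rewrite big_cons; exact: cintegrableD.
Qed.

Lemma fourier_sum (I : Type) (s : seq I) (F : I -> Rn R n -> R[i]) xi :
  (forall i, cintegrable (F i)) ->
  fourier (fun x => \sum_(i <- s) F i x) xi = \sum_(i <- s) fourier (F i) xi.
Proof.
move=> IF; elim: s => [|i s IH].
  by under eq_fun do rewrite big_nil; rewrite big_nil fourier0.
under eq_fun do rewrite big_cons; rewrite big_cons -IH fourierD//.
exact: cintegrable_sum.
Qed.

Lemma fourier_bound f xi : cintegrable f ->
  normc (fourier f xi) <= (2 * pi) `^ (- (n%:R / 2)) * (2 * \int[mu]_x normc (f x)).
Proof.
move=> If; rewrite /fourier normcM normcR ger0_norm ?powR_ge0// ler_wpM2l ?powR_ge0//.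
apply: normc_cintegral_le; first exact: cintegrable_wave.
  exact: cintegrable_normc.
by move=> x; rewrite normcM normc_expi mul1r.
Qed.

Lemma normc_expi_taylor (t : R) : normc (expi t - 1 - 'i%C * t%:C) <= 2 * t ^+ 2.
Proof.
apply: le_trans (ler_normc_ReIm _) _.
have -> : cRe (expi t - 1 - 'i%C * t%:C) = cos t - 1 by rewrite !cE /=; ring.
have -> : cIm (expi t - 1 - 'i%C * t%:C) = sin t - t by rewrite !cE /=; ring.
rewrite mulr2n mulrDl !mul1r; apply: lerD.
  have := @taylor2_bound _ cos (fun t => - sin t) (fun t => - cos t) 0 t 1.
  rewrite add0r cos0 sin0 oppr0 mulr0 subr0 mul1r; apply.
  by move=> z _; rewrite normrN ler_norml cos_geN1 cos_le1.
have := @taylor2_bound _ sin cos (fun t => - sin t) 0 t 1.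
rewrite add0r sin0 cos0 mulr1 subr0 mul1r; apply.
by move=> z _; rewrite normrN ler_norml sin_geN1 sin_le1.
Qed.

Lemma dotp_setcr j x xi (y : R) :
  dotp x (setc j xi y) = dotp x xi + (tnth x j : R) * (y - tnth xi j).
Proof.
rewrite /dotp (bigD1 j)//= [in RHS](bigD1 j)//= tnth_setc eqxx.
rewrite (eq_bigr (fun i => (tnth x i : R) * (tnth xi i : R))); first by ring.
by move=> i /negbTE ij; rewrite tnth_setc ij.
Qed.

(** The second moment is required because the Taylor remainder of the wave is quadratic in
    [h * x_j]; it gives the constant [K] for [der_quadratic]. *)
Lemma is_partial_fourier j f : cintegrable f ->
  cintegrable (fun x => (tnth x j : R)%:C * f x) ->
  cintegrable (fun x => (tnth x j : R)%:C * ((tnth x j : R)%:C * f x)) ->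
  is_partial j (fourier f) (fourier (fun x => - 'i%C * ((tnth x j : R)%:C * f x))).
Proof.
move=> If I1 I2 xi.
pose K := 2 * (\int[mu]_x (2 * normc ((tnth x j : R)%:C * ((tnth x j : R)%:C * f x)))).
have key (h : R) : normc (fourier f (setc j xi (tnth xi j + h)) - fourier f xi -
    h%:C * fourier (fun x => - 'i%C * ((tnth x j : R)%:C * f x)) xi) <= (normc c0 * K) * h ^+ 2.
  have IJ : cintegrable (fun x => - 'i%C * ((tnth x j : R)%:C * f x)) by exact: cintegrableZl.
  have -> : fourier f (setc j xi (tnth xi j + h)) - fourier f xi -
      h%:C * fourier (fun x => - 'i%C * ((tnth x j : R)%:C * f x)) xi =
      c0 * cintegral (fun x => expi (- dotp x xi) *
        ((expi (- h * tnth x j) - 1 - 'i%C * (- h * tnth x j)%:C) * f x)).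
    rewrite /fourier [h%:C * _]mulrCA -!mulrBr; congr (_ * _).
    rewrite -cintegralZl; last exact: cintegrable_wave.
    rewrite -(cintegralB (cintegrable_wave _ If) (cintegrable_wave _ If)).
    rewrite -cintegralB; [|by apply: cintegrableB; exact: cintegrable_wave|
      by apply: cintegrableZl; exact: cintegrable_wave].
    congr cintegral; apply/funext => x.
    have -> : dotp x (setc j xi (tnth xi j + h)) = dotp x xi + tnth x j * h.
      by rewrite dotp_setcr; congr (_ + _ * _); ring.
    rewrite opprD expiD.
    rewrite (_ : - (tnth x j * h) = - h * tnth x j :> R); last by rewrite mulrC mulNr.
    rewrite rmorphM rmorphN /=; ring.
  rewrite normcM -mulrA ler_wpM2l ?normc_ge0//.
  have IK : rintegrable (fun x => 2 * normc ((tnth x j : R)%:C * ((tnth x j : R)%:C * f x))).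
    by apply: rintegrableZl; exact: cintegrable_normc.
  have bnd x : normc (expi (- dotp x xi) *
     ((expi (- h * tnth x j) - 1 - 'i%C * (- h * tnth x j)%:C) * f x)) <=
     h ^+ 2 * (2 * normc ((tnth x j : R)%:C * ((tnth x j : R)%:C * f x))).
    rewrite 2!normcM normc_expi mul1r.
    rewrite [normc (_%:C * _)]normcM [normc (_%:C * _)]normcM normcR.
    have -> : h ^+ 2 * (2 * (`|tnth x j : R| * (`|tnth x j : R| * normc (f x)))) =
        2 * (- h * tnth x j) ^+ 2 * normc (f x).
      by rewrite exprMn -[tnth x j ^+ 2](@real_normK R) ?num_real// sqrrN; ring.
    by rewrite ler_wpM2r ?normc_ge0// normc_expi_taylor.
  rewrite /K -mulrA (mulrC _ (h ^+ 2)) -RintegralZl//.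
  apply: normc_cintegral_le => //; last exact: rintegrableZl.
  apply: (cintegrable_le _ bnd); last exact: rintegrableZl.
  apply: cmeasurableM; first exact: cmeasurable_waveN.
  apply: cmeasurableM; last exact: cintegrable_measurable.
  have mt : measurable_fun setT (fun x : Rn R n => - h * tnth x j : R).
    by apply: measurable_funM => //; exact: measurable_coord.
  apply: cmeasurableB.
    apply: cmeasurableB; last exact: cmeasurable_cst.
    exact: cmeasurable_expi.
  by apply: cmeasurableM; [exact: cmeasurable_cst|exact: cmeasurableR].
split.
  apply: (@der_quadratic _ _ _ _ (normc c0 * K)) => h _; rewrite setc_id.
  apply: le_trans (key h); apply: le_trans (ler_Re_normc _).
  by rewrite cRe_increment.
apply: (@der_quadratic _ _ _ _ (normc c0 * K)) => h _; rewrite setc_id.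
apply: le_trans (key h); apply: le_trans (ler_Im_normc _).
by rewrite cIm_increment.
Qed.

Lemma Rintegral_shiftn (a : Rn R n) (h : Rn R n -> R) : measurable_fun setT h ->
  \int[mu]_x h (shiftn a x) = \int[mu]_x h x.
Proof.
move=> mh; congr fine.
have mh' : measurable_fun setT (EFin \o h) by exact/measurable_EFinP.
rewrite integralE [RHS]integralE; congr (_ - _)%E.
  transitivity (\int[mu]_x ((EFin \o h)^\+ (shiftn a x)))%E.
    by apply: eq_integral => x _; rewrite !funeposE.
  by apply: ge0_integral_shiftn => //; exact: measurable_funepos.
transitivity (\int[mu]_x ((EFin \o h)^\- (shiftn a x)))%E.
  by apply: eq_integral => x _; rewrite !funenegE.
by apply: ge0_integral_shiftn => //; exact: measurable_funeneg.
Qed.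

Lemma cintegral_shiftn (a : Rn R n) f : cmeasurable f ->
  cintegral (fun x => f (shiftn a x)) = cintegral f.
Proof.
by move=> [mr mi]; apply: complexP => /=; [exact: (Rintegral_shiftn _ mr)|exact: (Rintegral_shiftn _ mi)].
Qed.

Lemma shiftn_setc j x (h : R) :
  shiftn [tuple if i == j then h else 0 | i < n] x = setc j x (tnth x j + h).
Proof.
apply: eq_from_tnth => i; rewrite tnth_setc !tnth_mktuple.
by case: eqP => [->|_]; rewrite ?add0r// addrC.
Qed.

Lemma cmeasurable_shiftn (a : Rn R n) f : cmeasurable f -> cmeasurable (fun x => f (shiftn a x)).
Proof.
by move=> [mr mi]; split; [apply: (measurableT_comp mr)|apply: (measurableT_comp mi)];
  exact: measurable_shiftn.
Qed.

Lemma cintegrable_shiftn (a : Rn R n) f : cintegrable f -> cintegrable (fun x => f (shiftn a x)).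
Proof.
move=> /cintegrableP[mf nf]; apply/cintegrableP; split; first exact: cmeasurable_shiftn.
have mn := cmeasurable_normc mf.
apply/integrableP; split.
  by apply/measurable_EFinP; exact: (cmeasurable_normc (cmeasurable_shiftn a mf)).
move/integrableP : nf => [_]; apply: le_lt_trans; rewrite le_eqVlt; apply/orP; left; apply/eqP.
apply: (ge0_integral_shiftn a (f := fun x => `|(normc (f x))%:E|%E)) => //.
by apply: measurableT_comp => //; exact/measurable_EFinP.
Qed.

(** By translation invariance the increment [f (x + h e_j) - f x] has integral 0, so [h] times the
    integral of [f1] equals the integral of a Taylor remainder up to sign. That remainder is of
    order [h ^ 2]; dividing by [h] and letting it tend to 0 concludes. The decay of [f2] makes the
    remainder integrable. *)
Lemma cintegral_partial0 j f f1 f2 : is_partial j f f1 -> is_partial j f1 f2 ->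
  cintegrable f -> cintegrable f1 -> rapid f2 -> cintegral f1 = 0.
Proof.
move=> p1 p2 If I1 r2.
have [M HM] := r2 (2 * n)%N.
pose K (x : Rn R n) := 2 * (M * (2 ^+ (2 * n) / (1 + enorm x) ^+ (2 * n))).
have E0 (x : Rn R n) : 0 < (1 + enorm x) ^+ (2 * n) by rewrite exprn_gt0// enorm1_gt0.
have M0 : 0 <= M.
  by apply: le_trans (HM [tuple 0 | i < n]); rewrite mulr_ge0 ?normc_ge0// ltW.
have mK : measurable_fun setT K.
  apply: measurable_funM => //; apply: measurable_funM => //; apply: measurable_funM => //.
  under eq_fun => x do rewrite -powR_inv1 ?(ltW (E0 x))//.
  apply: (measurableT_comp (f := fun y : R => y `^ (-1))); first exact: measurable_powR.
  by apply: measurable_funX; apply: measurable_funD => //; exact: measurable_enorm.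
have IK : rintegrable K.
  apply: (@integrable_decay _ _ _ (2 * (M * 2 ^+ (2 * n)))) => // x.
  rewrite ger0_norm; last first.
    by rewrite mulr_ge0// mulr_ge0// divr_ge0// ?exprn_ge0// ltW// enorm1_gt0.
  by rewrite /K mulrC !mulrA mulfVK// gt_eqF.
(* A shift of at most 1 changes the weight [1 + enorm x] by a factor at most 2, whence a majorant
   that does not depend on [z]. *)
have f2K x (z : R) : `|z - tnth x j| <= 1 -> normc (f2 (setc j x z)) <= M * (2 ^+ (2 * n) / (1 + enorm x) ^+ (2 * n)).
  move=> z1; have := enorm_setc1 z1; set y := setc j x z => xy.
  have : normc (f2 y) <= M / (1 + enorm y) ^+ (2 * n) by rewrite ler_pdivlMr// mulrC.
  move=> /le_trans; apply; rewrite ler_wpM2l//.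
  rewrite -[X in X <= _]mul1r ler_pdivrMr// mulrAC ler_pdivlMr// mul1r -exprMn.
  by rewrite lerXn2r// nnegrE ?mulr_ge0// ltW// enorm1_gt0.
have key (h : R) : `|h| <= 1 -> normc (h%:C * cintegral f1) <= (2 * \int[mu]_x K x) * h ^+ 2.
  move=> h1.
  have -> : h%:C * cintegral f1 = - cintegral (fun x => f (setc j x (tnth x j + h)) - f x - h%:C * f1 x).
    have IS : cintegrable (fun x => f (setc j x (tnth x j + h))).
      have := cintegrable_shiftn [tuple if i == j then h else 0 | i < n] If.
      by under eq_fun do rewrite shiftn_setc.
    rewrite cintegralB; [|by apply: cintegrableB|by apply: cintegrableZl].
    rewrite cintegralB// cintegralZl//.
    have -> : cintegral (fun x => f (setc j x (tnth x j + h))) = cintegral f.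
      rewrite -(cintegral_shiftn [tuple if i == j then h else 0 | i < n] (cintegrable_measurable If)).
      by congr cintegral; apply/funext => x; rewrite shiftn_setc.
    by rewrite subrr sub0r opprK.
  have bnd x : normc (f (setc j x (tnth x j + h)) - f x - h%:C * f1 x) <= h ^+ 2 * K x.
    apply: le_trans (ler_normc_ReIm _) _.
    set B := M * (2 ^+ (2 * n) / (1 + enorm x) ^+ (2 * n)).
    have -> : h ^+ 2 * K x = B * h ^+ 2 + B * h ^+ 2 by rewrite /K -/B; ring.
    apply: lerD.
      have := @taylor2_bound _ (fun y => cRe (f (setc j x y))) (fun y => cRe (f1 (setc j x y)))
         (fun y => cRe (f2 (setc j x y))) (tnth x j) h B.
      rewrite setc_id cRe_increment; apply.
      + by move=> z; have [] := is_partial_line p1 x z.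
      + by move=> z; have [] := is_partial_line p2 x z.
      + by move=> z zh; apply: le_trans (ler_Re_normc _) _; apply: f2K; exact: le_trans zh h1.
    have := @taylor2_bound _ (fun y => cIm (f (setc j x y))) (fun y => cIm (f1 (setc j x y)))
       (fun y => cIm (f2 (setc j x y))) (tnth x j) h B.
    rewrite setc_id cIm_increment; apply.
    + by move=> z; have [] := is_partial_line p1 x z.
    + by move=> z; have [] := is_partial_line p2 x z.
    + by move=> z zh; apply: le_trans (ler_Im_normc _) _; apply: f2K; exact: le_trans zh h1.
  rewrite normcN -mulrA (mulrC _ (h ^+ 2)) -RintegralZl//.
  apply: normc_cintegral_le => //; last exact: rintegrableZl.
  apply: (cintegrable_le _ bnd); last exact: rintegrableZl.
  apply: cmeasurableB.
    apply: cmeasurableB; last exact: cintegrable_measurable.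
    have := cmeasurable_shiftn [tuple if i == j then h else 0 | i < n] (cintegrable_measurable If).
    by under eq_fun do rewrite shiftn_setc.
  by apply: cmeasurableM; [exact: cmeasurable_cst|exact: cintegrable_measurable].
apply: Normc.eq0_normc; apply/eqP; rewrite eq_le normc_ge0 andbT.
apply/ler_addgt0Pl => e e0; rewrite addr0.
set C := 2 * \int[mu]_x K x in key.
pose h := Num.min 1 (e / (`|C| + 1)).
have C1 : 0 < `|C| + 1 by rewrite ltr_wpDl.
have h0 : 0 < h by rewrite lt_min ltr01 divr_gt0.
have := key h; rewrite ger0_norm ?(ltW h0)// ge_min lexx => /(_ isT).
rewrite normcM normcR ger0_norm ?(ltW h0)// expr2 mulrCA ler_pM2l// => /le_trans; apply.
apply: (@le_trans _ _ ((`|C| + 1) * h)).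
  by rewrite ler_wpM2r ?(ltW h0)// (le_trans (ler_norm C))// lerDl.
by rewrite mulrC -ler_pdivlMr// ge_min lexx orbT.
Qed.

Lemma is_partial_wave j xi :
  is_partial j (fun x => expi (- dotp x xi)) (fun x => - 'i%C * (tnth xi j : R)%:C * expi (- dotp x xi)).
Proof.
move=> x.
have d1 : is_derive (tnth x j : R) 1 (fun y => - dotp (setc j x y) xi) (- (tnth xi j : R)).
  have dc z : dotp (setc j x z) xi = dotp x xi + (tnth xi j : R) * (z - tnth x j).
    rewrite (_ : dotp (setc j x z) xi = dotp xi (setc j x z)); last first.
      by apply: eq_bigr => i _; rewrite mulrC.
    by rewrite dotp_setcr; congr (_ + _); apply: eq_bigr => i _; rewrite mulrC.
  have D : is_derive (tnth x j : R) 1 (fun z : R => - (dotp x xi + (tnth xi j : R) * (z - tnth x j))) (- (0 + (tnth xi j : R) * (1 - 0))).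
    exact: (der_N (der_D (der_cst _ _) (der_Zl _ (der_B (der_id _) (der_cst _ _))))).
  apply: (@der_eq _ _ _ (- (0 + (tnth xi j : R) * (1 - 0)))); last by rewrite subr0 mulr1 add0r.
  by apply: (der_ext D) => z; rewrite dc.
split => /=.
  apply: der_eq (der_cos d1) _; rewrite setc_id; ring.
apply: der_eq (der_sin d1) _; rewrite setc_id; ring.
Qed.

Lemma fourier_partial j f xi : schwartz f ->
  fourier (partial j f) xi = 'i%C * (tnth xi j : R)%:C * fourier f xi.
Proof.
move=> Sf; have S1 := schwartz_partial j Sf.
set c := 'i%C * _; pose e (x : Rn R n) : R[i] := expi (- dotp x xi).
(* [D] is the partial derivative conjugated by the wave: the derivative of [e * g] is [e * D g]. The
   vanishing integral of [e * D f] is the claim. *)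
pose D (g : Rn R n -> R[i]) := fun x => partial j g x - c * g x.
have SD g : schwartz g -> schwartz (D g).
  move=> Sg; apply: (@schwartz_ext _ _ (fun x => partial j g x + (- c) * g x)).
    by apply: schwartzD; [exact: schwartz_partial|exact: schwartzZl].
  by move=> x; rewrite /D mulNr.
have pe g : schwartz g -> is_partial j (fun x => e x * g x) (fun x => e x * D g x).
  move=> Sg; apply: is_partial_ext (is_partialM (is_partial_wave j xi) (schwartz_is_partial j Sg)) _ => x.
  rewrite /D /e /c; ring.
have re g : rapid g -> rapid (fun x => e x * g x).
  by move=> rg N; have [M HM] := rg N; exists M => x; rewrite normcM normc_expi mul1r.
have := @cintegral_partial0 j (fun x => e x * f x) (fun x => e x * D f x) (fun x => e x * D (D f) x)
  (pe _ Sf) (pe _ (SD _ Sf)) (cintegrable_wave xi (schwartz_integrable Sf))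
  (cintegrable_wave xi (schwartz_integrable (SD _ Sf))) (re _ (schwartz_rapid (SD _ (SD _ Sf)))).
rewrite (_ : (fun x => e x * D f x) = (fun x => e x * partial j f x - c * (e x * f x))); last first.
  by apply/funext => x; rewrite /D; ring.
rewrite cintegralB; last 2 first.
- by apply: cintegrable_wave; exact: schwartz_integrable.
- by apply: cintegrableZl; apply: cintegrable_wave; exact: schwartz_integrable.
rewrite cintegralZl; last by apply: cintegrable_wave; exact: schwartz_integrable.
by move=> /subr0_eq; rewrite /fourier => ->; rewrite mulrCA.
Qed.

(** Both sides are compared with the largest of 1 and the entries, whose [N]-th power is one of the
    terms on the right. *)
Lemma ler_pow_sum N (s : seq R) : all (fun a => 0 <= a) s ->
  (1 + \sum_(a <- s) a) ^+ N <= (1 + (size s)%:R) ^+ N * (1 + \sum_(a <- s) a ^+ N).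
Proof.
move=> s0.
pose m := \big[Num.max/1]_(a <- s) a.
have m1 : 1 <= m by rewrite /m; elim: s {s0 m} => [|a s IH]; rewrite ?big_nil ?big_cons// le_max IH orbT.
have sm : 1 + \sum_(a <- s) a <= (1 + (size s)%:R) * m.
  rewrite mulrDl mul1r; apply: lerD => //.
  rewrite /m {m m1 s0}; elim: s => [|a s IH]; first by rewrite !big_nil mul0r.
  rewrite !big_cons /= -natr1 mulrDl mul1r addrC; apply: lerD.
    by apply: le_trans IH _; rewrite ler_wpM2l// le_max lexx orbT.
  by rewrite le_max lexx.
have mN : m ^+ N <= 1 + \sum_(a <- s) a ^+ N.
  rewrite /m {m m1 sm}; elim: s s0 => [|a s IH] /=; first by rewrite !big_nil expr1n addr0.
  move=> /andP[a0 s0]; rewrite !big_cons addrCA.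
  have S0 : 0 <= \sum_(j <- s) j ^+ N.
    by rewrite big_seq_cond; apply: sumr_ge0 => j /andP[/(allP s0) ? _]; exact: exprn_ge0.
  rewrite /Num.max; case: ifP => _; first by apply: le_trans (IH s0) _; rewrite lerDr exprn_ge0.
  by rewrite lerDl addr_ge0.
have S0 : 0 <= \sum_(a <- s) a.
  by rewrite big_seq_cond; apply: sumr_ge0 => j /andP[/(allP s0) ? _].
apply: (@le_trans _ _ (((1 + (size s)%:R) * m) ^+ N)).
  by rewrite lerXn2r// nnegrE ?addr_ge0// mulr_ge0// ?addr_ge0// (le_trans _ m1).
by rewrite exprMn ler_wpM2l// exprn_ge0// addr_ge0.
Qed.

Lemma rapid_coord g : (forall j N, exists M : R, forall xi, `|tnth xi j : R| ^+ N * normc (g xi) <= M) ->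
  (exists M : R, forall xi, normc (g xi) <= M) -> rapid g.
Proof.
move=> H [M0 HM0] N.
have [M HM] := choice (fun j => H j N).
exists ((1 + n%:R) ^+ N * (M0 + \sum_(j < n) M j)) => xi.
have E : (1 + enorm xi) ^+ N <= (1 + n%:R) ^+ N * (1 + \sum_(j < n) `|tnth xi j : R| ^+ N).
  apply: (@le_trans _ _ ((1 + \sum_(j < n) `|tnth xi j : R|) ^+ N)).
    rewrite lerXn2r// ?nnegrE ?addr_ge0 ?enorm_ge0 ?sumr_ge0// lerD2l.
    exact: ler_enorm_sum.
  have := @ler_pow_sum N [seq `|tnth xi j : R| | j <- index_enum 'I_n].
  rewrite !big_map size_map (_ : size (index_enum 'I_n) = n); last first.
    by rewrite -sum1_size sum1_card card_ord.
  by apply; apply/allP => _ /mapP[j _ ->].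
apply: (le_trans (ler_wpM2r (normc_ge0 _) E)).
rewrite -mulrA ler_wpM2l ?exprn_ge0 ?addr_ge0// mulrDl mul1r lerD//.
by rewrite mulr_suml; apply: ler_sum => j _.
Qed.

(** Multiplication by a coordinate is, up to a unit factor, the transform of a derivative, and
    transforms of Schwartz functions are bounded. *)
Lemma fourier_rapid f : schwartz f -> rapid (fourier f).
Proof.
move=> Sf; have bdd g : schwartz g -> exists M, forall xi, normc (fourier g xi) <= M.
  by move=> Sg; eexists => xi; apply: fourier_bound; exact: schwartz_integrable.
apply: rapid_coord; last exact: bdd.
move=> j N; elim: N f Sf => [|N IH] f Sf.
  by have [M HM] := bdd _ Sf; exists M => xi; rewrite expr0 mul1r.
have [M HM] := IH _ (schwartz_partial j Sf); exists M => xi.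
have := HM xi; rewrite fourier_partial//; move: (fourier f xi) => F.
rewrite !normcM normcR (_ : normc 'i%C = 1 :> R).
  by rewrite mul1r mulrA -exprSr.
by rewrite normcE /= expr0n expr1n add0r sqrtr1.
Qed.

Lemma schwartz_coordM_i j f : schwartz f -> schwartz (fun x => - 'i%C * ((tnth x j : R)%:C * f x)).
Proof. by move=> Sf; apply: schwartzZl; exact: schwartz_coordM. Qed.

Lemma is_partial_fourier_schwartz j f : schwartz f ->
  is_partial j (fourier f) (fourier (fun x => - 'i%C * ((tnth x j : R)%:C * f x))).
Proof.
move=> Sf; apply: is_partial_fourier; first exact: schwartz_integrable.
  by apply: schwartz_integrable; exact: schwartz_coordM.
by apply: schwartz_integrable; apply: schwartz_coordM; exact: schwartz_coordM.
Qed.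

Lemma schwartz_fourier f : schwartz f -> schwartz (fourier f).
Proof.
move=> Sf.
apply: (@schwartz_coind _ _ (fun h => exists2 f, schwartz f & h = fourier f)); last by exists f.
move=> _ [g Sg ->]; split; first exact: fourier_rapid.
move=> j; eexists; last exact: is_partial_fourier_schwartz.
by eexists; last reflexivity; exact: schwartz_coordM_i.
Qed.

Lemma laplacian_fourier f : schwartz f ->
  laplacian (fourier f) = fourier (fun x => - (enorm x ^+ 2)%:C * f x).
Proof.
move=> Sf; apply/funext => xi; rewrite /laplacian.
pose F i x := - 'i%C * ((tnth x i : R)%:C * (- 'i%C * ((tnth x i : R)%:C * f x))).
transitivity (\sum_(i < n) fourier (F i) xi).
apply: eq_bigr => i _.
have [-> _] := is_partialP (is_partial_fourier_schwartz i Sf).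
by have [-> _] := is_partialP (is_partial_fourier_schwartz i (schwartz_coordM_i i Sf)).
rewrite -fourier_sum; last first.
by move=> i; apply: schwartz_integrable; do 2 apply: schwartz_coordM_i.
apply: (congr1 (fun g => fourier g xi)); apply/funext => x.
rewrite sqr_enorm /dotp real_complex_sum -sumrN mulr_suml.
apply: eq_bigr => i _; rewrite /F real_complexM.
have ii : 'i%C * 'i%C = -1 :> R[i] by rewrite -expr2 sqr_i.
move: (tnth x i : R)%:C (f x) => a b.
transitivity (('i%C * 'i%C) * (a * a * b)); first by ring.
by rewrite ii mulN1r mulNr.
Qed.

Lemma schwartz_enormM f : schwartz f -> schwartz (fun x => - (enorm x ^+ 2)%:C * f x).
Proof.
move=> Sf; have H (s : seq 'I_n) : schwartz (fun x => \sum_(i <- s) (- 1) * ((tnth x i : R)%:C * ((tnth x i : R)%:C * f x))).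
  elim: s => [|i s IH].
    by apply: schwartz_ext (schwartz0) _ => x; rewrite big_nil.
  apply: schwartz_ext (schwartzD _ IH) _; last by move=> x; rewrite big_cons.
  by apply: schwartzZl; do 2 apply: schwartz_coordM.
apply: schwartz_ext (H (index_enum 'I_n)) _ => x.
rewrite sqr_enorm /dotp real_complex_sum -sumrN mulr_suml; apply: eq_bigr => i _.
by rewrite real_complexM mulN1r mulNr mulrA.
Qed.

End fourier_schwartz.

(** * Gaussians and Fourier inversion *)

Section gaussian.
Context {R : realType} {n : nat}.
Implicit Types (x y xi a b : Rn R n) (f g phi : Rn R n -> R[i]) (s t : R).
Local Notation mu := (@lebesgue_Rn R n).
Local Notation rintegrable f := (mu.-integrable setT (EFin \o f)).

(** The module generated by [f] over the polynomials, as an inductive predicate suited to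
    [schwartz_coind]. *)
Inductive poly_multiple f : (Rn R n -> R[i]) -> Prop :=
| poly_multiple1 : poly_multiple f f
| poly_multipleD g h : poly_multiple f g -> poly_multiple f h ->
    poly_multiple f (fun x => g x + h x)
| poly_multipleZ (c : R[i]) g : poly_multiple f g -> poly_multiple f (fun x => c * g x)
| poly_multipleX j g : poly_multiple f g -> poly_multiple f (fun x => (tnth x j : R)%:C * g x).

(* The polynomial multiples of f are stable under differentiation. *)
Lemma schwartz_affine_log_derivative f (p : R) (q : 'I_n -> R) :
  (forall j, is_partial j f (fun x => (p * tnth x j + q j)%:C * f x)) ->
  rapid f -> schwartz f.
Proof.
move=> pf rf; apply: (@schwartz_coind _ _ (poly_multiple f)); last exact: poly_multiple1.
move=> g Pg; split.
  elim: Pg => // [? ? _ + _|? ? _|? ? _].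
  - exact: rapidD.
  - exact: rapidZl.
  - exact: rapid_coordM.
move=> j; elim: Pg => [|g1 g2 _ [g1' P1 d1] _ [g2' P2 d2]|c g1 _ [g1' P1 d1]|i g1 P [g1' P1 d1]].
- exists (fun x => p%:C * ((tnth x j : R)%:C * f x) + (q j)%:C * f x).
    apply: poly_multipleD; last by apply: poly_multipleZ; exact: poly_multiple1.
    by apply: poly_multipleZ; apply: poly_multipleX; exact: poly_multiple1.
  apply: is_partial_ext (pf j) _ => x.
  by rewrite real_complexD real_complexM mulrDl mulrA.
- by eexists; [exact: poly_multipleD P1 P2|exact: is_partialD].
- by eexists; [exact: poly_multipleZ P1|exact: is_partialZl].
- exists (fun x => (j == i)%:R * g1 x + (tnth x i : R)%:C * g1' x).
    by apply: poly_multipleD; [exact: poly_multipleZ|exact: poly_multipleX].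
  exact: is_partialM (is_partial_coord j i) d1.
Qed.

Lemma gaussn_sym s a x : gaussn s a x = gaussn s x a.
Proof.
by apply: eq_bigr => i _; rewrite /normal_fun -sqrrN opprB.
Qed.

Lemma gaussn_le1 s a x : gaussn s a x <= 1.
Proof.
rewrite gaussnE -expR0 ler_expR mulNr oppr_le0 divr_ge0//.
  by apply: sumr_ge0 => i _; exact: sqr_ge0.
by rewrite mulrn_wge0 ?sqr_ge0.
Qed.

Lemma is_partial_gaussn s a j : s != 0 ->
  is_partial j (fun x => (gaussn s a x)%:C)
    (fun x => (- (s ^+ 2)^-1 * tnth x j + (s ^+ 2)^-1 * tnth a j)%:C * (gaussn s a x)%:C).
Proof.
move=> s0; under [X in is_partial _ _ X]eq_fun do rewrite -real_complexM.
apply: is_partialR => x.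
pose C := \prod_(i < n | i != j) normal_fun (tnth a i : R) s (tnth x i).
have e t : C * expR (- (s ^+ 2 *+ 2)^-1 * (t - tnth a j) ^+ 2) = gaussn s a (setc j x t).
  rewrite /gaussn (bigD1 j)//= tnth_setc eqxx mulrC; congr (_ * _).
    by rewrite /normal_fun; congr expR; rewrite mulrC mulNr mulrN.
  by apply: eq_bigr => i /negbTE ij; rewrite tnth_setc ij.
have D := der_Zl C (der_exp (der_Zl (- (s ^+ 2 *+ 2)^-1)
   (der_sqr (der_B (der_id (tnth x j : R)) (der_cst (tnth a j : R) (tnth x j : R)))))).
apply: (@der_eq _ _ _ _ _ (der_ext D e)).
rewrite mulrA e setc_id mulrC; congr (_ * _).
have s2 : s ^+ 2 != 0 by rewrite expf_neq0.
by field; rewrite s0.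
Qed.

Lemma expR_ge_pow (N : nat) (t : R) : 0 <= t -> t ^+ N <= N%:R ^+ N * expR t.
Proof.
case: N => [|N] t0; first by rewrite !expr0 mul1r -expR0 ler_expR.
have N0 : (0 : R) < N.+1%:R by [].
have -> : t = N.+1%:R * (t / N.+1%:R) by rewrite mulrC mulfVK// gt_eqF.
set u := t / _; have u0 : 0 <= u by rewrite divr_ge0.
rewrite exprMn expRM_natl ler_wpM2l ?exprn_ge0//.
by rewrite lerXn2r ?nnegrE ?expR_ge0// (le_trans _ (expR_ge1Dx u))// lerDr.
Qed.

Lemma rapid_gaussn s a : s != 0 -> rapid (fun x => (gaussn s a x)%:C).
Proof.
move=> s0 N; exists (N%:R ^+ N * expR (1 + \sum_(i < n) (`|tnth a i : R| + s ^+ 2 / 2))) => x.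
rewrite normcR ger0_norm ?(ltW (gaussn_gt0 _ _ _))//.
apply: (@le_trans _ _ (N%:R ^+ N * expR (1 + enorm x) * gaussn s a x)).
  by rewrite ler_wpM2r ?(ltW (gaussn_gt0 _ _ _))// expR_ge_pow// ltW// enorm1_gt0.
rewrite -mulrA ler_wpM2l ?exprn_ge0// gaussnE -expRD ler_expR -addrA lerD2l.
apply: (le_trans (lerD (ler_enorm_sum x) (lexx _))).
rewrite mulNr mulr_suml -sumrB; apply: ler_sum => i _.
have s2 : 0 < s ^+ 2 by rewrite exprn_even_gt0.
have : `|tnth x i : R| <= `|tnth a i : R| + `|tnth x i - tnth a i : R|.
  by rewrite -{1}(subrKC (tnth a i : R) (tnth x i : R)) ler_normD.
rewrite -(real_normK (num_real (tnth x i - tnth a i : R))).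
set d := `|tnth x i - tnth a i : R|; set b := `|tnth a i : R| => H.
(* The left side is largest at [d = s ^ 2]: complete the square. *)
suff : d - d ^+ 2 / (s ^+ 2 *+ 2) <= s ^+ 2 / 2 by lra.
have := sqr_ge0 (d - s ^+ 2); move: s2; set S := s ^+ 2 => S0 h.
rewrite -mulr_natr -(ler_pM2r S0) mulrBl.
have -> : d ^+ 2 / (S * 2) * S = d ^+ 2 / 2 by field; rewrite gt_eqF.
nra.
Qed.

Lemma schwartz_gaussn s a : s != 0 -> schwartz (fun x => (gaussn s a x)%:C).
Proof.
move=> s0; apply: (@schwartz_affine_log_derivative _ (- (s ^+ 2)^-1) (fun j => (s ^+ 2)^-1 * tnth a j)).
  by move=> j; exact: is_partial_gaussn.
exact: rapid_gaussn.
Qed.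

(** The logarithmic derivatives add up and stay affine. Such products are the test functions of
    [schwartz_total]. *)
Lemma schwartz_gaussnM s a s' a' : s != 0 -> s' != 0 ->
  schwartz (fun x => (gaussn s a x)%:C * (gaussn s' a' x)%:C).
Proof.
move=> s0 s'0; apply: (@schwartz_affine_log_derivative _ (- (s ^+ 2)^-1 - (s' ^+ 2)^-1)
  (fun j => (s ^+ 2)^-1 * tnth a j + (s' ^+ 2)^-1 * tnth a' j)).
  move=> j; apply: is_partial_ext (is_partialM (is_partial_gaussn a j s0) (is_partial_gaussn a' j s'0)) _ => x.
  rewrite (_ : (_ - _) * _ + _ = (- (s ^+ 2)^-1 * tnth x j + (s ^+ 2)^-1 * tnth a j) +
    (- (s' ^+ 2)^-1 * tnth x j + (s' ^+ 2)^-1 * tnth a' j)); last by ring.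
  rewrite real_complexD; ring.
move=> N; have [M HM] := rapid_gaussn a s0 N; exists M => x.
apply: le_trans (HM x); rewrite normcM ler_wpM2l//.
  by rewrite exprn_ge0// ltW// enorm1_gt0.
rewrite -[leRHS]mulr1 ler_wpM2l ?normc_ge0// normcR ger0_norm ?gaussn_le1//.
exact: ltW (gaussn_gt0 _ _ _).
Qed.

Definition origin : Rn R n := [tuple 0 | i < n].

Lemma gaussn0E s x : gaussn s origin x = expR (- dotp x x / (s ^+ 2 *+ 2)).
Proof.
rewrite gaussnE (_ : \sum_(i < n) _ = dotp x x)//; apply: eq_bigr => i _.
by rewrite tnth_mktuple subr0 expr2.
Qed.

Lemma is_partial0_cst f x y : (forall j, is_partial j f (fun=> 0)) -> f x = f y.
Proof.
move=> H; apply: complexP; apply/eqP; rewrite -subr_eq0 -normr_le0.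
  have L : lipschitz_coord (fun x => cRe (f x)) 0.
    apply: lipschitz_coord_setc => j z u v.
    apply: (@MVT_bound _ (fun t => cRe (f (setc j z t))) (fun=> 0)) => w _; last by rewrite normr0.
    by have [] := is_partial_line (H j) z w.
  by apply: le_trans (L x y) _; rewrite mul0r.
have L : lipschitz_coord (fun x => cIm (f x)) 0.
  apply: lipschitz_coord_setc => j z u v.
  apply: (@MVT_bound _ (fun t => cIm (f (setc j z t))) (fun=> 0)) => w _; last by rewrite normr0.
  by have [] := is_partial_line (H j) z w.
by apply: le_trans (L x y) _; rewrite mul0r.
Qed.

(** The relation between the Gaussian and its gradient becomes, for the transform, the same relation
    with [s] inverted. With the integrating factor [E] all partial derivatives vanish, so the
    product is constant. *)
Lemma fourier_gaussn_ode s : s != 0 -> forall xi,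
  fourier (fun x => (gaussn s origin x)%:C) xi =
  fourier (fun x => (gaussn s origin x)%:C) origin * (expR (- (s ^+ 2 / 2) * dotp xi xi))%:C.
Proof.
move=> s0 xi; have SG := schwartz_gaussn origin s0.
set G := (fun x : Rn R n => _) in SG *.
have s2 : s ^+ 2 != 0 by rewrite expf_neq0.
have dF j : is_partial j (fourier G) (fun xi => - (s ^+ 2 * tnth xi j)%:C * fourier G xi).
  apply: is_partial_ext (is_partial_fourier_schwartz j SG) _ => z.
  have [pG _] := is_partialP (is_partial_gaussn origin j s0).
  have -> : (fun x : Rn R n => - 'i%C * ((tnth x j : R)%:C * G x)) =
      (fun x => ('i%C * (s ^+ 2)%:C) * partial j G x).
    apply/funext => x; rewrite /G pG tnth_mktuple mulr0 addr0 -/G.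
    have SS : (s ^+ 2)%:C * (- (s ^+ 2)^-1)%:C = -1.
      by rewrite -real_complexM mulrN mulfV// real_complexN.
    rewrite (real_complexM _ (tnth x j)).
    move: (gaussn s origin x)%:C (tnth x j : R)%:C => A b.
    transitivity ('i%C * ((s ^+ 2)%:C * (- (s ^+ 2)^-1)%:C) * (b * A)); last by ring.
    by rewrite SS mulrN1.
  rewrite fourierZl; last by apply: schwartz_integrable; exact: schwartz_partial.
  rewrite fourier_partial// mulrA real_complexM; move: (fourier G z) (s ^+ 2)%:C (tnth z j : R)%:C => A b c.
  have ii : 'i%C * 'i%C = -1 :> R[i] by rewrite -expr2 sqr_i.
  transitivity (('i%C * 'i%C) * (b * c) * A); first by ring.
  by rewrite ii mulN1r.
pose E (z : Rn R n) : R := expR (s ^+ 2 / 2 * dotp z z).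
have dE j : is_partial j (fun z => (E z)%:C) (fun z => (s ^+ 2 * tnth z j * E z)%:C).
  apply: is_partialR => z.
  have D := der_exp (der_Zl (s ^+ 2 / 2) (der_D (der_cst (dotp z z - (tnth z j : R) ^+ 2) (tnth z j : R)) (der_sqr (der_id (tnth z j : R))))).
  apply: (@der_eq _ _ _ _ _ (der_ext D (g := fun t => E (setc j z t)) _)).
    by move=> t; rewrite /E dotp_setc.
  by rewrite subrK -/(E z) mulrC; congr (_ * _); field.
have K := @is_partial0_cst (fun z => (E z)%:C * fourier G z) xi origin.
have : (E xi)%:C * fourier G xi = (E origin)%:C * fourier G origin.
  apply: K => j; apply: is_partial_ext (is_partialM (dE j) (dF j)) _ => z.
  by rewrite [(_ * E z)%:C]real_complexM; ring.
have -> : E origin = 1.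
  rewrite /E (_ : dotp origin origin = 0) ?mulr0 ?expR0//.
  by apply: big1 => i _; rewrite tnth_mktuple mulr0.
rewrite mul1r => <-; rewrite mulrAC -real_complexM -expRD mulNr subrr expR0 mul1r//.
Qed.

Lemma fourier_gaussn_origin s : 0 < s ->
  fourier (fun x => (gaussn s origin x)%:C) origin = (s ^+ n)%:C.
Proof.
move=> s0.
have -> : fourier (fun x => (gaussn s origin x)%:C) origin =
    ((2 * pi) `^ (- (n%:R / 2)) * \int[mu]_x (gaussn s origin x))%:C.
  rewrite /fourier real_complexM; congr (_ * _).
  rewrite (_ : (fun x => _) = (fun x => (gaussn s origin x)%:C)); last first.
    apply/funext => x; rewrite (_ : dotp _ _ = 0) ?oppr0 ?expi0 ?mul1r//.
    by apply: big1 => i _; rewrite tnth_mktuple mulr0.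
  by apply: complexP => //=; rewrite Rintegral_cst// mul0r.
congr (_%:C); rewrite /Rintegral integral_gaussn ?gt_eqF//= /normal_peak invrK.
have P0 : (0 : R) < 2 * pi by rewrite mulr_gt0// pi_gt0.
rewrite (_ : Num.sqrt _ = s * (2 * pi) `^ (2^-1)); last first.
  transitivity (Num.sqrt (s ^+ 2) * Num.sqrt (2 * pi)).
    by rewrite -sqrtrM ?sqr_ge0//; congr Num.sqrt; rewrite -mulr_natl; ring.
  by rewrite sqrtr_sqr ger0_norm ?(ltW s0)// powR12_sqrt// ltW.
rewrite exprMn mulrCA -[(_ `^ 2^-1) ^+ n]powR_mulrn ?powR_ge0// -powRrM -powRD; last first.
  by rewrite (gt_eqF P0) implybT.
by rewrite [2^-1 * _]mulrC addNr powRr0 mulr1.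
Qed.

Lemma fourier_gaussn s : 0 < s ->
  fourier (fun x => (gaussn s origin x)%:C) = (fun xi => (s ^+ n)%:C * (gaussn s^-1 origin xi)%:C).
Proof.
move=> s0; apply/funext => xi.
rewrite fourier_gaussn_ode ?gt_eqF// fourier_gaussn_origin//; congr (_ * _%:C).
rewrite gaussn0E; congr expR; field; by rewrite gt_eqF.
Qed.

Lemma dotpC x y : dotp x y = dotp y x.
Proof. by apply: eq_bigr => i _; rewrite mulrC. Qed.

(** The multiplication formula, by Fubini with majorant [|f x| |g y|]. It yields inversion below,
    and makes the transform of a distribution extend that of integrable functions. *)
Lemma fourier_mult f g : cintegrable f -> cintegrable g ->
  cintegral (fun x => f x * fourier g x) = cintegral (fun y => fourier f y * g y).
Proof.
move=> If Ig; rewrite /fourier; set c0 := (_ `^ _)%:C.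
pose F x y := f x * (expi (- dotp x y) * g y).
have mf := cintegrable_measurable If; have mg := cintegrable_measurable Ig.
have eF : cintegral (fun x => f x * (c0 * cintegral (fun y => expi (- dotp y x) * g y))) =
    cintegral (fun x => cintegral (fun y => c0 * F x y)).
  congr cintegral; apply/funext => x; rewrite mulrCA.
  rewrite -(cintegralZl (f x) (cintegrable_wave x Ig)).
  rewrite -(cintegralZl c0 (cintegrableZl (f x) (cintegrable_wave x Ig))).
  by congr cintegral; apply/funext => y; rewrite /F dotpC.
have eG : cintegral (fun y => c0 * cintegral (fun x => expi (- dotp x y) * f x) * g y) =
    cintegral (fun y => cintegral (fun x => c0 * F x y)).
  congr cintegral; apply/funext => y.
  rewrite mulrAC -cintegralZl; last exact: cintegrable_wave.
  by congr cintegral; apply/funext => x; rewrite /F; ring.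
rewrite eF eG.
have mfx : measurable_fun setT (fun p : Rn R n * Rn R n => cRe (f p.1)).
  by case: mf => mr _; exact: (measurableT_comp mr).
have mfy : measurable_fun setT (fun p : Rn R n * Rn R n => cIm (f p.1)).
  by case: mf => _ mi; exact: (measurableT_comp mi).
have mgx : measurable_fun setT (fun p : Rn R n * Rn R n => cRe (g p.2)).
  by case: mg => mr _; exact: (measurableT_comp mr).
have mgy : measurable_fun setT (fun p : Rn R n * Rn R n => cIm (g p.2)).
  by case: mg => _ mi; exact: (measurableT_comp mi).
have md : measurable_fun setT (fun p : Rn R n * Rn R n => - dotp p.1 p.2 : R).
  by apply: measurableT_comp => //; exact: measurable_dotp.
have mc : measurable_fun setT (fun p : Rn R n * Rn R n => cos (- dotp p.1 p.2) : R).
  apply: (measurableT_comp (f := @cos R)) => //.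
  by apply: continuous_measurable_fun; exact: continuous_cos.
have ms : measurable_fun setT (fun p : Rn R n * Rn R n => sin (- dotp p.1 p.2) : R).
  apply: (measurableT_comp (f := @sin R)) => //.
  by apply: continuous_measurable_fun; exact: continuous_sin.
apply: (@cintegral_swap _ _ (fun x y => c0 * F x y) (fun x => normc c0 * normc (f x)) (fun y => normc (g y))).
- rewrite /F; under eq_fun do rewrite cReZ !cE /=.
  apply: measurable_funM => //; apply: measurable_funB; apply: measurable_funM => //.
    by apply: measurable_funB; exact: measurable_funM.
  by apply: measurable_funD; exact: measurable_funM.
- rewrite /F; under eq_fun do rewrite cImZ !cE /=.
  apply: measurable_funM => //; apply: measurable_funD; apply: measurable_funM => //.
    by apply: measurable_funD; exact: measurable_funM.
  by apply: measurable_funB; exact: measurable_funM.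
- by move=> x y; rewrite !normcM normc_expi mul1r mulrA.
- by move=> x; rewrite mulr_ge0 ?normc_ge0.
- by move=> y; exact: normc_ge0.
- by apply: rintegrableZl; exact: cintegrable_normc.
- exact: cintegrable_normc.
Qed.

End gaussian.

(** * Heat kernel and Fourier inversion *)

Section heat_kernel.
Context {R : realType} {n : nat}.
Implicit Types (x y xi a b : Rn R n) (f g phi : Rn R n -> R[i]) (s t : R).
Local Notation mu := (@lebesgue_Rn R n).
Local Notation rintegrable f := (mu.-integrable setT (EFin \o f)).

(** Takes the place of a passage to the limit: all regularisation errors below are linear in [s]. *)
Lemma ler0_linear (a C : R) : (forall s, 0 < s -> s <= 1 -> a <= C * s) -> a <= 0.
Proof.
move=> H; apply/ler_addgt0Pl => e e0; rewrite addr0.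
have C1 : 0 < `|C| + 1 by rewrite ltr_wpDl.
pose s := Num.min 1 (e / (`|C| + 1)).
have s0 : 0 < s by rewrite lt_min ltr01 divr_gt0.
apply: (le_trans (H s s0 _)); first by rewrite ge_min lexx.
apply: (@le_trans _ _ ((`|C| + 1) * s)).
  by rewrite ler_wpM2r ?(ltW s0)// (le_trans (ler_norm C))// lerDl.
by rewrite mulrC -ler_pdivlMr// ge_min lexx orbT.
Qed.

(** The heat kernel at time [s ^ 2 / 2]; with the standard deviation as parameter, errors are linear
    in it. *)
Definition heat s x y : R := normal_peak s ^+ n * gaussn s x y.

Lemma heat_ge0 s x y : 0 <= heat s x y.
Proof. by rewrite mulr_ge0 ?exprn_ge0 ?normal_peak_ge0// ltW// gaussn_gt0. Qed.

Lemma heat_sym s x y : heat s x y = heat s y x.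
Proof. by rewrite /heat gaussn_sym. Qed.

Lemma measurable_heat s x : measurable_fun setT (heat s x).
Proof. by apply: measurable_funM => //; exact: measurable_gaussn. Qed.

Lemma measurable_heat2 s : measurable_fun setT (fun p : Rn R n * Rn R n => heat s p.1 p.2).
Proof.
apply: measurable_funM => //; apply: measurable_prod => i _; rewrite /normal_fun.
apply: measurableT_comp => //; apply: measurable_funM => //; apply: measurableT_comp => //.
apply: measurable_funX; apply: measurable_funB.
  by apply: (measurableT_comp (@measurable_coord _ n i)).
by apply: (measurableT_comp (@measurable_coord _ n i)).
Qed.

Lemma rintegrable_heat s x : s != 0 -> rintegrable (heat s x).
Proof. by move=> s0; apply: rintegrableZl; exact: integrable_gaussn. Qed.

Lemma Rintegral_gaussn s x : s != 0 -> \int[mu]_y gaussn s x y = (normal_peak s)^-1 ^+ n.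
Proof. by move=> s0; rewrite /Rintegral integral_gaussn. Qed.

Lemma Rintegral_heat s x : s != 0 -> \int[mu]_y heat s x y = 1.
Proof.
move=> s0; rewrite RintegralZl//; last exact: integrable_gaussn.
by rewrite Rintegral_gaussn// -exprMn divff ?expr1n// gt_eqF// normal_peak_gt0.
Qed.

(** Half of the exponent pays for the linear factor; the other half is a Gaussian of variance
    [2 s ^ 2]. *)
Lemma gaussn_first_moment s x y i : 0 < s ->
  `|(tnth y i : R) - tnth x i| * gaussn s x y <= s * gaussn (Num.sqrt 2 * s) x y.
Proof.
move=> s0; rewrite !gaussnE.
set S := \sum_(j < n) _.
have S0 : ((tnth y i : R) - tnth x i) ^+ 2 <= S.
  by rewrite /S (bigD1 i)//= lerDl sumr_ge0// => j _; exact: sqr_ge0.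
have s2 : 0 < s ^+ 2 by rewrite exprn_gt0.
rewrite exprMn sqr_sqrtr//.
have -> : - S / (s ^+ 2 *+ 2) = - (S / (4 * s ^+ 2)) - S / (4 * s ^+ 2).
  by rewrite -mulr_natr; field; rewrite gt_eqF.
have -> : - S / (2 * s ^+ 2 *+ 2) = - (S / (4 * s ^+ 2)).
  by rewrite -mulr_natr; field; rewrite gt_eqF.
rewrite expRD mulrCA [leRHS]mulrC ler_wpM2l ?expR_ge0//.
rewrite expRN ler_pdivrMr ?expR_gt0//.
apply: (@le_trans _ _ (s * (1 + S / (4 * s ^+ 2)))); last first.
  by rewrite ler_pM2l// expR_ge1Dx.
rewrite -(ler_pM2l s0); rewrite -(real_normK (num_real _)) in S0.
move: S0; set d := `| _ | => S0.
have -> : s * (s * (1 + S / (4 * s ^+ 2))) = s ^+ 2 + S / 4 by field; rewrite gt_eqF.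
have := sqr_ge0 (s - d / 2); nra.
Qed.

Lemma normal_peak_ratio s : 0 < s -> normal_peak s / normal_peak (Num.sqrt 2 * s) = Num.sqrt 2.
Proof.
move=> s0; rewrite /normal_peak invrK.
have -> : (Num.sqrt 2 * s) ^+ 2 * pi *+ 2 = 2 * (s ^+ 2 * pi *+ 2).
  by rewrite exprMn sqr_sqrtr// mulrnAr !mulrA.
rewrite sqrtrM// mulrC mulfK// gt_eqF// sqrtr_gt0.
by rewrite pmulrn_rgt0// mulr_gt0 ?exprn_gt0 ?pi_gt0.
Qed.

(** Each of the [n] coordinates in the Lipschitz bound costs a first moment of size [s]. The power
    of [Num.sqrt 2] is the mass of the widened Gaussian under the original normalisation. *)
Lemma heat_approx (h : Rn R n -> R) (L : R) s x : 0 < s -> 0 <= L -> lipschitz_coord h L ->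
  rintegrable (fun y => h y * heat s x y) ->
  `|\int[mu]_y (h y * heat s x y) - h x| <= L * n%:R * Num.sqrt 2 ^+ n * s.
Proof.
move=> s0 L0 hL Ih; have sn0 : s != 0 by rewrite gt_eqF.
have I1 := rintegrable_heat x sn0.
have -> : h x = \int[mu]_y (h x * heat s x y) by rewrite RintegralZl// Rintegral_heat// mulr1.
rewrite -RintegralB//; last exact: rintegrableZl.
have Id : rintegrable (fun y => h y * heat s x y - h x * heat s x y).
  by apply: rintegrableB => //; exact: rintegrableZl.
apply: le_trans (le_normr_Rintegral measurableT Id) _.
have sq0 : 0 < Num.sqrt 2 * s by rewrite mulr_gt0// sqrtr_gt0.
have -> : L * n%:R * Num.sqrt 2 ^+ n * s =
    \int[mu]_y (L * n%:R * s * normal_peak s ^+ n * gaussn (Num.sqrt 2 * s) x y).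
  rewrite RintegralZl//; last by apply: integrable_gaussn; rewrite gt_eqF.
  rewrite Rintegral_gaussn ?gt_eqF// -[Num.sqrt 2 in LHS](normal_peak_ratio s0) exprMn; ring.
apply: le_Rintegral => //; first exact: (integrable_abse Id).
  by apply: rintegrableZl; apply: integrable_gaussn; rewrite gt_eqF.
move=> y _; rewrite -mulrBl normrM (ger0_norm (heat_ge0 _ _ _)) /heat.
apply: (@le_trans _ _ (L * (\sum_(i < n) `|(tnth y i : R) - tnth x i|) * (normal_peak s ^+ n * gaussn s x y))).
  by apply: ler_wpM2r; [exact: heat_ge0|exact: hL].
rewrite -!mulrA ler_wpM2l// mulrCA [leRHS]mulrA [leRHS]mulrCA -!mulrA.
rewrite ler_wpM2l ?exprn_ge0 ?normal_peak_ge0// mulr_suml.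
apply: le_trans (ler_sum _ (fun i _ => gaussn_first_moment x y i s0)) _.
by rewrite sumr_const card_ord mulr_natl.
Qed.

(** A Gaussian factor is inserted in the inversion integral. By the multiplication formula the
    regularised integral is the heat average of [phi]; removing the factor on one side ([B1]) and
    the average on the other ([B2]) costs errors linear in [s]. *)
Lemma inv_fourierK phi : schwartz phi -> inv_fourier (fourier phi) = phi.
Proof.
move=> Sphi; apply/funext => x.
have SF := schwartz_fourier Sphi; have IF := schwartz_integrable SF.
have [L L0 [LR LI]] := schwartz_lipschitz Sphi.
set c0 := (2 * pi : R) `^ (- (n%:R / 2)).
have c00 : 0 <= c0 by exact: powR_ge0.
have IS := schwartz_integrable (schwartz_enormM SF).
have IN := cintegrable_normc IS.
pose J := \int[mu]_xi normc (- (enorm xi ^+ 2)%:C * fourier phi xi).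
pose C := c0 * (2 * J) + 2 * (L * n%:R * Num.sqrt 2 ^+ n).
apply/eqP; rewrite -subr_eq0; apply/eqP; apply: Normc.eq0_normc; apply/eqP.
rewrite eq_le normc_ge0 andbT; apply: (@ler0_linear _ C) => s s0 s1.
have sV0 : 0 < s^-1 by rewrite invr_gt0.
have sn0 : s != 0 by rewrite gt_eqF.
pose G xi : R[i] := (gaussn s^-1 origin xi)%:C.
have IG : cintegrable G by apply: schwartz_integrable; apply: schwartz_gaussn; rewrite gt_eqF.
pose f xi := expi (dotp xi x) * G xi.
have If : cintegrable f.
  apply: (cintegrable_bddM (M := 1)) => //; last by move=> xi; rewrite normc_expi.
  by have := cmeasurable_wave x 1; under eq_fun do rewrite mul1r.
have Ff y : fourier f y = (s^-1 ^+ n)%:C * (gaussn s x y)%:C.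
  pose z : Rn R n := [tuple (tnth y i : R) - tnth x i | i < n].
  have -> : fourier f y = fourier G z.
    rewrite /fourier; congr (_ * cintegral _); apply/funext => xi.
    rewrite /f mulrA -expiD; congr (expi _ * _).
    by rewrite /dotp -!sumrN -big_split; apply: eq_bigr => i _; rewrite tnth_mktuple/=; ring.
  rewrite /G fourier_gaussn// invrK; congr (_ * _%:C).
  rewrite !gaussnE (_ : \sum_(i < n) _ = \sum_(i < n) (tnth y i - tnth x i : R) ^+ 2)//.
  by apply: eq_bigr => i _; rewrite !tnth_mktuple subr0.
have peakE : c0 * s^-1 ^+ n = normal_peak s ^+ n.
  rewrite /c0 /normal_peak.
  have P0 : (0 : R) < 2 * pi by rewrite mulr_gt0// pi_gt0.
  have -> : Num.sqrt (s ^+ 2 * pi *+ 2) = s * Num.sqrt (2 * pi).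
    transitivity (Num.sqrt (s ^+ 2) * Num.sqrt (2 * pi)).
      by rewrite -sqrtrM ?sqr_ge0//; congr Num.sqrt; rewrite -mulr_natl; ring.
    by rewrite sqrtr_sqr ger0_norm// ltW.
  rewrite invfM exprMn mulrC; congr (_ * _).
  have -> : (Num.sqrt (2 * pi : R))^-1 = (2 * pi) `^ (- 2^-1) by rewrite powRN powR12_sqrt// ltW.
  by rewrite -[RHS](powR_mulrn n (powR_ge0 _ _)) -powRrM; congr (_ `^ _); rewrite mulNr mulrC.
have Iheat : cintegrable (fun y => phi y * (heat s x y)%:C).
  apply: (cintegrable_le (g := fun y => normal_peak s ^+ n * normc (phi y))).
  - apply: cmeasurableM; first exact: schwartz_measurable.
    by apply: cmeasurableR; exact: measurable_heat.
  - move=> y; rewrite normcM normcR ger0_norm ?heat_ge0// mulrC ler_wpM2r ?normc_ge0//.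
    by rewrite /heat ler_piMr ?gaussn_le1// exprn_ge0// normal_peak_ge0.
  - by apply: rintegrableZl; apply: cintegrable_normc; exact: schwartz_integrable.
have E1 : c0%:C * cintegral (fun xi => f xi * fourier phi xi) =
    cintegral (fun y => phi y * (heat s x y)%:C).
  rewrite fourier_mult//; last exact: schwartz_integrable.
  rewrite -cintegralZl; last first.
    under eq_fun do rewrite Ff -mulrA.
    apply: cintegrableZl; apply: (cintegrable_bddM (M := 1)).
    - exact: schwartz_integrable.
    - by apply: cmeasurableR; exact: measurable_gaussn.
    - by move=> y; rewrite normcR ger0_norm ?gaussn_le1// ltW// gaussn_gt0.
  congr cintegral; apply/funext => y; rewrite Ff /heat -peakE !real_complexM; ring.
have IfF : cintegrable (fun xi => f xi * fourier phi xi).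
  apply: (cintegrable_bddM (M := 1)) => //; first exact: cintegrable_measurable.
  move=> xi; rewrite /f normcM normc_expi mul1r normcR ger0_norm ?gaussn_le1//.
  exact: ltW (gaussn_gt0 _ _ _).
have IeF : cintegrable (fun xi => expi (dotp x xi) * fourier phi xi).
  apply: (cintegrable_bddM (M := 1)) => //; last by move=> xi; rewrite normc_expi.
  have := cmeasurable_wave x 1; congr cmeasurable; apply/funext => xi.
  by rewrite mul1r dotpC.
have B1 : normc (inv_fourier (fourier phi) x - cintegral (fun y => phi y * (heat s x y)%:C)) <=
    c0 * (2 * J) * s.
  rewrite -E1 /inv_fourier -/c0 -mulrBr -cintegralB// normcM normcR ger0_norm//.
  rewrite -mulrA ler_wpM2l//.
  have -> : 2 * J * s = 2 * \int[mu]_xi (s * normc (- (enorm xi ^+ 2)%:C * fourier phi xi)).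
    by rewrite RintegralZl// mulrAC -mulrA.
  apply: normc_cintegral_le; [exact: cintegrableB|exact: rintegrableZl|].
  move=> xi; rewrite /f (dotpC xi x) -mulrBl [in leRHS]normcM [leLHS]normcM mulrA.
  rewrite ler_wpM2r ?normc_ge0// -{1}[expi _]mulr1 -mulrBr normcM normc_expi mul1r.
  rewrite normcN normcR ger0_norm ?sqr_ge0//.
  have -> : 1 - G xi = (1 - gaussn s^-1 origin xi)%:C by rewrite real_complexD real_complexN.
  rewrite normcR ger0_norm ?subr_ge0 ?gaussn_le1// gaussn0E sqr_enorm.
  (* One minus the Gaussian is at most [s ^ 2 |xi| ^ 2 / 2], hence at most [s |xi| ^ 2] as [s <= 1];
     the factor [|xi| ^ 2] is paid for by the decay of the transform. *)
  have := expR_ge1Dx (- dotp xi xi / (s^-1 ^+ 2 *+ 2)).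
  have -> : - dotp xi xi / (s^-1 ^+ 2 *+ 2) = - (dotp xi xi * (s ^+ 2 / 2)).
    by rewrite -mulr_natr; field; rewrite sn0.
  have : dotp xi xi * (s ^+ 2 / 2) <= s * dotp xi xi.
    by rewrite mulrC ler_wpM2r ?dotp_ge0//; nra.
  lra.
have B2 : normc (cintegral (fun y => phi y * (heat s x y)%:C) - phi x) <=
    2 * (L * n%:R * Num.sqrt 2 ^+ n) * s.
  apply: le_trans (ler_normc_ReIm _) _; rewrite cReB cImB /cintegral /=.
  rewrite -mulrA mulr_natl mulr2n; case: Iheat => Ir Ii; apply: lerD.
    have e : (fun y => cRe (phi y * (heat s x y)%:C)) = fun y => cRe (phi y) * heat s x y.
      by apply/funext => y; rewrite mulrC cReZ mulrC.
    rewrite e; apply: (heat_approx s0 L0 LR).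
    by move: Ir; congr (integrable _ _ _); apply/funext => y /=; rewrite mulrC cReZ mulrC.
  have e : (fun y => cIm (phi y * (heat s x y)%:C)) = fun y => cIm (phi y) * heat s x y.
    by apply/funext => y; rewrite mulrC cImZ mulrC.
  rewrite e; apply: (heat_approx s0 L0 LI).
  by move: Ii; congr (integrable _ _ _); apply/funext => y /=; rewrite mulrC cImZ mulrC.
rewrite /C mulrDl; apply: le_trans (lerD B1 B2).
set A := inv_fourier _ _; set B := cintegral _.
by rewrite (_ : A - phi x = (A - B) + (B - phi x)) ?ler_normcD//; ring.
Qed.

End heat_kernel.

(** * Schwartz functions separate functions *)

Section totality.
Context {R : realType} {n : nat}.
Implicit Types (x y xi a b : Rn R n) (f g phi : Rn R n -> R[i]) (s t : R).
Local Notation mu := (@lebesgue_Rn R n).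
Local Notation rintegrable f := (mu.-integrable setT (EFin \o f)).

Lemma rintegrable_bddM (h k : Rn R n -> R) (M : R) : rintegrable h -> measurable_fun setT k ->
  (forall x, `|k x| <= M) -> rintegrable (fun x => h x * k x).
Proof.
move=> Ih mk kM; have mh : measurable_fun setT h by apply/measurable_EFinP; exact: measurable_int Ih.
apply: (rintegrable_le (k := fun x => M * `|h x|)).
- exact: measurable_funM.
- by move=> x; rewrite normrM mulrC ler_wpM2r.
- by apply: rintegrableZl; exact: (integrable_abse Ih).
Qed.

(** As [h] is merely bounded, [integrable_prod_dom] does not fit. Tonelli is applied directly, the
    kernel having mass one in its second variable. *)
Lemma integrable_heat_prod (v h : Rn R n -> R) (B s : R) : 0 < s -> rintegrable v ->
  measurable_fun setT h -> (forall x, `|h x| <= B) ->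
  (mu \x mu)%E.-integrable setT (EFin \o (fun p : Rn R n * Rn R n => v p.1 * (h p.2 * heat s p.1 p.2))).
Proof.
move=> s0 Iv mh hB; have sn0 : s != 0 by rewrite gt_eqF.
have mv : measurable_fun setT v by apply/measurable_EFinP; exact: measurable_int Iv.
have B0 : 0 <= B by apply: le_trans (hB origin).
have m1 : measurable_fun setT (fun p : Rn R n * Rn R n => v p.1).
  exact: (measurableT_comp mv).
have m2 : measurable_fun setT (fun p : Rn R n * Rn R n => h p.2).
  exact: (measurableT_comp mh).
have mheat := @measurable_heat2 R n s.
have mF : measurable_fun setT (fun p : Rn R n * Rn R n => v p.1 * (h p.2 * heat s p.1 p.2)).
  by apply: measurable_funM => //; exact: measurable_funM.
have mG : measurable_fun setT (fun p : Rn R n * Rn R n => `|v p.1| * B * heat s p.1 p.2).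
  apply: measurable_funM => //; apply: measurable_funM => //.
  exact: measurableT_comp.
apply: (@le_integrable _ _ _ _ setT measurableT _
   (EFin \o (fun p : Rn R n * Rn R n => `|v p.1| * B * heat s p.1 p.2))).
- exact/measurable_EFinP.
- move=> p _ /=; rewrite lee_fin.
  have := heat_ge0 s p.1 p.2; move: (heat s p.1 p.2) => w w0.
  by rewrite !normrM normr_id (ger0_norm B0) (ger0_norm w0) -mulrA ler_wpM2l// ler_wpM2r.
have G0 p : 0 <= `|v p.1| * B * heat s p.1 p.2 by rewrite mulr_ge0 ?heat_ge0// mulr_ge0.
apply/integrableP; split; first exact/measurable_EFinP.
under eq_integral do rewrite /= ger0_norm ?G0//.
rewrite fubini_tonelli1; last 2 first.
- exact/measurable_EFinP.
- by move=> p; rewrite lee_fin G0.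
rewrite /fubini_F /=.
under eq_integral.
  move=> x _; under eq_integral do rewrite EFinM.
  rewrite ge0_integralZl//; last 3 first.
    - by apply/measurable_EFinP; exact: measurable_heat.
    - by move=> y _; rewrite lee_fin heat_ge0.
    - by rewrite lee_fin mulr_ge0.
  rewrite (_ : \int[mu]_y (heat s x y)%:E = 1)%E ?mule1; last first.
    by rewrite -(fineK (integrable_fin_num measurableT (rintegrable_heat x sn0))) -[fine _]/(\int[mu]_y heat s x y) Rintegral_heat.
  over.
have : rintegrable (fun x => B * `|v x|) by apply: rintegrableZl; exact: (integrable_abse Iv).
move=> /integrableP[_]; apply: le_lt_trans; rewrite le_eqVlt; apply/orP; left; apply/eqP.
by apply: eq_integral => x _; rewrite /= (ger0_norm (mulr_ge0 B0 (normr_ge0 _))) mulrC.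
Qed.

(** By symmetry of the kernel and Fubini, [v] is orthogonal to the heat average [hs] of [h], which
    differs from [h] by at most [K * s] everywhere. *)
Lemma orthogonal_heat_lipschitz (v h : Rn R n -> R) (B L : R) : rintegrable v ->
  (forall s x, 0 < s -> \int[mu]_y (v y * heat s x y) = 0) ->
  0 <= L -> lipschitz_coord h L -> (forall x, `|h x| <= B) ->
  \int[mu]_x (v x * h x) = 0.
Proof.
move=> Iv v0 L0 hL hB.
have mh := lipschitz_measurable hL.
have mv : measurable_fun setT v by apply/measurable_EFinP; exact: measurable_int Iv.
have Ivh : rintegrable (fun x => v x * h x) by exact: rintegrable_bddM hB.
pose K := L * n%:R * Num.sqrt 2 ^+ n.
have Iabs : rintegrable (fun x => `|v x|) by exact: (integrable_abse Iv).
have Ihh s y : 0 < s -> rintegrable (fun x => h x * heat s y x).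
  move=> s0; under [X in integrable _ _ X]eq_fun do rewrite /= mulrC.
  by apply: rintegrable_bddM hB => //; apply: rintegrable_heat; rewrite gt_eqF.
apply/eqP; rewrite -normr_le0; apply: (@ler0_linear R _ (K * \int[mu]_x `|v x|)) => s s0 _.
have sn0 : s != 0 by rewrite gt_eqF.
pose hs y := \int[mu]_x (h x * heat s y x).
have hsE y : `|hs y - h y| <= K * s by apply: heat_approx => //; exact: Ihh.
have swap : \int[mu]_y (v y * hs y) = 0.
  have IF := integrable_heat_prod s0 Iv mh hB.
  have := Rintegral_swap IF; rewrite /=.
  have -> : \int[mu]_y (v y * hs y) = \int[mu]_x \int[mu]_y (v x * (h y * heat s x y)).
    by apply: eq_Rintegral => y _; rewrite /hs -RintegralZl//; exact: Ihh.
  move=> ->.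
  - rewrite (_ : (fun y => \int[mu]_x (v x * (h y * heat s x y))) = fun=> 0).
      by rewrite Rintegral_cst// mul0r.
    apply/funext => y; under eq_Rintegral do rewrite mulrCA heat_sym.
    rewrite RintegralZl// ?v0 ?mulr0//.
    apply: (rintegrable_bddM (M := normal_peak s ^+ n)) => //; first exact: measurable_heat.
    move=> x; rewrite ger0_norm ?heat_ge0// /heat ler_piMr ?gaussn_le1//.
    by rewrite exprn_ge0// normal_peak_ge0.
  - by move=> x; apply: rintegrableZl; exact: Ihh.
  - move=> y; apply: (rintegrable_bddM (M := B * normal_peak s ^+ n)) => //.
      apply: measurable_funM => //; under eq_fun do rewrite heat_sym.
      exact: measurable_heat.
    move=> x; rewrite normrM (ger0_norm (heat_ge0 _ _ _)) ler_pM ?heat_ge0//.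
    by rewrite /heat ler_piMr ?gaussn_le1// exprn_ge0// normal_peak_ge0.
(* Adding [B] makes the integrand nonnegative, so that Tonelli gives measurability; the mass one of
   the kernel allows [B] to be subtracted again. *)
have mhs : measurable_fun setT hs.
  have mk : measurable_fun setT (fun p : Rn R n * Rn R n => (h p.2 + B) * heat s p.1 p.2).
    apply: measurable_funM; last exact: measurable_heat2.
    by apply: measurable_funD => //; exact: (measurableT_comp mh).
  have hB0 x : 0 <= h x + B by have := hB x; rewrite ler_norml => /andP[]; lra.
  have mk0 p : (0 <= ((h p.2 + B) * heat s p.1 p.2)%:E)%E by rewrite lee_fin mulr_ge0 ?heat_ge0.
  have := @measurable_fun_fubini_tonelli_F _ _ _ _ _ mu
     (fun p : Rn R n * Rn R n => ((h p.2 + B) * heat s p.1 p.2)%:E) (iffRL (measurable_EFinP _ _) mk) mk0.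
  have -> : fubini_F mu (fun p : Rn R n * Rn R n => ((h p.2 + B) * heat s p.1 p.2)%:E) =
      EFin \o (fun y => hs y + B).
    apply/funext => y; rewrite /fubini_F /=.
    have Ih := rintegrable_heat y sn0.
    transitivity (\int[mu]_x (h x * heat s y x + B * heat s y x))%:E.
      rewrite fineK; first by apply: eq_integral => x _; rewrite mulrDl.
      apply: integrable_fin_num => //; apply: rintegrableD; first exact: Ihh.
      exact: rintegrableZl.
    rewrite RintegralD//; [|exact: Ihh|exact: rintegrableZl].
    by rewrite RintegralZl// Rintegral_heat// mulr1.
  move=> /measurable_EFinP H.
  rewrite (_ : hs = fun y => (hs y + B) - B); last by apply/funext => y; rewrite addrK.
  exact: measurable_funB.
have Ivs : rintegrable (fun x => v x * hs x).
  apply: (rintegrable_bddM (M := B + K * s)) => // x.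
  rewrite (_ : hs x = h x + (hs x - h x)); last by ring.
  by apply: le_trans (ler_normD _ _) _; exact: lerD.
have -> : \int[mu]_x (v x * h x) = - \int[mu]_x (v x * hs x - v x * h x).
  by rewrite RintegralB// swap sub0r opprK.
have Id : rintegrable (fun x => v x * hs x - v x * h x) by exact: rintegrableB.
rewrite normrN; apply: le_trans (le_normr_Rintegral measurableT Id) _.
rewrite mulrAC -RintegralZl//; apply: le_Rintegral => //.
- exact: (integrable_abse Id).
- exact: rintegrableZl.
- by move=> x _; rewrite -mulrBr normrM mulrC ler_wpM2r.
Qed.

(** A generating family closed under intersection whose indicators are pointwise limits of bounded
    Lipschitz functions. It replaces the open sets. *)
Definition open_lip : set (set (Rn R n)) := [set A | exists (F : Rn R n -> R) (L B : R),
  [/\ 0 <= L, lipschitz_coord F L, (forall x, `|F x| <= B) & A = [set x | 0 < F x]]].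

Lemma open_lip_measurable A : open_lip A -> measurable A.
Proof.
move=> [F [L [B [L0 FL FB ->]]]]; have mF := lipschitz_measurable FL.
rewrite (_ : [set x | _] = F @^-1` `]0, +oo[%classic); last first.
  by apply/seteqP; split => x /=; rewrite in_itv/= andbT.
by rewrite -[X in measurable X]setTI; exact: mF.
Qed.

Lemma lerN_norm (u : R) : - u <= `|u|.
Proof. by rewrite -normrN ler_norm. Qed.

Lemma max_contract (c u w : R) : `|Num.max c u - Num.max c w| <= `|u - w|.
Proof.
have := ler_norm (u - w); have := lerN_norm (u - w); move: `|u - w| => p a1 a2.
by case: (leP c u) => ?; case: (leP c w) => ?; rewrite ler_norml; apply/andP; split; lra.
Qed.

Lemma min_contract (c u w : R) : `|Num.min c u - Num.min c w| <= `|u - w|.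
Proof.
have := ler_norm (u - w); have := lerN_norm (u - w); move: `|u - w| => p a1 a2.
by case: (leP c u) => ?; case: (leP c w) => ?; rewrite ler_norml; apply/andP; split; lra.
Qed.

Lemma lipschitz_min (F G : Rn R n -> R) (L M : R) : 0 <= L -> 0 <= M ->
  lipschitz_coord F L -> lipschitz_coord G M ->
  lipschitz_coord (fun x => Num.min (F x) (G x)) (L + M).
Proof.
move=> L0 M0 FL GM x y; have := FL x y; have := GM x y.
set S := \sum_(i < n) _; have S0 : 0 <= S by apply: sumr_ge0.
move=> h1 h2; apply: (@le_trans _ _ (`|F x - F y| + `|G x - G y|)); last first.
  by rewrite mulrDl; exact: lerD h2 h1.
have := ler_norm (F x - F y); have := lerN_norm (F x - F y).
have := ler_norm (G x - G y); have := lerN_norm (G x - G y).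
move: `|F x - F y| `|G x - G y| => p q a1 a2 a3 a4.
by case: (leP (F x) (G x)) => ?; case: (leP (F y) (G y)) => ?; rewrite ler_norml; apply/andP; split; lra.
Qed.

Lemma open_lip_setI : setI_closed open_lip.
Proof.
move=> _ _ [F [L [B [L0 FL FB ->]]]] [G [M [D [M0 GM GD ->]]]].
exists (fun x => Num.min (F x) (G x)), (L + M), (B + D); split.
- exact: addr_ge0.
- exact: lipschitz_min.
- move=> x; apply: (@le_trans _ _ (`|F x| + `|G x|)); last exact: lerD.
  by rewrite /Num.min; case: ifP => _; rewrite ?lerDl ?lerDr.
- by apply/seteqP; split => x /=; rewrite lt_min => /andP.
Qed.

Lemma open_lipT : open_lip setT.
Proof.
exists (fun=> 1), 0, 1; split => //.
- by move=> x y; rewrite subrr normr0 mul0r.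
- by move=> x; rewrite normr1.
- by apply/seteqP; split => x //= _; exact: ltr01.
Qed.

Lemma open_lip_generates A : measurable A -> <<s open_lip >> A.
Proof.
pose Tg := g_sigma_algebraType open_lip.
have mid : measurable_fun setT (idfun : Tg -> Rn R n).
  apply/measurable_fun_tnthP => i.
  have := @measurability _ _ Tg (measurableTypeR R) setT (fun x : Rn R n => tnth x i) _ (RGenOInfty.measurableE R).
  apply => _ [_ [c ->] <-]; rewrite setTI.
  apply: sub_sigma_algebra.
  (* A coordinate half-space is the positivity set of a clipped coordinate; clipping makes it
     bounded. *)
  pose F (x : Rn R n) : R := Num.min 1 (Num.max (-1) (tnth x i - c)).
  exists F, 1, 1; split => //.
  - move=> x y; rewrite mul1r (bigD1 i)//=.
    apply: (@le_trans _ _ `|(tnth x i : R) - tnth y i|); last by rewrite lerDl sumr_ge0.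
    apply: le_trans (min_contract _ _ _) _; apply: le_trans (max_contract _ _ _) _.
    by rewrite opprB addrA subrK.
  - move=> x; rewrite /F ler_norml le_min ge_min lexx orTb andbT.
    by rewrite le_max lexx andbT; lra.
  - apply/seteqP; split => x /=; rewrite in_itv/= andbT /F lt_min ltr01/= lt_max ltr0N1 /= subr_gt0//.
by move=> mA; have := mid measurableT A mA; rewrite setTI.
Qed.

Lemma orthogonal_open_lip (v : Rn R n -> R) : rintegrable v ->
  (forall s x, 0 < s -> \int[mu]_y (v y * heat s x y) = 0) ->
  forall A, open_lip A -> (\int[mu]_(x in A) (v x)%:E = 0)%E.
Proof.
move=> Iv v0 A oA; have mA := open_lip_measurable oA.
case: oA => F [L [B [L0 FL FB AE]]].
have mv : measurable_fun setT v by apply/measurable_EFinP; exact: measurable_int Iv.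
(* At each point this sequence eventually equals the indicator of [A], and each term is Lipschitz,
   hence orthogonal to [v]. *)
pose h (k : nat) x : R := Num.max 0 (Num.min 1 (k%:R * F x)).
have h0 k x : 0 <= h k x by rewrite /h le_max lexx.
have h1 k x : h k x <= 1 by rewrite /h ge_max ler01 ge_min lexx.
have hL k : lipschitz_coord (h k) (k%:R * L).
  move=> x y; apply: (@le_trans _ _ (k%:R * `|F x - F y|)); last by rewrite -mulrA ler_wpM2l.
  rewrite -[k%:R in leRHS]ger0_norm// -normrM mulrBr.
  by apply: le_trans (max_contract _ _ _) _; exact: min_contract.
have vh k : \int[mu]_x (v x * h k x) = 0.
  apply: (@orthogonal_heat_lipschitz v (h k) 1 (k%:R * L)) => //; first by rewrite mulr_ge0.
  by move=> x; rewrite ger0_norm.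
have mh k : measurable_fun setT (h k) by exact: lipschitz_measurable (hL k).
have hcvg x : \forall k \near \oo, (v x * h k x)%:E = (v x * \1_A x)%:E.
  rewrite AE indicE; case: (boolP (x \in _)) => [/[!inE]/= Fx|/negP xA]; near=> k.
    rewrite /h min_l ?max_r//; apply: (@le_trans _ _ ((F x)^-1 * F x)); first by rewrite mulVf// gt_eqF.
    rewrite ler_pM2r//; near: k.
    exists (Num.truncn ((F x)^-1)).+1 => // j /= jm.
    by apply: ltW; apply: (lt_le_trans (truncnS_gt _)); rewrite ler_nat.
  have Fx : F x <= 0 by rewrite leNgt; apply/negP => Fx; apply: xA; rewrite inE.
  by rewrite /h max_l// ge_min mulr_ge0_le0 ?orbT.
have [|||||_ _] := @dominated_convergence _ _ _ mu setT measurableT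
  (fun k x => (v x * h k x)%:E) (fun x => (v x * \1_A x)%:E) (fun x => `|v x|%:E).
- by move=> k; apply/measurable_EFinP; exact: measurable_funM.
- by apply/measurable_EFinP; apply: measurable_funM => //; exact: measurable_indic.
- by apply: aeW => x _; apply: cvg_near_cst; exact: hcvg.
- exact: (integrable_abse Iv).
- apply: aeW => x k _; rewrite /= lee_fin normrM (ger0_norm (h0 _ _)).
  by rewrite ler_piMr.
rewrite (_ : [sequence _]_k = fun=> 0%E); last first.
  apply/funext => k /=; have := vh k; rewrite /Rintegral => /eqP.
  rewrite fine_eq0; last first.
    apply: integrable_fin_num => //; apply: (rintegrable_bddM (M := 1)) => // x.
    by rewrite ger0_norm.
  by move=> /eqP.
move=> /(cvg_lim (@ereal_hausdorff R)); rewrite lim_cst//.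
move=> e; transitivity (\int[mu]_x (v x * \1_A x)%:E)%E; last by rewrite -e.
rewrite integral_mkcond; apply: eq_integral => x _.
by rewrite patchE indicE; case: ifP => _; rewrite ?mulr1 ?mulr0.
Unshelve. all: by end_near.
Qed.

(** Dynkin's theorem: the sets over which [v] has integral 0 contain the generating family and form
    a Dynkin system, complements being allowed because the total integral is 0. *)
Lemma orthogonal_heat_eq0 (v : Rn R n -> R) : rintegrable v ->
  (forall s x, 0 < s -> \int[mu]_y (v y * heat s x y) = 0) ->
  {ae mu, forall x, v x = 0}.
Proof.
move=> Iv v0.
pose H : set (set (Rn R n)) := [set A | measurable A /\ (\int[mu]_(x in A) (v x)%:E = 0)%E].
have GH : open_lip `<=` H.
  by move=> A oA; split; [exact: open_lip_measurable|exact: (orthogonal_open_lip Iv v0)].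
have mv : measurable_fun setT v by apply/measurable_EFinP; exact: measurable_int Iv.
have HT : H setT by apply: GH; exact: open_lipT.
have mvA A : measurable_fun A (fun x => (v x)%:E).
  by apply: measurable_funTS; exact/measurable_EFinP.
have dH : dynkin H.
  split => //.
  - move=> A [mA A0]; split; first exact: measurableC.
    have [_] := HT; rewrite -(setUv A) integral_setU//.
    + by rewrite A0 add0e.
    + exact: measurableC.
    + by apply/eqP; rewrite setICr.
  - move=> F tF HF; have mF k : measurable (F k) by have [] := HF k.
    split; first exact: bigcupT_measurable.
    rewrite integral_bigcup//; last first.
      by apply: integrableS Iv => //; exact: bigcupT_measurable.
    by apply: eseries0 => k _ _; have [] := HF k.
have HA A : measurable A -> (\int[mu]_(x in A) (v x)%:E = 0)%E.
  move=> /open_lip_generates; rewrite -(setI_closed_g_dynkin_g_sigma_algebra open_lip_setI).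
  by move=> /(smallest_sub dH GH)[].
have := @integral_ae_eq _ _ _ mu setT measurableT (cst 0%E) (EFin \o v) Iv (measurable_cst _).
move=> /(_ _)[|N [mN N0 sub]].
  by move=> E _ mE; rewrite HA// integral0.
exists N; split => // x /= vx; apply: sub => /= Hx; apply: vx; have := Hx I.
by move=> [].
Qed.

(** A fixed Gaussian factor first makes the real and imaginary parts of [g] integrable.
    Orthogonality of the product to heat kernels is then a test against products of two
    Gaussians. *)
Lemma schwartz_total (g : Rn R n -> R[i]) : cmeasurable g ->
  (forall phi, schwartz phi -> cintegrable (fun x => g x * phi x)) ->
  (forall phi, schwartz phi -> cintegral (fun x => g x * phi x) = 0) ->
  {ae mu, forall x, g x = 0}.
Proof.
move=> mg Ig g0.
have ae0 (v : Rn R n -> R) : measurable_fun setT v ->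
    rintegrable (fun x => v x * gaussn 1 origin x) ->
    (forall s a s' a', s != 0 -> s' != 0 -> rintegrable (fun x => v x * (gaussn s a x * gaussn s' a' x))) ->
    (forall s a s' a', s != 0 -> s' != 0 -> \int[mu]_x (v x * (gaussn s a x * gaussn s' a' x)) = 0) ->
    {ae mu, forall x, v x = 0}.
  move=> mv Iv1 Iv v0.
  have : {ae mu, forall x, v x * gaussn 1 origin x = 0}.
    apply: orthogonal_heat_eq0 => // s x s0.
    have := v0 1 origin s x (oner_neq0 _) (lt0r_neq0 s0) => H.
    rewrite (_ : (fun y => _) = (fun y => normal_peak s ^+ n *
      (v y * (gaussn 1 origin y * gaussn s x y)))); last first.
      by apply/funext => y; rewrite /heat; ring.
    rewrite RintegralZl//; last by apply: Iv; [exact: oner_neq0|exact: lt0r_neq0].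
    by rewrite H mulr0.
  apply: filterS => x /eqP; rewrite mulf_eq0 (gt_eqF (gaussn_gt0 _ _ _)) orbF => /eqP.
  exact.
have S s a s' a' : s != 0 -> s' != 0 -> schwartz (fun x : Rn R n => (gaussn s a x * gaussn s' a' x)%:C).
  move=> s0 s'0; apply: schwartz_ext (schwartz_gaussnM a a' s0 s'0) _ => x.
  by rewrite real_complexM.
have eR (r : R) x : cRe (g x * r%:C) = cRe (g x) * r.
  by rewrite mulrC cReZ mulrC.
have eI (r : R) x : cIm (g x * r%:C) = cIm (g x) * r.
  by rewrite mulrC cImZ mulrC.
have [mr mi] := mg.
have aer : {ae mu, forall x, cRe (g x) = 0}.
  apply: ae0 => // [|s a s' a' s0 s'0|s a s' a' s0 s'0].
  - have [+ _] := Ig _ (schwartz_gaussn origin (oner_neq0 _)).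
    by congr (integrable _ _ _); apply/funext => x; rewrite eR.
  - have [+ _] := Ig _ (S s a s' a' s0 s'0).
    by congr (integrable _ _ _); apply/funext => x; rewrite eR.
  - have := g0 _ (S s a s' a' s0 s'0) => /(congr1 (@complex.Re R)) /=.
    by under eq_Rintegral do rewrite eR.
have aei : {ae mu, forall x, cIm (g x) = 0}.
  apply: ae0 => // [|s a s' a' s0 s'0|s a s' a' s0 s'0].
  - have [_ +] := Ig _ (schwartz_gaussn origin (oner_neq0 _)).
    by congr (integrable _ _ _); apply/funext => x; rewrite eI.
  - have [_ +] := Ig _ (S s a s' a' s0 s'0).
    by congr (integrable _ _ _); apply/funext => x; rewrite eI.
  - have := g0 _ (S s a s' a' s0 s'0) => /(congr1 (@complex.Im R)) /=.
    by under eq_Rintegral do rewrite eI.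
by apply: filterS2 aer aei => x gr gi; exact: complexP.
Qed.

End totality.

(** * Exponential generating functions *)

Section exponential_series.
Context {R : realType}.
Implicit Types (a : nat -> R) (B D t x : R).

Definition geom_bounded a D B := forall k, `|a k| <= D * B ^+ k.

(** Differentiation shifts the sequence of coefficients, so a linear recurrence for [a] becomes a
    differential equation with the same coefficients. *)
Definition egf a t : R := limn (pseries (fun k => a k / k`!%:R) t).

Lemma geom_bounded_shift a D B j : geom_bounded a D B ->
  geom_bounded (fun k => a (k + j)%N) (D * B ^+ j) B.
Proof. by move=> aB k; rewrite -mulrA -exprD addnC; exact: aB. Qed.

Lemma geom_bounded_cvg a D B t : 0 <= B -> geom_bounded a D B ->
  cvgn [normed series (fun k => a k / k`!%:R * t ^+ k)].
Proof.
move=> B0 aB.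
have D0 : 0 <= D by have := aB 0%N; rewrite expr0 mulr1; exact: le_trans.
apply: (series_le_cvg (v_ := D *: exp_coeff (B * `|t|))).
- by move=> k; exact: normr_ge0.
- by move=> k; rewrite /GRing.scale/= mulr_ge0// exp_coeff_ge0// mulr_ge0.
- move=> k /=; rewrite /GRing.scale/= /exp_coeff /= normrM normrM normrX exprMn.
  rewrite [`|k`!%:R^-1|]ger0_norm//.
  rewrite [leRHS](_ : _ = D * B ^+ k * (k`!%:R)^-1 * `|t| ^+ k); last by rewrite /GRing.scale/=; ring.
  by rewrite ler_wpM2r ?exprn_ge0// ler_wpM2r ?invr_ge0.
- by apply: is_cvg_seriesZ; exact: is_cvg_series_exp_coeff.
Qed.

Lemma pseries_diffs_egf a :
  pseries_diffs (fun k => a k / k`!%:R) = fun k => a k.+1 / k`!%:R.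
Proof.
apply/funext => k; rewrite /pseries_diffs factS natrM invfM mulrCA mulVKf//.
Qed.

Lemma egf_derive a D B t : 0 <= B -> geom_bounded a D B ->
  is_derive t 1 (egf a) (egf (fun k => a k.+1) t).
Proof.
move=> B0 aB.
have cv b D' x : geom_bounded b D' B -> cvgn (pseries (fun k => b k / k`!%:R) x).
  by move=> bB; apply: normed_cvg; exact: (geom_bounded_cvg (t := x) B0 bB).
have aB1 : geom_bounded (fun k => a k.+1) (D * B ^+ 1) B.
  by move=> k; have := geom_bounded_shift 1 aB k; rewrite addn1.
have aB2 : geom_bounded (fun k => a k.+2) (D * B ^+ 2) B.
  by move=> k; have := geom_bounded_shift 2 aB k; rewrite addn2.
(* Termwise differentiation asks for convergence of the series and of its first two derived series
   at a point beyond [t]; shifted sequences are still geometrically bounded. *)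
have := @pseries_snd_diffs R (fun k => a k / k`!%:R) (`|t| + 1) t (cv _ _ _ aB).
rewrite !pseries_diffs_egf; apply.
- exact: cv aB1.
- exact: cv aB2.
- by rewrite [ltRHS]ger0_norm ?ltrDl// addr_ge0.
Qed.

Lemma egf_cvg a D B t : 0 <= B -> geom_bounded a D B ->
  pseries (fun k => a k / k`!%:R) t @ \oo --> egf a t.
Proof. by move=> B0 aB; apply: normed_cvg; exact: geom_bounded_cvg aB. Qed.

Lemma egf_le a D B t : 0 <= B -> geom_bounded a D B -> `|egf a t| <= D * expR (B * `|t|).
Proof.
move=> B0 aB; have D0 : 0 <= D by have := aB 0%N; rewrite expr0 mulr1; exact: le_trans.
have cn := geom_bounded_cvg (t := t) B0 aB.
apply: le_trans (lim_series_norm cn) _.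
rewrite /expR -[D * _]/(D *: _) -lim_seriesZ; last exact: is_cvg_series_exp_coeff.
apply: lim_series_le => //; first by apply: is_cvg_seriesZ; exact: is_cvg_series_exp_coeff.
move=> k /=; rewrite /GRing.scale/= /exp_coeff /= normrM normrM normrX exprMn.
rewrite [`|k`!%:R^-1|]ger0_norm//.
rewrite [leRHS](_ : _ = D * B ^+ k * (k`!%:R)^-1 * `|t| ^+ k); last by rewrite /GRing.scale/=; ring.
by rewrite ler_wpM2r ?exprn_ge0// ler_wpM2r ?invr_ge0.
Qed.

Lemma egf0 a : egf a 0 = a 0%N.
Proof.
apply/cvg_lim => //; apply: cvg_near_cst; exists 1%N => // k /= k1.
case: k k1 => // k _; rewrite /pseries /series /=.
by rewrite big_nat_recl// expr0 fact0 invr1 !mulr1 big1 ?addr0// => i _; rewrite expr0n mulr0.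
Qed.

End exponential_series.

(** * The ordinary differential equation at a fixed frequency *)

Section mgt_kernel.
Context {R : realType} (tau b : R).
Implicit Types (rho t : R).
Hypotheses (tau0 : 0 < tau) (b0 : 0 <= b).

(** The companion matrix of the cubic with [rho = r ^ 2], acting on three successive derivatives at
    time 0. *)
Definition mgt_step rho (s : R * R * R) : R * R * R :=
  (s.1.2, s.2, - (s.2 + b * rho * s.1.2 + rho * s.1.1) / tau).

Definition mgt_state rho k := iter k (mgt_step rho) (0, 0, 1).

Definition mgt_coef rho k := (mgt_state rho k).1.1.

(* The j-th time derivative of the solution with initial data (0, 0, 1). *)
Definition mgtk j rho t : R := egf (fun k => mgt_coef rho (k + j)) t.

(** Bounds the companion matrix in the maximum norm. Being at least 1, it also covers the rows that
    only shift. *)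
Definition mgt_rate rho := 1 + (1 + b * rho + rho) / tau.

Lemma mgt_coef_rec rho k :
  mgt_coef rho k.+3 = - (mgt_coef rho k.+2 + b * rho * mgt_coef rho k.+1 + rho * mgt_coef rho k) / tau.
Proof. by []. Qed.

Lemma mgt_rate_ge1 rho : 0 <= rho -> 1 <= mgt_rate rho.
Proof. by move=> r0; rewrite lerDl divr_ge0 ?(ltW tau0)// !addr_ge0 ?mulr_ge0. Qed.

Lemma mgt_coef_bounded rho : 0 <= rho -> geom_bounded (mgt_coef rho) 1 (mgt_rate rho).
Proof.
move=> r0 k; rewrite mul1r.
have B1 := mgt_rate_ge1 r0; have B0 : 0 <= mgt_rate rho by exact: le_trans B1.
suff : [/\ `|(mgt_state rho k).1.1| <= mgt_rate rho ^+ k,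
   `|(mgt_state rho k).1.2| <= mgt_rate rho ^+ k & `|(mgt_state rho k).2| <= mgt_rate rho ^+ k].
  by case.
elim: k => [|k [IH1 IH2 IH3]]; first by rewrite /= normr0 normr1 expr0.
have E0 : 0 <= mgt_rate rho ^+ k by exact: exprn_ge0.
have Ele : mgt_rate rho ^+ k <= mgt_rate rho ^+ k.+1 by rewrite exprS ler_peMl.
rewrite /mgt_state iterS -/(mgt_state rho k) /mgt_step /=; split; [exact: le_trans Ele|exact: le_trans Ele|].
rewrite normrM normrN [`|tau^-1|]ger0_norm ?invr_ge0 ?(ltW tau0)//.
apply: (@le_trans _ _ ((1 + b * rho + rho) * mgt_rate rho ^+ k / tau)).
  rewrite ler_wpM2r ?invr_ge0 ?(ltW tau0)// !mulrDl mul1r.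
  apply: le_trans (ler_normD _ _) _; apply: lerD.
    apply: le_trans (ler_normD _ _) _; apply: lerD => //.
    by rewrite normrM ger0_norm ?mulr_ge0// ler_wpM2l ?mulr_ge0.
  by rewrite normrM ger0_norm// ler_wpM2l.
by rewrite exprS mulrAC ler_wpM2r// /mgt_rate lerDr.
Qed.

Lemma mgtk_bounded rho j : 0 <= rho ->
  geom_bounded (fun k => mgt_coef rho (k + j)) (1 * mgt_rate rho ^+ j) (mgt_rate rho).
Proof. by move=> r0; apply: geom_bounded_shift; exact: mgt_coef_bounded. Qed.

Lemma mgt_rate_ge0 rho : 0 <= rho -> 0 <= mgt_rate rho.
Proof. by move=> /mgt_rate_ge1; exact: le_trans. Qed.

Lemma mgtk_derive rho j t : 0 <= rho -> is_derive t 1 (mgtk j rho) (mgtk j.+1 rho t).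
Proof.
move=> r0; apply: der_eq (egf_derive t (mgt_rate_ge0 r0) (mgtk_bounded j r0)) _.
by congr (egf _ t); apply/funext => k; rewrite addSnnS.
Qed.

Lemma mgtk_le rho j t : 0 <= rho -> `|mgtk j rho t| <= mgt_rate rho ^+ j * expR (mgt_rate rho * `|t|).
Proof.
move=> r0; rewrite -[X in X * _]mul1r; apply: egf_le (mgt_rate_ge0 r0) _.
exact: mgtk_bounded.
Qed.

Lemma mgtk_rec rho j t : 0 <= rho ->
  mgtk j.+3 rho t = - (mgtk j.+2 rho t + b * rho * mgtk j.+1 rho t + rho * mgtk j rho t) / tau.
Proof.
move=> r0; apply/cvg_lim => //.
have cv i := egf_cvg (t := t) (mgt_rate_ge0 r0) (mgtk_bounded i r0).
have H := cvgM (cvgN (cvgD (cvgD (cv j.+2) (cvgM (cvg_cst (b * rho)) (cv j.+1))) (cvgM (cvg_cst rho) (cv j)))) (cvg_cst tau^-1).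
pose S i := pseries (fun k => mgt_coef rho (k + i) / k`!%:R) t.
have e : S j.+3 = (fun N => - (S j.+2 N + b * rho * S j.+1 N + rho * S j N) / tau); last first.
  by rewrite -/(S j.+3) e; exact: H.
apply/funext => N; rewrite /S /pseries /series /= !mulr_sumr -!big_split -sumrN mulr_suml.
apply: eq_bigr => k _; rewrite !addnS mgt_coef_rec /=.
rewrite -!addrA; field; rewrite gt_eqF//=.
Qed.

Lemma mgtk0 rho : 0 <= rho -> [/\ mgtk 0 rho 0 = 0, mgtk 1 rho 0 = 0, mgtk 2 rho 0 = 1,
  mgtk 3 rho 0 = - tau^-1 & mgtk 4 rho 0 = tau^-1 ^+ 2 - b * rho / tau].
Proof.
move=> r0; rewrite /mgtk !egf0 /mgt_coef /=; split => //.
  by rewrite !mulr0 !addr0 mulN1r.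
by field; rewrite gt_eqF.
Qed.

Lemma measurable_mgtk n j t :
  measurable_fun setT (fun xi : Rn R n => mgtk j (enorm xi ^+ 2) t).
Proof.
have me : measurable_fun setT (fun xi : Rn R n => enorm xi ^+ 2 : R).
  by apply: measurable_funX; exact: measurable_enorm.
have ms k : [/\ measurable_fun setT (fun xi : Rn R n => (mgt_state (enorm xi ^+ 2) k).1.1),
    measurable_fun setT (fun xi : Rn R n => (mgt_state (enorm xi ^+ 2) k).1.2) &
    measurable_fun setT (fun xi : Rn R n => (mgt_state (enorm xi ^+ 2) k).2)].
  elim: k => [|k [IH1 IH2 IH3]]; first by split; exact: measurable_cst.
  split => //=; apply: measurable_funM => //; apply: measurableT_comp => //.
  apply: measurable_funD; last exact: measurable_funM.
  by apply: measurable_funD => //; apply: measurable_funM => //; exact: measurable_funM.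
apply: (@measurable_fun_cvg _ _ _ setT
   (fun N (xi : Rn R n) => pseries (fun k => mgt_coef (enorm xi ^+ 2) (k + j) / k`!%:R) t N)).
- move=> N; rewrite /pseries /series /=; apply: measurable_sum => k.
  apply: measurable_funM => //; apply: measurable_funM => //.
  by case: (ms (k + j)%N).
- move=> xi _; have r0 : 0 <= enorm xi ^+ 2 :> R by exact: sqr_ge0.
  exact: egf_cvg (mgt_rate_ge0 r0) (mgtk_bounded j r0).
Qed.

End mgt_kernel.

(** * Energy estimates *)

Section gronwall.
Context {R : realType}.
Implicit Types (E dE : R -> R) (k a F t x y : R).

Lemma nonincreasing_of_der E dE : (forall t, is_derive t 1 E (dE t)) ->
  (forall t, 0 <= t -> dE t <= 0) -> forall t, 0 <= t -> E t <= E 0.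
Proof.
move=> hE hd t; rewrite le_eqVlt => /predU1P[<-//|t0].
have [c /andP[c0 _] e] := @MVT_derT _ E dE 0 t t0 (fun z _ => hE z).
by rewrite -subr_le0 e subr0 mulr_le0_ge0 ?(ltW t0)// hd// ltW.
Qed.

Lemma gronwall E dE k : (forall t, is_derive t 1 E (dE t)) ->
  (forall t, 0 <= t -> dE t <= - k * E t) ->
  forall t, 0 <= t -> E t <= expR (- k * t) * E 0.
Proof.
move=> hE hd t t0.
have D z := der_M (der_exp (der_Zl k (der_id z))) (hE z).
have := @nonincreasing_of_der (fun t => expR (k * t) * E t) _ D _ t t0.
rewrite mulr0 expR0 mul1r => H.
rewrite mulNr expRN mulrC ler_pdivlMr ?expR_gt0// mulrC; apply: H => z z0.
rewrite mulr1 -mulrA -mulrDr mulr_ge0_le0 ?expR_ge0//.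
by have := hd z z0; lra.
Qed.

(** Subtracting the particular solution with amplitude [G = F / (k - a)] reduces to [gronwall]; the
    gap [2 * a <= k] gives [G <= 2 * F / k]. *)
Lemma gronwall_forced E dE k a F : (forall t, is_derive t 1 E (dE t)) -> 2 * a <= k -> 0 < k -> 0 <= F ->
  (forall t, 0 <= t -> dE t <= - k * E t + F * expR (- a * t)) ->
  forall t, 0 <= t -> E t <= expR (- k * t) * E 0 + 2 * F / k * expR (- a * t).
Proof.
move=> hE ak k0 F0 hd t t0.
have ka : 0 < k - a by lra.
pose G := F / (k - a).
have G0 : 0 <= G by rewrite divr_ge0// ltW.
have GF : G * (k - a) = F by rewrite mulfVK// gt_eqF.
have D z := der_B (hE z) (der_Zl G (der_exp (der_Zl (- a) (der_id z)))).
have := @gronwall (fun t => E t - G * expR (- a * t)) _ k D _ t t0.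
rewrite mulr0 expR0 !mulr1 => H.
have {H} : E t - G * expR (- a * t) <= expR (- k * t) * (E 0 - G).
  by apply: H => z z0; have := hd z z0; rewrite -GF; set e := expR _ => h; lra.
have GF2 : G <= 2 * F / k.
  by rewrite ler_pdivlMr// -GF; nra.
have := expR_ge0 (- k * t); have := expR_ge0 (- a * t).
set e1 := expR (- a * t); set e2 := expR (- k * t); nra.
Qed.

Lemma young k x y : 0 < k -> 2 * (x * y) <= k * x ^+ 2 + y ^+ 2 / k.
Proof.
move=> k0; rewrite -subr_ge0.
have -> : k * x ^+ 2 + y ^+ 2 / k - 2 * (x * y) = k * (x - y / k) ^+ 2.
  by field; rewrite gt_eqF.
by rewrite mulr_ge0 ?sqr_ge0// ltW.
Qed.

(** The forced Gronwall bound for [q ^ 2], since [2 q (h - q) <= h ^ 2 - q ^ 2]. In the constant 3,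
    one unit comes from the initial value and two from the forcing. *)
Lemma damped (q dq h : R -> R) (tau a H : R) : 0 < tau -> 4 * (tau * a) <= 1 ->
  (forall t, is_derive t 1 q (dq t)) -> (forall t, tau * dq t = - q t + h t) ->
  (forall t, 0 <= t -> `|h t| <= H * expR (- a * t)) -> q 0 ^+ 2 <= H ^+ 2 -> 0 <= a ->
  forall t, 0 <= t -> q t ^+ 2 <= 3 * H ^+ 2 * expR (- a * t) ^+ 2.
Proof.
move=> tau0 ta hq qe hh q0 a0 t t0.
have tv : tau^-1 * tau = 1 by rewrite mulVf// gt_eqF.
have tv0 : 0 < tau^-1 by rewrite invr_gt0.
have H0 : 0 <= H by have := hh 0 (lexx _); rewrite mulr0 expR0 mulr1; exact: le_trans.
have ee z : expR (- (2 * a) * z) = expR (- a * z) ^+ 2.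
  by rewrite expr2 -expRD; congr expR; ring.
have c1 : 2 * (2 * a) <= tau^-1 by rewrite -[leRHS]mul1r ler_pdivlMr//; lra.
have G0 : 0 <= tau^-1 * H ^+ 2 by rewrite mulr_ge0 ?sqr_ge0// ltW.
apply: le_trans (gronwall_forced (fun z => der_sqr (hq z)) c1 tv0 G0 _ t0) _ => [z z0|].
- rewrite ee; have dqE : dq z = tau^-1 * (- q z + h z) by rewrite -qe mulrA tv mul1r.
  have : h z ^+ 2 <= H ^+ 2 * expR (- a * z) ^+ 2.
    by rewrite -exprMn -real_normK ?num_real// lerXn2r ?nnegrE ?mulr_ge0 ?expR_ge0 ?hh.
  rewrite dqE; set e := expR _ ^+ 2; set v := tau^-1; move: (q z) (h z) tv0 => x y v0 hy.
  have := mulr_ge0 (ltW v0) (sqr_ge0 (x - y)); have := ler_wpM2l (ltW v0) hy.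
  rewrite -/v; lra.
- rewrite ee; set e := expR (- a * t) ^+ 2.
  have -> : 2 * (tau^-1 * H ^+ 2) / tau^-1 = 2 * H ^+ 2 by field; rewrite gt_eqF.
  have : expR (- tau^-1 * t) <= e by rewrite /e -ee ler_expR; nra.
  have := expR_ge0 (- tau^-1 * t); set e' := expR _ => e0 ee'.
  have := sqr_ge0 H; have := sqr_ge0 (q 0); nra.
Qed.

End gronwall.

(** * The Lyapunov functional *)

Section energy.
Context {R : realType} (tau delta : R).
Hypotheses (tau0 : 0 < tau) (delta0 : 0 < delta).

(** Size of the cross terms. The bounds by 1, [(2 * tau)^-1] and [delta] keep the functional
    equivalent to [energy0]. The last denominator collects the coefficients of [r2 * q ^ 2] that
    Young's inequality produces in [energy_dissipation], so that they use at most half of the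
    natural dissipation [2 * delta * r2 * q ^ 2]. *)
Definition energy_weight : R :=
  Num.min (Num.min 1 (2 * tau)^-1) (delta / (5 + 4 * tau ^+ 2 + tau * delta + delta ^+ 2)).
Local Notation al := energy_weight.

Lemma energy_weight_spec : [/\ 0 < al, al <= 1, al * tau <= 2^-1, al <= delta &
  al * (5 + 4 * tau ^+ 2 + tau * delta + delta ^+ 2) <= delta].
Proof.
have P0 : 1 <= 5 + 4 * tau ^+ 2 + tau * delta + delta ^+ 2.
  by have := sqr_ge0 tau; have := sqr_ge0 delta; have := mulr_gt0 tau0 delta0; lra.
have P1 : 0 < 5 + 4 * tau ^+ 2 + tau * delta + delta ^+ 2 by exact: lt_le_trans P0.
have a0 : 0 < al by rewrite /energy_weight !lt_min ltr01 invr_gt0 mulr_gt0// divr_gt0.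
have a4 : al * (5 + 4 * tau ^+ 2 + tau * delta + delta ^+ 2) <= delta.
  by rewrite -ler_pdivlMr// /energy_weight ge_min lexx orbT.
split => //.
- by rewrite /energy_weight !ge_min lexx.
- have : al <= (2 * tau)^-1 by rewrite /energy_weight !ge_min lexx orbT.
  by rewrite -(ler_pM2r tau0) invfM mulfVK// gt_eqF.
- by apply: le_trans a4; rewrite ler_peMr// ltW.
Qed.

Definition energy0 (r2 w0 w1 q : R) := w1 ^+ 2 + r2 * w0 ^+ 2 + delta * tau * (r2 * q ^+ 2).

Lemma energy0_ge0 r2 w0 w1 q : 0 <= r2 -> 0 <= energy0 r2 w0 w1 q.
Proof.
move=> r20; rewrite /energy0 !addr_ge0 ?sqr_ge0//; first by rewrite mulr_ge0 ?sqr_ge0.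
by apply: mulr_ge0; apply: mulr_ge0; rewrite ?sqr_ge0// ltW.
Qed.

(** Only [q] is damped by [energy0] itself. Differentiating the first cross term yields
    [- al * w1 ^ 2]; the second yields [- al / 2 * r2 * w0 ^ 2] and gives back [al / 2 * w1 ^ 2].
    The parameter [m] plays the role of the minimum of 1 and [r2]. *)
Definition energy (m r2 w0 w1 q : R) :=
  energy0 r2 w0 w1 q + m * (- (al * tau) * (w1 * q) + al / 2 * (w1 * w0)).

Lemma energy_equiv m r2 w0 w1 q : 0 <= m -> m <= 1 -> m <= r2 ->
  energy0 r2 w0 w1 q <= 2 * energy m r2 w0 w1 q /\
  energy m r2 w0 w1 q <= 2 * energy0 r2 w0 w1 q.
Proof.
move=> m0 m1 mr; have [a0 a1 a2 a3 _] := energy_weight_spec.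
rewrite /energy /energy0; set E := al.
have m2 : m ^+ 2 <= r2 by apply: le_trans mr; rewrite expr2 ler_piMr.
have q2 : m ^+ 2 * q ^+ 2 <= r2 * q ^+ 2 by rewrite ler_wpM2r ?sqr_ge0.
have w2 : m ^+ 2 * w0 ^+ 2 <= r2 * w0 ^+ 2 by rewrite ler_wpM2r ?sqr_ge0.
have at0 : 0 < E * tau by exact: mulr_gt0.
have b1 : `|m * (E * tau * (w1 * q))| <= E * tau / 2 * (w1 ^+ 2 + m ^+ 2 * q ^+ 2).
  rewrite ler_norml; have := sqr_ge0 (w1 - m * q); have := sqr_ge0 (w1 + m * q).
  move: at0; set c := E * tau => c0 h1 h2.
  by apply/andP; split; [have := mulr_ge0 (ltW c0) h1|have := mulr_ge0 (ltW c0) h2]; lra.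
have b2 : `|m * (E / 2 * (w1 * w0))| <= E / 4 * (w1 ^+ 2 + m ^+ 2 * w0 ^+ 2).
  rewrite ler_norml; have := sqr_ge0 (w1 - m * w0); have := sqr_ge0 (w1 + m * w0) => h1 h2.
  by apply/andP; split; [have := mulr_ge0 (ltW a0) h1|have := mulr_ge0 (ltW a0) h2]; rewrite -/E; lra.
have c1 : E * tau / 2 * (w1 ^+ 2 + m ^+ 2 * q ^+ 2) <= w1 ^+ 2 / 4 + delta * tau * (r2 * q ^+ 2) / 2.
  have := ler_wpM2r (sqr_ge0 w1) a2.
  have u0 : 0 <= m ^+ 2 * q ^+ 2 by rewrite mulr_ge0 ?sqr_ge0.
  have h1 : E * tau * (m ^+ 2 * q ^+ 2) <= delta * tau * (m ^+ 2 * q ^+ 2).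
    by rewrite ler_wpM2r// ler_wpM2r// ltW.
  have h2 : delta * tau * (m ^+ 2 * q ^+ 2) <= delta * tau * (r2 * q ^+ 2).
    by rewrite ler_wpM2l// mulr_ge0// ltW.
  rewrite -/E; lra.
have c2 : E / 4 * (w1 ^+ 2 + m ^+ 2 * w0 ^+ 2) <= w1 ^+ 2 / 4 + r2 * w0 ^+ 2 / 4.
  have h : 0 <= w1 ^+ 2 + m ^+ 2 * w0 ^+ 2 by rewrite addr_ge0 ?sqr_ge0// mulr_ge0 ?sqr_ge0.
  have := ler_wpM2r h a1; rewrite -/E; lra.
move: b1 b2; rewrite !ler_norml => /andP[b1 b1'] /andP[b2 b2'].
have := sqr_ge0 w1; have r20 : 0 <= r2 by exact: le_trans mr.
have := mulr_ge0 r20 (sqr_ge0 w0).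
have := mulr_ge0 (mulr_ge0 (ltW delta0) (ltW tau0)) (mulr_ge0 r20 (sqr_ge0 q)).
split; lra.
Qed.

(** The cross terms damp [w1 ^ 2] and [r2 * w0 ^ 2] with weight [al / 2] each (times [m]); Young's
    inequality spends [3 * al / 16] and the rate takes [al / 4]. The second bound limits the cost in
    [q] to [delta / 2 * r2 * q ^ 2]. *)
Definition energy_rate : R := Num.min (al / 4) (2 * tau)^-1.
Definition energy_const : R := 16 / al + 4 * delta + al * (5 + tau ^+ 2).

(* The left-hand side is the derivative of [energy m r2 w0 w1 q] along
   w0' = w1, w1' = - r2 w0 - delta r2 q + m g, tau q' = - q + w1 + f. *)
Lemma energy_dissipation m r2 w0 w1 q g f : 0 < m -> m <= 1 -> m <= r2 ->
  2 * w1 * (- r2 * w0 - delta * r2 * q + m * g) + r2 * (2 * w0 * w1) +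
    2 * delta * (r2 * (q * (- q + w1 + f))) +
    m * (- al * (tau * (- r2 * w0 - delta * r2 * q + m * g) * q + w1 * (- q + w1 + f)) +
         al / 2 * ((- r2 * w0 - delta * r2 * q + m * g) * w0 + w1 * w1))
  <= - energy_rate * m * energy0 r2 w0 w1 q + energy_const * (m * g ^+ 2 + r2 * f ^+ 2).
Proof.
move=> m0 m1 mr; have [a0 a1 a2 a3 a4] := energy_weight_spec; set A := al in a0 a1 a2 a3 a4 *.
have r20 : 0 < r2 by exact: lt_le_trans mr.
(* Of the indefinite terms estimated in [T1] to [T11], three spend [A / 16] of the damping of [w1]
   and three spend [A / 16] of that of [w0]. The rest is charged to [q] and to the forcing. *)
have T1 : 2 * (w1 * (m * g)) <= m * (A / 16 * w1 ^+ 2) + m * (16 / A * g ^+ 2).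
  have := young w1 g (_ : 0 < A / 16); rewrite divr_gt0// => /(_ isT).
  have -> : g ^+ 2 / (A / 16) = 16 / A * g ^+ 2 by field; rewrite gt_eqF.
  by move=> /(ler_wpM2l (ltW m0)); lra.
have T2 : 2 * delta * (r2 * (q * f)) <= delta / 4 * (r2 * q ^+ 2) + 4 * delta * (r2 * f ^+ 2).
  have := mulr_ge0 (mulr_ge0 (ltW delta0) (ltW r20)) (sqr_ge0 (q / 2 - 2 * f)); lra.
have mq : m * q ^+ 2 <= r2 * q ^+ 2 by rewrite ler_wpM2r ?sqr_ge0.
have mrq : m * (r2 * q ^+ 2) <= r2 * q ^+ 2 by rewrite ler_piMl// mulr_ge0 ?sqr_ge0// ltW.
have T3 : m * (A * (w1 * q)) <= m * (A / 16 * w1 ^+ 2) + 4 * A * (r2 * q ^+ 2).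
  have := mulr_ge0 (mulr_ge0 (ltW a0) (ltW m0)) (sqr_ge0 (w1 / 4 - 2 * q)).
  have := ler_wpM2l (ltW a0) mq; lra.
have T4 : m * (A * (tau * r2 * (w0 * q))) <= m * (A / 16 * (r2 * w0 ^+ 2)) + 4 * A * tau ^+ 2 * (r2 * q ^+ 2).
  have := mulr_ge0 (mulr_ge0 (mulr_ge0 (ltW a0) (ltW m0)) (ltW r20)) (sqr_ge0 (w0 / 4 - 2 * (tau * q))).
  have := ler_wpM2l (mulr_ge0 (ltW a0) (sqr_ge0 tau)) mrq; lra.
have T5 : m * (A * (tau * delta * (r2 * q ^+ 2))) <= A * (tau * delta) * (r2 * q ^+ 2).
  have := ler_wpM2l (mulr_ge0 (ltW a0) (mulr_ge0 (ltW tau0) (ltW delta0))) mrq; lra.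
have m2 : m ^+ 2 <= m by rewrite expr2 ler_piMr// ltW.
have T6 : - (m * (A * (tau * (m * g) * q))) <= A * (r2 * q ^+ 2) + A * tau ^+ 2 * (m * g ^+ 2).
  have h1 := mulr_ge0 (ltW a0) (sqr_ge0 (m * (tau * g) + q)).
  have h1' := mulr_ge0 (mulr_ge0 (ltW a0) (ltW m0)) (sqr_ge0 (m * (tau * g) + q)).
  have h2 : m ^+ 2 * (tau ^+ 2 * g ^+ 2) <= tau ^+ 2 * g ^+ 2.
    by rewrite ler_piMl//; [rewrite mulr_ge0 ?sqr_ge0|exact: le_trans m2 m1].
  have h3 := ler_wpM2l (mulr_ge0 (ltW a0) (ltW m0)) h2.
  have h4 := ler_wpM2l (ltW a0) mq.
  have h5 := mulr_ge0 (mulr_ge0 (ltW a0) (ltW m0)) (mulr_ge0 (sqr_ge0 tau) (sqr_ge0 g)).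
  have h6 := mulr_ge0 (mulr_ge0 (ltW a0) (ltW r20)) (sqr_ge0 q).
  lra.
have T7 : - (m * (A * (w1 * f))) <= m * (A / 16 * w1 ^+ 2) + 4 * A * (r2 * f ^+ 2).
  have := mulr_ge0 (mulr_ge0 (ltW a0) (ltW m0)) (sqr_ge0 (w1 / 4 + 2 * f)).
  have mf : m * f ^+ 2 <= r2 * f ^+ 2 by rewrite ler_wpM2r ?sqr_ge0.
  have := ler_wpM2l (ltW a0) mf; lra.
have T10 : - (m * (A / 2 * (delta * r2 * (q * w0)))) <= m * (A / 16 * (r2 * w0 ^+ 2)) + A * delta ^+ 2 * (r2 * q ^+ 2).
  have := mulr_ge0 (mulr_ge0 (mulr_ge0 (ltW a0) (ltW m0)) (ltW r20)) (sqr_ge0 (w0 / 4 + delta * q)).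
  have := ler_wpM2l (mulr_ge0 (ltW a0) (sqr_ge0 delta)) mrq; lra.
have T11 : m * (A / 2 * (m * g * w0)) <= m * (A / 16 * (r2 * w0 ^+ 2)) + A * (m * g ^+ 2).
  have h1 := mulr_ge0 (mulr_ge0 (ltW a0) (ltW m0)) (sqr_ge0 (m * w0 / 4 - g)).
  have h2 : m ^+ 2 * w0 ^+ 2 <= r2 * w0 ^+ 2 by rewrite ler_wpM2r ?sqr_ge0// (le_trans m2).
  have := ler_wpM2l (mulr_ge0 (ltW a0) (ltW m0)) h2; lra.
have aq : A * (5 + 4 * tau ^+ 2 + tau * delta + delta ^+ 2) * (r2 * q ^+ 2) <= delta * (r2 * q ^+ 2).
  by rewrite ler_wpM2r// mulr_ge0 ?sqr_ge0// ltW.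
have c0 : energy_rate <= A / 4 by rewrite /energy_rate ge_min lexx.
have c1 : energy_rate * (delta * tau * (r2 * q ^+ 2)) <= delta / 2 * (r2 * q ^+ 2).
  have : energy_rate * tau <= 2^-1.
    by rewrite -ler_pdivlMr// -invfM mulrC /energy_rate ge_min [tau * 2]mulrC lexx orbT.
  move=> /(ler_wpM2r (mulr_ge0 (ltW delta0) (mulr_ge0 (ltW r20) (sqr_ge0 q)))); lra.
have c1' : m * (energy_rate * (delta * tau * (r2 * q ^+ 2))) <= delta / 2 * (r2 * q ^+ 2).
  apply: le_trans (ler_wpM2l (ltW m0) c1) _; rewrite ler_piMl//.
  by rewrite mulr_ge0 ?divr_ge0 ?(ltW delta0)//; apply: mulr_ge0; [exact: ltW|exact: sqr_ge0].
have c2 : m * (energy_rate * w1 ^+ 2) <= m * (A / 4 * w1 ^+ 2).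
  by rewrite ler_wpM2l ?(ltW m0)// ler_wpM2r ?sqr_ge0.
have c3 : m * (energy_rate * (r2 * w0 ^+ 2)) <= m * (A / 4 * (r2 * w0 ^+ 2)).
  by rewrite ler_wpM2l ?(ltW m0)// ler_wpM2r// mulr_ge0 ?sqr_ge0// ltW.
have p1 := mulr_ge0 (mulr_ge0 (ltW a0) (ltW m0)) (sqr_ge0 w1).
have p2 := mulr_ge0 (mulr_ge0 (mulr_ge0 (ltW a0) (ltW m0)) (ltW r20)) (sqr_ge0 w0).
have p3 := mulr_ge0 (mulr_ge0 (ltW delta0) (ltW r20)) (sqr_ge0 q).
have p4 := mulr_ge0 (ltW r20) (sqr_ge0 f).
have p5 := mulr_ge0 (ltW m0) (sqr_ge0 g).
have p6 := mulr_ge0 (ltW a0) p4.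
have p7 := mulr_ge0 (mulr_ge0 (ltW a0) (sqr_ge0 tau)) p4.
have p8 := mulr_ge0 (ltW delta0) p5.
have p9 : 0 <= 16 / A * (r2 * f ^+ 2) by rewrite mulr_ge0// divr_ge0// ltW.
have p10 := mulr_ge0 (ltW a0) p5.
rewrite /energy0 /energy_const -/A; lra.
Qed.

Lemma energy_rate_gt0 : 0 < energy_rate.
Proof. by have [a0 _ _ _ _] := energy_weight_spec; rewrite lt_min divr_gt0//= invr_gt0 mulr_gt0. Qed.

Lemma energy_const_gt0 : 0 < energy_const.
Proof.
have [a0 _ _ _ _] := energy_weight_spec; rewrite /energy_const.
have h1 : 0 < 16 / al by rewrite divr_gt0.
have h2 : 0 < al * (5 + tau ^+ 2) by rewrite mulr_gt0// ltr_wpDr ?sqr_ge0.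
by rewrite !addr_gt0// mulr_gt0.
Qed.

(** The forcing is assumed to enter the energy with a factor [m], which cancels the [m] in the decay
    rate: the constant is uniform in the frequency. Passing to [energy] and back costs 4 on the
    initial value; the forcing gives 8 by [gronwall_forced], doubled on the way back. *)
Lemma energy_decay (m r2 a K : R) (w0 w1 q g f : R -> R) :
  0 < m -> m <= 1 -> m <= r2 -> 0 <= a -> 8 * a <= energy_rate * m ->
  (forall t : R, is_derive t 1 w0 (w1 t)) ->
  (forall t : R, is_derive t 1 w1 (- r2 * w0 t - delta * r2 * q t + m * g t)) ->
  (forall t : R, is_derive t 1 q (tau^-1 * (- q t + w1 t + f t))) ->
  (forall t : R, 0 <= t -> g t ^+ 2 <= K ^+ 2 * expR (- a * t) ^+ 2) ->
  (forall t : R, 0 <= t -> r2 * f t ^+ 2 <= m * K ^+ 2 * expR (- a * t) ^+ 2) ->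
  energy0 r2 (w0 0) (w1 0) (q 0) <= K ^+ 2 ->
  forall t : R, 0 <= t -> energy0 r2 (w0 t) (w1 t) (q t) <=
    (4 + 16 * energy_const / energy_rate) * K ^+ 2 * expR (- a * t) ^+ 2.
Proof.
move=> m0 m1 mr a0 ha h0 h1 h2 hg hf hE t t0.
have c0 := energy_rate_gt0; have C0 := energy_const_gt0.
have r20 : 0 < r2 by exact: lt_le_trans mr.
have tv : tau * tau^-1 = 1 by rewrite divff// gt_eqF.
have equ z := energy_equiv (w0 z) (w1 z) (q z) (ltW m0) m1 mr.
have D (z : R) : is_derive z 1 (fun t => energy m r2 (w0 t) (w1 t) (q t)) _ :=
  der_D (der_D (der_D (der_sqr (h1 z)) (der_Zl r2 (der_sqr (h0 z))))
     (der_Zl (delta * tau) (der_Zl r2 (der_sqr (h2 z)))))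
   (der_Zl m (der_D (der_Zl (- (al * tau)) (der_M (h1 z) (h2 z))) (der_Zl (al / 2) (der_M (h1 z) (h0 z))))).
have ee z : expR (- (2 * a) * z) = expR (- a * z) ^+ 2.
  by rewrite expr2 -expRD; congr expR; ring.
have k0 : 0 < energy_rate * m / 2 by rewrite divr_gt0// mulr_gt0.
have c1 : 2 * (2 * a) <= energy_rate * m / 2 by lra.
have G0 : 0 <= 2 * energy_const * m * K ^+ 2 by apply: mulr_ge0; rewrite ?sqr_ge0// !mulr_ge0// ltW.
have H : energy m r2 (w0 t) (w1 t) (q t) <= expR (- (energy_rate * m / 2) * t) *
    energy m r2 (w0 0) (w1 0) (q 0) +
    2 * (2 * energy_const * m * K ^+ 2) / (energy_rate * m / 2) * expR (- (2 * a) * t).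
  apply: (gronwall_forced D c1 k0 G0 _ t0) => z z0.
  have := energy_dissipation (w0 z) (w1 z) (q z) (g z) (f z) m0 m1 mr.
  have := hg z z0; have := hf z z0; rewrite ee; set e2 := expR _ ^+ 2 => hf' hg'.
  have [_ eq2] := equ z; move=> H.
  have e1 : - energy_rate * m * energy0 r2 (w0 z) (w1 z) (q z) <=
      - (energy_rate * m / 2) * energy m r2 (w0 z) (w1 z) (q z).
    by have := ler_wpM2l (ltW k0) eq2; lra.
  have e3 : energy_const * (m * g z ^+ 2 + r2 * f z ^+ 2) <= 2 * energy_const * m * K ^+ 2 * e2.
    have := ler_wpM2l (ltW m0) hg' => hg''.
    by have := ler_wpM2l (ltW C0) (lerD hg'' hf'); lra.
  apply: le_trans (lerD e1 e3); apply: le_trans H; rewrite le_eqVlt; apply/orP; left; apply/eqP.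
  have hX : - q z + w1 z + f z = tau * (tau^-1 * (- q z + w1 z + f z)).
    by rewrite mulrA tv mul1r.
  rewrite {3 4}hX; set X := tau^-1 * _; move: al => A; ring.
rewrite ee in H; set e2 := expR (- a * t) ^+ 2 in H *.
  have [eq1 _] := equ t; have [_ eq2] := equ 0.
  have : expR (- (energy_rate * m / 2) * t) <= e2.
    by rewrite /e2 -ee ler_expR; have := ler_wpM2r t0 ha; have := mulr_ge0 a0 t0; lra.
  have := expR_ge0 (- (energy_rate * m / 2) * t); set e' := expR _ => e'0 e'2.
  have E0 : 0 <= energy m r2 (w0 0) (w1 0) (q 0).
    have [h _] := equ 0; have : 0 <= energy0 r2 (w0 0) (w1 0) (q 0); last by lra.
    exact: energy0_ge0 (ltW r20).
  have b1 : e' * energy m r2 (w0 0) (w1 0) (q 0) <= 2 * K ^+ 2 * e2.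
    rewrite mulrC; apply: ler_pM => //; lra.
  have eqc : 2 * (2 * energy_const * m * K ^+ 2) / (energy_rate * m / 2) = 8 * energy_const / energy_rate * K ^+ 2.
    by field; rewrite !gt_eqF.
  rewrite eqc in H; apply: le_trans eq1 _.
  have := sqr_ge0 K; have : 0 <= e2 by exact: sqr_ge0.
  rewrite -/e' in H; lra.
Qed.

End energy.

(** * Rules for bounds with inferred constants *)

Section bound_combinators.
Context {R : realType}.
Implicit Types c k x y X Y : R.

(** In these rules the coefficient is found by unification: a bound for a compound expression is
    assembled rule by rule, and the constant fills an existential variable created before the
    frequency, the time and the data are introduced. *)
Lemma bndD c1 c2 x y X : `|x| <= c1 * X -> `|y| <= c2 * X -> `|x + y| <= (c1 + c2) * X.
Proof. by move=> h1 h2; rewrite mulrDl (le_trans (ler_normD _ _))// lerD. Qed.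

Lemma bndN c x X : `|x| <= c * X -> `|- x| <= c * X.
Proof. by rewrite normrN. Qed.

Lemma bndB c1 c2 x y X : `|x| <= c1 * X -> `|y| <= c2 * X -> `|x - y| <= (c1 + c2) * X.
Proof. by move=> h1 h2; apply: bndD => //; exact: bndN. Qed.

Lemma bndM k c x X : `|x| <= c * X -> `|k * x| <= (`|k| * c) * X.
Proof. by move=> h; rewrite normrM -mulrA ler_wpM2l. Qed.

Lemma bndW Y c x X : `|x| <= c * X -> 0 <= X -> X <= Y -> `|x| <= `|c| * Y.
Proof.
move=> h X0 XY; apply: le_trans h _; apply: (@le_trans _ _ (`|c| * X)).
  by rewrite ler_wpM2r// ler_norm.
by rewrite ler_wpM2l.
Qed.

Lemma bndWl c x (s N E L : R) : 0 <= s -> 0 <= N -> 0 <= E -> 0 <= L ->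
  `|x| <= c * (s * (N * E)) -> `|x| <= `|c| * (N * (s * E + L)).
Proof.
move=> s0 N0 E0 L0 h; apply: bndW h _ _; first by rewrite mulr_ge0// mulr_ge0.
by rewrite mulrDr mulrCA lerDl mulr_ge0.
Qed.

Lemma bndWr c x (s N E L : R) : 0 <= s -> 0 <= N -> 0 <= E -> 0 <= L ->
  `|x| <= c * (N * L) -> `|x| <= `|c| * (N * (s * E + L)).
Proof.
move=> s0 N0 E0 L0 h; apply: bndW h _ _; first by rewrite mulr_ge0.
by rewrite mulrDr lerDr mulr_ge0// mulr_ge0.
Qed.

Lemma bnd_sqr c x X : 0 <= c -> 0 <= X -> x ^+ 2 <= c * X ^+ 2 -> `|x| <= (c + 1) * X.
Proof.
move=> c0 X0 h; have B0 : 0 <= (c + 1) * X by rewrite mulr_ge0// addr_ge0.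
rewrite -[leRHS]ger0_norm// -ler_sqr ?nnegrE// !real_normK ?num_real//.
apply: le_trans h _; rewrite exprMn ler_wpM2r ?sqr_ge0//.
by have := sqr_ge0 c; lra.
Qed.

Lemma sqr_bnd c x X : `|x| <= c * X -> x ^+ 2 <= c ^+ 2 * X ^+ 2.
Proof.
move=> h; rewrite -exprMn -real_normK ?num_real// lerXn2r ?nnegrE//.
exact: le_trans h.
Qed.

Lemma bndR s c x X : 0 <= s -> `|x| <= c * X -> `|s * x| <= c * (s * X).
Proof. by move=> s0 h; rewrite normrM ger0_norm// mulrCA ler_wpM2l. Qed.

Lemma bndRr s c x X : 0 <= s -> `|x| <= c * X -> `|x * s| <= c * (X * s).
Proof. by move=> s0 h; rewrite normrM (ger0_norm s0) mulrA ler_wpM2r. Qed.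

Lemma bndA c x s X Y : `|x| <= c * (s * (X * Y)) -> `|x| <= c * (s * X * Y).
Proof. by rewrite (mulrA s). Qed.

Lemma bndAV c x s X Y : `|x| <= c * (s * X * Y) -> `|x| <= c * (s * (X * Y)).
Proof. by rewrite (mulrA s). Qed.

Lemma bndS s c x X : 0 <= s -> s <= 1 -> `|x| <= c * X -> `|s * x| <= c * X.
Proof. by move=> s0 s1; apply: le_trans; rewrite normrM ger0_norm// ler_piMl. Qed.

Lemma bndV s c x X : 0 < s -> `|s * x| <= c * (s * X) -> `|x| <= c * X.
Proof. by move=> s0; rewrite normrM gtr0_norm// mulrCA ler_pM2l. Qed.

End bound_combinators.

(** * High-frequency and low-frequency estimates *)

Section mgt_ode.
Context {R : realType} (tau delta : R).
Hypotheses (tau0 : 0 < tau) (delta0 : 0 < delta).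
Local Notation b := (delta + tau).

(** The equation is imposed on every derivative because the low-frequency argument works with the
    equation differentiated once. *)
Definition mgt_ode (r : R) (y : nat -> R -> R) :=
  (forall j (t : R), is_derive t 1 (y j) (y j.+1 t)) /\
  (forall j (t : R), tau * y j.+3 t = - (y j.+2 t + b * r ^+ 2 * y j.+1 t + r ^+ 2 * y j t)).

(** The successive bounds serve [energy_decay], then [damped] with time constants [b] and [tau], and
    finally the comparison with the Gaussian [exp(- delta r^2 t / 2)] of the profile. *)
Definition decay_rate : R :=
  Num.min (Num.min (energy_rate tau delta / 8) (4 * b)^-1) (Num.min (4 * tau)^-1 (delta / 2)).
Local Notation a := decay_rate.

Lemma decay_rate_spec : [/\ 0 < a, 8 * a <= energy_rate tau delta, 4 * (b * a) <= 1,
  4 * (tau * a) <= 1 & a <= delta / 2].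
Proof.
have b0 : 0 < b by exact: addr_gt0.
have e0 := energy_rate_gt0 tau0 delta0.
split.
- by rewrite /decay_rate !lt_min !divr_gt0//= !invr_gt0 !mulr_gt0.
- by rewrite -ler_pdivlMl// mulrC /decay_rate !ge_min lexx.
- by rewrite mulrA -ler_pdivlMl ?mulr_gt0// mulr1 /decay_rate !ge_min lexx orbT.
- by rewrite mulrA -ler_pdivlMl ?mulr_gt0// mulr1 /decay_rate !ge_min lexx !orbT.
- by rewrite /decay_rate !ge_min lexx !orbT.
Qed.

(** The energy, with [m = 1], controls w', r w and r y', hence y only with one power of r less than
    wanted. The missing power comes from an auxiliary first-order damped equation. *)
Lemma high_freq_bound : exists c0 c1 c2 : R, forall r y, 1 <= r -> mgt_ode r y ->
  let N : R := `|y 2%N 0| + r * `|y 1%N 0| + r ^+ 2 * `|y 0%N 0| in forall t : R, 0 <= t ->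
  [/\ `|r ^+ 2 * y 0%N t| <= c0 * (N * expR (- a * t)),
      `|r * y 1%N t| <= c1 * (N * expR (- a * t)) &
      `|y 2%N t| <= c2 * (N * expR (- a * t))].
Proof.
have b0 : 0 < b by exact: addr_gt0.
have [a0 a1 a2 a3 a4] := decay_rate_spec.
have tv : tau^-1 * tau = 1 by rewrite mulVf// gt_eqF.
(* The first two summands bound the initial energy by multiples of [N ^ 2]; the last one ensures
   [C0 <= C0 ^ 2], so that [C0 * N] can serve as the amplitude. *)
pose C0 := 2 * (1 + tau) ^+ 2 + delta * tau + 1.
pose C1 := 4 + 16 * energy_const tau delta / energy_rate tau delta.
have dt0 : 0 < delta * tau by exact: mulr_gt0.
have C00 : 1 <= C0 by rewrite lerDr addr_ge0 ?(ltW dt0)// mulr_ge0 ?sqr_ge0.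
have C10 : 0 <= C1 by rewrite addr_ge0// divr_ge0 ?(ltW (energy_rate_gt0 _ _))// mulr_ge0// ltW// energy_const_gt0.
do 3 eexists; move=> r y r1 [dy ey] N t t0.
have r0 : 0 < r by exact: lt_le_trans r1.
have rr : r <= r ^+ 2 by rewrite expr2 ler_peMl// ltW.
have N0 : 0 <= N by rewrite /N !addr_ge0// mulr_ge0// ?sqr_ge0// ltW.
have n2 : `|y 2%N 0| <= N by rewrite /N -addrA lerDl addr_ge0// mulr_ge0// ?sqr_ge0// ltW.
have n1 : r * `|y 1%N 0| <= N.
  by rewrite /N -addrA addrCA lerDl addr_ge0// mulr_ge0// sqr_ge0.
have n0 : r ^+ 2 * `|y 0%N 0| <= N.
  by rewrite /N lerDr addr_ge0// mulr_ge0// ltW.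
have n1' : `|y 1%N 0| <= N by apply: le_trans n1; rewrite ler_peMl.
have n0' : r * `|y 0%N 0| <= N by apply: le_trans n0; rewrite ler_wpM2r.
have h1 (z : R) : is_derive z 1 (fun z => y 1%N z + tau * y 2%N z)
    (- r ^+ 2 * (y 0%N z + tau * y 1%N z) - delta * r ^+ 2 * y 1%N z + 1 * 0).
  by apply: der_eq (der_D (dy 1%N z) (der_Zl tau (dy 2%N z))) _; rewrite ey; ring.
have h0 (z : R) : is_derive z 1 (fun z => y 0%N z + tau * y 1%N z) (y 1%N z + tau * y 2%N z).
  exact: der_D (dy 0%N z) (der_Zl tau (dy 1%N z)).
have h2 (z : R) : is_derive z 1 (y 1%N) (tau^-1 * (- y 1%N z + (y 1%N z + tau * y 2%N z) + 0)).
  by apply: der_eq (dy 1%N z) _; rewrite addr0 addKr mulrA tv mul1r.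
have w10 : `|y 1%N 0 + tau * y 2%N 0| <= (1 + tau) * N.
  rewrite (le_trans (ler_normD _ _))// mulrDl mul1r lerD// normrM ger0_norm ?(ltW tau0)//.
  by rewrite ler_wpM2l// ltW.
have w00 : `|r * (y 0%N 0 + tau * y 1%N 0)| <= (1 + tau) * N.
  rewrite mulrDr (le_trans (ler_normD _ _))// mulrDl mul1r !normrM !(ger0_norm (ltW r0)) lerD//.
  by rewrite mulrCA (ger0_norm (ltW tau0)) ler_wpM2l// ltW.
have q0 : `|r * y 1%N 0| <= 1 * N by rewrite normrM (ger0_norm (ltW r0)) mul1r.
have E0 : energy0 tau delta (r ^+ 2) (y 0%N 0 + tau * y 1%N 0) (y 1%N 0 + tau * y 2%N 0) (y 1%N 0) <= (C0 * N) ^+ 2.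
  rewrite /energy0 -!exprMn.
  have := sqr_bnd w10; have := sqr_bnd w00; have := ler_wpM2l (ltW dt0) (sqr_bnd q0).
  move=> u1 u2 u3; apply: le_trans (lerD (lerD u3 u2) u1) _.
  rewrite [leRHS]exprMn [leLHS](_ : _ = (2 * (1 + tau) ^+ 2 + delta * tau) * N ^+ 2); last by ring.
  rewrite ler_wpM2r ?sqr_ge0//.
  have : C0 <= C0 ^+ 2 by rewrite expr2 ler_peMl// (le_trans _ C00).
  by apply: le_trans; rewrite /C0; lra.
have Ed := @energy_decay _ tau delta tau0 delta0 1 (r ^+ 2) a (C0 * N) _ _ _ (fun=> 0) (fun=> 0)
  ltr01 (lexx _) (le_trans r1 rr) (ltW a0) _ h0 h1 h2.
have {}Ed : forall z : R, 0 <= z -> energy0 tau delta (r ^+ 2) (y 0%N z + tau * y 1%N z) (y 1%N z + tau * y 2%N z) (y 1%N z) <= C1 * (C0 * (N * expR (- a * z))) ^+ 2.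
  move=> z z0; rewrite (_ : C1 * _ = C1 * (C0 * N) ^+ 2 * expR (- a * z) ^+ 2); last by ring.
  apply: Ed => //; first by rewrite mulr1.
  - by move=> u _; rewrite expr0n/= mulr_ge0 ?sqr_ge0.
  - by move=> u _; rewrite expr0n/= mulr0 mul1r mulr_ge0 ?sqr_ge0.
have X0 z : 0 <= N * expR (- a * z) by rewrite mulr_ge0// expR_ge0.
have X0' z : 0 <= C0 * (N * expR (- a * z)) by rewrite mulr_ge0// (le_trans _ C00).
have bw z : 0 <= z -> `|y 1%N z + tau * y 2%N z| <= ((C1 + 1) * C0) * (N * expR (- a * z)).
  move=> z0; rewrite -mulrA; apply: bnd_sqr => //; apply: le_trans (Ed z z0).
  rewrite /energy0 -addrA lerDl -!exprMn addr_ge0 ?sqr_ge0//.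
  by apply: mulr_ge0; rewrite ?sqr_ge0// ltW.
have bq z : 0 <= z -> `|r * y 1%N z| <= ((C1 / (delta * tau) + 1) * C0) * (N * expR (- a * z)).
  move=> z0; rewrite -mulrA; apply: bnd_sqr => //; first by rewrite divr_ge0// ltW.
  rewrite mulrAC ler_pdivlMr// mulrC; apply: le_trans (Ed z z0).
  by rewrite /energy0 exprMn lerDr -!exprMn addr_ge0 ?sqr_ge0.
have bq' z : 0 <= z -> `|y 1%N z| <= ((C1 / (delta * tau) + 1) * C0) * (N * expR (- a * z)).
  by move=> /bq; apply: le_trans; rewrite normrM (ger0_norm (ltW r0)) ler_peMl.
(* For H = r^2 y + w' / b the terms in y' cancel and b H' = - H + w' / b. So [damped] applies with
   the forcing already controlled by the energy. *)
have hH (z : R) := der_D (der_Zl (r ^+ 2) (dy 0%N z)) (der_Zl b^-1 (h1 z)).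
have bH : `|r ^+ 2 * y 0%N 0 + b^-1 * (y 1%N 0 + tau * y 2%N 0)| <= (1 + `|b^-1| * (1 + tau)) * N.
  by apply: bndD; [rewrite mul1r normrM ger0_norm ?sqr_ge0|exact: bndM].
pose H1 := `|b^-1| * ((C1 + 1) * C0) + (1 + `|b^-1| * (1 + tau)).
have H10 : 0 <= `|b^-1| * (1 + tau) by rewrite mulr_ge0// addr_ge0// ltW.
have H11 : 0 <= `|b^-1| * ((C1 + 1) * C0) by apply: mulr_ge0 => //; apply: mulr_ge0; [exact: addr_ge0|exact: le_trans C00].
have := damped b0 _ hH (h := fun z => b^-1 * (y 1%N z + tau * y 2%N z)) (a := a) (H := H1 * N).
move=> /(_ _ _ _ _ (ltW a0)) bHt.
have {bHt} : (r ^+ 2 * y 0%N t + b^-1 * (y 1%N t + tau * y 2%N t)) ^+ 2 <= 3 * (H1 * (N * expR (- a * t))) ^+ 2.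
  rewrite (_ : 3 * _ = 3 * (H1 * N) ^+ 2 * expR (- a * t) ^+ 2); last by ring.
  apply: bHt => //.
  - by move=> z; field; rewrite gt_eqF.
  - move=> z z0; rewrite -mulrA; apply: le_trans (bndM _ (bw z z0)) _.
    by rewrite ler_wpM2r// lerDl addr_ge0.
  - have := sqr_bnd bH; move=> /le_trans; apply; rewrite -exprMn lerXn2r ?nnegrE//; [by apply: mulr_ge0 => //; exact: addr_ge0|by apply: mulr_ge0 => //; rewrite addr_ge0// addr_ge0|].
    by rewrite ler_wpM2r// lerDr.
have H12 : 0 <= H1 by rewrite addr_ge0// addr_ge0.
move=> /(bnd_sqr (ler0n _ 3) (mulr_ge0 H12 (X0 t))); rewrite (mulrA _ H1) => bHt.
split.
- rewrite -[r ^+ 2 * _](addrK (b^-1 * (y 1%N t + tau * y 2%N t))).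
  exact: bndB bHt (bndM _ (bw t t0)).
- exact: bq.
- have -> : y 2%N t = tau^-1 * (y 1%N t + tau * y 2%N t - y 1%N t) by rewrite addrC addKr mulrA tv mul1r.
  exact: bndM (bndB (bw t t0) (bq' t t0)).
Qed.

(** The first factor is the constant of [energy_decay] plus the 1 lost in [bnd_sqr]; the second
    dominates the initial energy and both forcing terms, and is at least 1. *)
Definition low_freq_const (c0 c1 c2 cg cf : R) :=
  (5 + 16 * energy_const tau delta / energy_rate tau delta) *
  (1 + c0 ^+ 2 + c1 ^+ 2 + delta * tau * c2 ^+ 2 + `|cg| + `|cf|).

(** Here [m = r ^ 2]. The energy controls only [r * q]; the bound for [q] without loss comes from
    its own damped equation, with [w1 + f] as forcing. *)
Lemma low_freq_energy (c0 c1 c2 cg cf r X : R) (w0 w1 q g f : R -> R) :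
  0 < r -> r <= 1 -> 0 <= X ->
  (forall t : R, is_derive t 1 w0 (w1 t)) ->
  (forall t : R, is_derive t 1 w1 (- r ^+ 2 * w0 t - delta * r ^+ 2 * q t + r ^+ 2 * g t)) ->
  (forall t : R, is_derive t 1 q (tau^-1 * (- q t + w1 t + f t))) ->
  `|w0 0| <= c0 * X -> `|w1 0| <= c1 * X -> `|q 0| <= c2 * X ->
  (forall t : R, 0 <= t -> `|g t| <= cg * (X * expR (- (a * r ^+ 2) * t))) ->
  (forall t : R, 0 <= t -> `|f t| <= cf * (X * expR (- (a * r ^+ 2) * t))) ->
  let C := low_freq_const c0 c1 c2 cg cf in forall t : R, 0 <= t ->
  [/\ `|r * w0 t| <= C * (X * expR (- (a * r ^+ 2) * t)),
      `|w1 t| <= C * (X * expR (- (a * r ^+ 2) * t)) &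
      `|q t| <= (4 * (C + `|cf| + `|c2|)) * (X * expR (- (a * r ^+ 2) * t))].
Proof.
move=> r0 r1 X0 h0 h1 h2 b0 b1 b2 bg bf C t t0.
have [a0 a1 a2 a3 a4] := decay_rate_spec.
pose C1 := 4 + 16 * energy_const tau delta / energy_rate tau delta.
have C10 : 0 <= C1 by rewrite addr_ge0// divr_ge0 ?(ltW (energy_rate_gt0 _ _))// mulr_ge0// ltW// energy_const_gt0.
have dt0 : 0 < delta * tau by exact: mulr_gt0.
pose K0 := 1 + c0 ^+ 2 + c1 ^+ 2 + delta * tau * c2 ^+ 2 + `|cg| + `|cf|.
have q0 : 0 <= delta * tau * c2 ^+ 2 by rewrite mulr_ge0 ?sqr_ge0// ltW.
have K1 : 1 <= K0.
  by have := sqr_ge0 c0; have := sqr_ge0 c1; have := normr_ge0 cg; have := normr_ge0 cf; rewrite /K0; lra.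
have K00 : 0 <= K0 by exact: le_trans K1.
have CE : C = (C1 + 1) * K0 by rewrite /C /low_freq_const -/K0 /C1; congr (_ * _); ring.
have r2 : 0 < r ^+ 2 by exact: exprn_gt0.
have r21 : r ^+ 2 <= 1 by rewrite expr_le1// ltW.
have E0 (z : R) : 0 <= expR (- (a * r ^+ 2) * z) by exact: expR_ge0.
have XE (z : R) : 0 <= X * expR (- (a * r ^+ 2) * z) by exact: mulr_ge0.
have i0 : energy0 tau delta (r ^+ 2) (w0 0) (w1 0) (q 0) <= (K0 * X) ^+ 2.
  have u1 := sqr_bnd b1; have u0 := sqr_bnd (bndS (ltW r0) r1 b0).
  have u2 := ler_wpM2l (ltW dt0) (sqr_bnd (bndS (ltW r0) r1 b2)).
  rewrite /energy0 -!exprMn; apply: le_trans (lerD (lerD u1 u0) u2) _.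
  rewrite [leRHS]exprMn [leLHS](_ : _ = (c1 ^+ 2 + c0 ^+ 2 + delta * tau * c2 ^+ 2) * X ^+ 2); last by ring.
  rewrite ler_wpM2r ?sqr_ge0//; apply: (@le_trans _ _ K0); last by rewrite expr2 ler_peMl.
  by have := normr_ge0 cg; have := normr_ge0 cf; rewrite /K0; lra.
have Kb c (z : R) x : `|x| <= c * (X * expR (- (a * r ^+ 2) * z)) -> `|c| <= K0 ->
    x ^+ 2 <= (K0 * X) ^+ 2 * expR (- (a * r ^+ 2) * z) ^+ 2.
  move=> h cK; rewrite -exprMn -mulrA -real_normK ?num_real// lerXn2r ?nnegrE ?(le_trans _ h)//.
    by rewrite mulr_ge0.
  by apply: le_trans h _; rewrite ler_wpM2r// (le_trans _ cK)// ler_norm.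
have cgK : `|cg| <= K0.
  by have := sqr_ge0 c0; have := sqr_ge0 c1; have := normr_ge0 cf; rewrite /K0; lra.
have cfK : `|cf| <= K0.
  by have := sqr_ge0 c0; have := sqr_ge0 c1; have := normr_ge0 cg; rewrite /K0; lra.
have Ed : forall z : R, 0 <= z -> energy0 tau delta (r ^+ 2) (w0 z) (w1 z) (q z) <=
    C1 * (K0 * (X * expR (- (a * r ^+ 2) * z))) ^+ 2.
  move=> z z0; rewrite (_ : C1 * _ = C1 * (K0 * X) ^+ 2 * expR (- (a * r ^+ 2) * z) ^+ 2); last by ring.
  apply: (@energy_decay _ tau delta tau0 delta0 (r ^+ 2) (r ^+ 2) _ (K0 * X) _ _ _ g f
     r2 r21 (lexx _) _ _ h0 h1 h2) => //.
  - by rewrite mulr_ge0// ltW.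
  - by rewrite mulrA ler_wpM2r// ltW.
  - by move=> u u0; exact: Kb (bg u u0) cgK.
  - by move=> u u0; rewrite -mulrA ler_wpM2l ?(ltW r2)//; exact: Kb (bf u u0) cfK.
have bw1 z : 0 <= z -> `|w1 z| <= C * (X * expR (- (a * r ^+ 2) * z)).
  move=> z0; rewrite CE -mulrA; apply: bnd_sqr; rewrite ?mulr_ge0//.
  apply: le_trans (Ed z z0); rewrite /energy0 -addrA lerDl -!exprMn addr_ge0 ?sqr_ge0//.
  by apply: mulr_ge0; rewrite ?sqr_ge0// ltW.
split; [|exact: bw1|].
  rewrite CE -mulrA; apply: bnd_sqr; rewrite ?mulr_ge0//.
  apply: le_trans (Ed t t0); rewrite /energy0 exprMn addrAC lerDr addr_ge0 ?sqr_ge0//.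
  by apply: mulr_ge0; [exact: ltW|rewrite mulr_ge0 ?sqr_ge0// ltW].
have C0 : 0 <= C by rewrite CE mulr_ge0// addr_ge0.
have := damped tau0 _ h2 (h := fun z => w1 z + f z) (a := a * r ^+ 2) (H := (C + `|cf| + `|c2|) * X).
have cf1 : 0 <= (C + `|cf| + `|c2|) * X by rewrite mulr_ge0// !addr_ge0.
move=> H; have {H} : q t ^+ 2 <= 3 * ((C + `|cf| + `|c2|) * X * expR (- (a * r ^+ 2) * t)) ^+ 2.
  rewrite exprMn mulrA; apply: H => //.
  - apply: le_trans a3; rewrite ler_wpM2l// ler_wpM2l ?(ltW tau0)//.
    by rewrite ler_piMr// ltW.
  - by move=> z; rewrite addrA mulrA divff ?gt_eqF// mul1r.
  - move=> z z0; apply: le_trans (bndD (bw1 z z0) (bf z z0)) _.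
    rewrite -[leRHS]mulrA ler_wpM2r// -addrA lerD2l.
    by apply: (@le_trans _ _ `|cf|); rewrite ?ler_norm// lerDl.
  - rewrite -real_normK ?num_real// lerXn2r ?nnegrE//; apply: le_trans b2 _.
    rewrite ler_wpM2r//; apply: (le_trans (ler_norm _)); rewrite lerDr.
    by rewrite addr_ge0.
  - by rewrite mulr_ge0// ltW.
move=> /(bnd_sqr (ler0n _ 3) (mulr_ge0 cf1 (E0 t))) h; apply: le_trans h _.
by rewrite le_eqVlt; apply/orP; left; apply/eqP; ring.
Qed.

(** The second-order equation with roots [- delta r^2 / 2 +- i r], solved by the profile. All [Z j]
    are full time derivatives, whereas the symbol in the theorem differentiates the sine only. *)
Definition damped_wave (r Psi : R) (Z : nat -> R -> R) :=
  [/\ forall j (t : R), is_derive t 1 (Z j) (Z j.+1 t),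
      forall j (t : R), Z j.+2 t + delta * r ^+ 2 * Z j.+1 t +
        (r ^+ 2 + delta ^+ 2 / 4 * r ^+ 4) * Z j t = 0,
      Z 1%N 0 = Psi & Z 2%N 0 = - (delta * r ^+ 2) * Psi].

Lemma low_freq_difference (G : R) : exists c0 c1 c2 : R, forall r y Z, 0 < r -> r <= 1 -> mgt_ode r y ->
  damped_wave r (y 1%N 0 + tau * y 2%N 0) Z ->
  let N : R := `|y 2%N 0| + `|y 1%N 0| + `|y 0%N 0| in
  (forall t : R, 0 <= t -> `|r * Z 0%N t| <= G * (N * expR (- (a * r ^+ 2) * t))) ->
  (forall j (t : R), (j <= 3)%N -> 0 <= t -> `|Z j.+1 t| <= G * (r ^+ j * (N * expR (- (a * r ^+ 2) * t)))) ->
  forall t : R, 0 <= t ->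
  [/\ `|y 0%N t - Z 0%N t| <= c0 * (N * (expR (- (a * r ^+ 2) * t) + expR (- tau^-1 * t))),
      `|y 1%N t - Z 1%N t| <= c1 * (N * (r * expR (- (a * r ^+ 2) * t) + expR (- tau^-1 * t))) &
      `|y 2%N t - Z 2%N t| <= c2 * (N * (r ^+ 2 * expR (- (a * r ^+ 2) * t) + expR (- tau^-1 * t)))].
Proof.
have b0 : 0 < b by exact: addr_gt0.
have [a0 a1 a2 a3 a4] := decay_rate_spec.
have tv : tau^-1 * tau = 1 by rewrite mulVf// gt_eqF.
pose C1 := 4 + 16 * energy_const tau delta / energy_rate tau delta.
have C10 : 0 <= C1 by rewrite addr_ge0// divr_ge0 ?(ltW (energy_rate_gt0 _ _))// mulr_ge0// ltW// energy_const_gt0.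
have dt0 : 0 < delta * tau by exact: mulr_gt0.
do 3 eexists; move=> r y Z r0 r1 [dy ey] [dZ eZ Z10 Z20] N bZ0 bZ t t0.
have r2 : 0 <= r ^+ 2 by exact: sqr_ge0.
have r2r : r ^+ 2 <= r by rewrite expr2 ler_piMl// ltW.
have r21 : r ^+ 2 <= 1 by exact: le_trans r1.
have N0 : 0 <= N by rewrite /N !addr_ge0.
have n2 : `|y 2%N 0| <= 1 * N by rewrite mul1r /N -addrA lerDl addr_ge0.
have n1 : `|y 1%N 0| <= 1 * N by rewrite mul1r /N -addrA addrCA lerDl addr_ge0.
have n0 : `|y 0%N 0| <= 1 * N by rewrite mul1r /N lerDr addr_ge0.
set Psi := y 1%N 0 + tau * y 2%N 0 in Z10 Z20.
have bPsi := bndD n1 (bndM tau n2); rewrite -/Psi in bPsi.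
(* The amplitude of the initial layer, chosen so that [k1 0] below reduces to [tau * Z 3 0], of size
   [r ^ 2] instead of 1. *)
pose mu := y 1%N 0 - Psi - tau * (delta * (r ^+ 2 * Psi)).
have bmu : `|mu| <= _ * N := bndB (bndB n1 bPsi) (bndM tau (bndM delta (bndS r2 r21 bPsi))).
have mu_eq : y 1%N 0 - Z 1%N 0 + tau * Z 2%N 0 - mu = 0 by rewrite Z10 Z20 /mu; ring.
pose E (z : R) := expR (- (a * r ^+ 2) * z); pose L (z : R) := expR (- tau^-1 * z).
have E0 z : 0 <= E z by exact: expR_ge0.
have L0 z : 0 <= L z by exact: expR_ge0.
have LE z : 0 <= z -> L z <= E z.
  move=> z0; rewrite ler_expR !mulNr lerN2 ler_wpM2r//.
  rewrite -(ler_pM2l tau0) mulfV ?gt_eqF//.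
  have : tau * (a * r ^+ 2) <= tau * a by rewrite ler_wpM2l ?(ltW tau0)// ler_piMr// ltW.
  by move=> /le_trans; apply; lra.
have dL (z : R) : is_derive z 1 L (- tau^-1 * L z).
  by apply: der_eq (der_exp (der_Zl (- tau^-1) (der_id z))) _; rewrite mulr1 mulrC.
have NE z : 0 <= N * E z by exact: mulr_ge0.
have bmuL z := bndRr (L0 z) bmu.
have bmuE z z0 := bndW (bmuL z) (mulr_ge0 N0 (L0 z)) (ler_wpM2l N0 (LE z z0)).
have bZ1 z : 0 <= z -> `|Z 1%N z| <= G * (N * E z).
  by move=> z0; have := bZ 0%N z isT z0; rewrite expr0 mul1r.
have bZ2 z : 0 <= z -> `|Z 2%N z| <= G * (r * (N * E z)) by move=> z0; exact: bZ 1%N z isT z0.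
have bZ3 z : 0 <= z -> `|Z 3%N z| <= G * (r ^+ 2 * (N * E z)) by move=> z0; exact: bZ.
have bZ4 z : 0 <= z -> `|Z 4%N z| <= `|G| * (r ^+ 2 * (N * E z)).
  move=> z0; apply: bndW (bZ 3%N z isT z0) _ _; first by apply: mulr_ge0; [rewrite exprn_ge0// ltW|exact: NE].
  by apply: ler_wpM2r; [exact: NE|rewrite exprSr ler_piMr].
(* The system for the differences y - Z is differentiated once in time, which gains
   a factor r, and the initial layer mu exp(-t/tau) is subtracted first. *)
pose u0 z := y 1%N z + tau * y 2%N z - Z 1%N z - delta * tau * r ^+ 2 * mu * L z.
pose u1 z := y 2%N z + tau * y 3%N z - Z 2%N z + delta * r ^+ 2 * mu * L z.
pose k1 z := y 2%N z - Z 2%N z + tau * Z 3%N z + tau^-1 * mu * L z.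
pose g z := delta ^+ 2 / 4 * (r ^+ 2 * Z 1%N z) + delta * tau * Z 3%N z - delta * tau * (r ^+ 2 * (mu * L z)).
pose f z := tau ^+ 2 * Z 4%N z - delta * (r ^+ 2 * (mu * L z)).
have h0 (z : R) : is_derive z 1 u0 (u1 z).
  apply: der_eq (der_B (der_B (der_D (dy 1%N z) (der_Zl tau (dy 2%N z))) (dZ 1%N z))
    (der_Zl (delta * tau * r ^+ 2 * mu) (dL z))) _.
  by rewrite /u1; field; rewrite gt_eqF.
have h1 (z : R) : is_derive z 1 u1 (- r ^+ 2 * u0 z - delta * r ^+ 2 * k1 z + r ^+ 2 * g z).
  apply: der_eq (der_D (der_B (der_D (dy 2%N z) (der_Zl tau (dy 3%N z))) (dZ 2%N z))
    (der_Zl (delta * r ^+ 2 * mu) (dL z))) _.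
  have := eZ 1%N z; rewrite ey /u0 /k1 /g => e.
  have -> : Z 3%N z = - (delta * r ^+ 2 * Z 2%N z + (r ^+ 2 + delta ^+ 2 / 4 * r ^+ 4) * Z 1%N z).
    by apply/eqP; rewrite -addr_eq0 addrA; apply/eqP.
  by field; rewrite gt_eqF.
have h2 (z : R) : is_derive z 1 k1 (tau^-1 * (- k1 z + u1 z + f z)).
  apply: der_eq (der_D (der_D (der_B (dy 2%N z) (dZ 2%N z)) (der_Zl tau (dZ 3%N z)))
    (der_Zl (tau^-1 * mu) (dL z))) _.
  by rewrite /k1 /u1 /f; field; rewrite gt_eqF.
have L00 : L 0 = 1 by rewrite /L mulr0 expR0.
have E00 : E 0 = 1 by rewrite /E mulr0 expR0.
have i0 := bndM (- (delta * tau)) (bndR r2 bmu).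
rewrite (_ : - (delta * tau) * (r ^+ 2 * mu) = u0 0) in i0; last by rewrite /u0 Z10 L00 /Psi; ring.
have i1 := bndR r2 (bndD (bndD (bndN (bndD (bndM b n1) n0)) (bndM delta bPsi)) (bndM delta bmu)).
rewrite (_ : r ^+ 2 * _ = u1 0) in i1; last by rewrite /u1 ey Z20 L00; ring.
have i2 := bndM tau (bZ3 0 (lexx _)).
rewrite E00 mulr1 (_ : tau * Z 3%N 0 = k1 0) in i2; last first.
  rewrite /k1 L00 mulr1 (_ : mu = y 1%N 0 - Z 1%N 0 + tau * Z 2%N 0); last by apply/esym/eqP; rewrite -subr_eq0 mu_eq.
  by rewrite Z10 /Psi; field; rewrite gt_eqF.
have ig z z0 := bndA (bndB (bndD (bndM (delta ^+ 2 / 4) (bndR r2 (bZ1 z z0))) (bndM (delta * tau) (bZ3 z z0)))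
  (bndM (delta * tau) (bndR r2 (bmuE z z0)))).
have if' z z0 := bndA (bndB (bndM (tau ^+ 2) (bZ4 z z0)) (bndM delta (bndR r2 (bmuE z z0)))).
have [/bndAV ru0 /bndAV bu1 /bndAV bk1] :=
  low_freq_energy r0 r1 (mulr_ge0 r2 N0) h0 h1 h2 i0 i1 i2 ig if' t0.
rewrite -/(E t) in ru0 bu1 bk1; rewrite [r ^+ 2]expr2 -(mulrA r) in ru0; have bu0 := bndV r0 ru0.
have T20 : 0 <= N * L t by exact: mulr_ge0.
have Et0 := E0 t; have Lt0 := L0 t; have r0' := ltW r0.
have w2 (c x : R) := @bndWl R c x _ _ _ _ r2 N0 Et0 Lt0.
have w2L (c x : R) := @bndWr R c x _ _ _ _ r2 N0 Et0 Lt0.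
have w1 (c x : R) := @bndWl R c x _ _ _ _ r0' N0 Et0 Lt0.
have w1L (c x : R) := @bndWr R c x _ _ _ _ r0' N0 Et0 Lt0.
have w0 (c x : R) : `|x| <= c * (N * E t) -> `|x| <= `|c| * (N * (E t + L t)).
  by move=> h; rewrite -[E t]mul1r; apply: bndWl => //; rewrite mul1r.
have w21 (c x : R) : `|x| <= c * (N * (r ^+ 2 * E t + L t)) -> `|x| <= `|c| * (N * (r * E t + L t)).
  move=> h; apply: bndW h _ _; first by rewrite mulr_ge0// addr_ge0// mulr_ge0.
  by rewrite ler_wpM2l// lerD2r ler_wpM2r.
have w10 (c x : R) : `|x| <= c * (N * (r * E t + L t)) -> `|x| <= `|c| * (N * (E t + L t)).
  move=> h; apply: bndW h _ _; first by rewrite mulr_ge0// addr_ge0// mulr_ge0// ltW.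
  by rewrite ler_wpM2l// lerD2r ler_piMl.
have b2 := bndB (bndB (w2 _ _ bk1) (w2 _ _ (bndM tau (bZ3 t t0)))) (w2L _ _ (bndM tau^-1 (bmuL t))).
rewrite (_ : k1 t - tau * Z 3%N t - tau^-1 * (mu * L t) = y 2%N t - Z 2%N t) in b2; last by rewrite /k1; ring.
have b1 := bndD (bndB (bndB (w1 _ _ bu0) (w21 _ _ (bndM tau b2))) (w1 _ _ (bndM tau (bZ2 t t0))))
  (w1L _ _ (bndM (delta * tau) (bndS r2 r21 (bmuL t)))).
rewrite (_ : _ + delta * tau * _ = y 1%N t - Z 1%N t) in b1; last by rewrite /u0; ring.
split; [|exact: b1|exact: b2].
(* The difference itself is not an unknown of the differentiated system. Multiplied by [r ^ 2] it is
   read off from the two equations, and [u1] carries the factor [r ^ 2] needed to divide again. *)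
apply: (bndV (s := r ^+ 2)); first exact: exprn_gt0.
rewrite (_ : _ * (_ - _) = - u1 t + r ^+ 2 * (- b * (y 1%N t - Z 1%N t) - b * Z 1%N t + delta * Z 1%N t
    + delta ^+ 2 / 4 * (r * (r * Z 0%N t)) + delta * (mu * L t))); last first.
  rewrite /u1 ey; have := eZ 0%N t => e.
  have -> : Z 2%N t = - (delta * r ^+ 2 * Z 1%N t + (r ^+ 2 + delta ^+ 2 / 4 * r ^+ 4) * Z 0%N t).
    by apply/eqP; rewrite -addr_eq0 addrA; apply/eqP.
  by ring.
apply: bndD.
  apply: bndN; apply: bndW bu1 _ _; first by rewrite mulr_ge0.
  by rewrite ler_wpM2l// ler_wpM2l// lerDl.
apply: bndR => //.
exact: bndD (bndD (bndD (bndB (w10 _ _ (bndM _ b1)) (w0 _ _ (bndM _ (bZ1 t t0)))) (w0 _ _ (bndM _ (bZ1 t t0))))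
  (w0 _ _ (bndM _ (bndS (ltW r0) r1 (bZ0 t t0))))) (w0 _ _ (bndM _ (bmuE t t0))).
Qed.

End mgt_ode.

(** * Explicit solutions at a fixed frequency *)

Section damped_wave_construction.
Context {R : realType} (tau delta : R).
Hypotheses (tau0 : 0 < tau) (delta0 : 0 < delta).
Implicit Types (r t Psi : R).
Local Notation a := (decay_rate tau delta).

(** Effect of one time derivative on the coefficients of cosine and sine in front of the Gaussian
    [exp(- delta r^2 t / 2)]. *)
Definition wave_step r (c : R * R) : R * R :=
  (- (delta / 2 * r ^+ 2) * c.1 + r * c.2, - (delta / 2 * r ^+ 2) * c.2 - r * c.1).

Definition wave_coef r j : R * R := iter j (wave_step r) (0, r^-1).

Definition dwave r Psi j t : R :=
  ((wave_coef r j).1 * cos (r * t) + (wave_coef r j).2 * sin (r * t)) *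
  expR (- (delta / 2 * r ^+ 2) * t) * Psi.

Lemma dwave_derive r Psi j t : is_derive t 1 (dwave r Psi j) (dwave r Psi j.+1 t).
Proof.
have d := der_M (der_M (der_D (der_Zl (wave_coef r j).1 (der_cos (der_Zl r (der_id t))))
  (der_Zl (wave_coef r j).2 (der_sin (der_Zl r (der_id t)))))
  (der_exp (der_Zl (- (delta / 2 * r ^+ 2)) (der_id t)))) (der_cst Psi t).
by apply: der_eq d _; rewrite /dwave [wave_coef r j.+1]/wave_coef iterS -/(wave_coef r j) /wave_step /=; ring.
Qed.

Lemma dwave_damped r Psi : r != 0 -> damped_wave delta r Psi (dwave r Psi).
Proof.
move=> r0; split.
- by move=> j t; exact: dwave_derive.
- move=> j t; rewrite /dwave /wave_coef !iterS -/(wave_coef r j) /wave_step /=.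
  by field.
- by rewrite /dwave /= !mulr0 cos0 sin0 expR0; field.
- by rewrite /dwave /= !mulr0 cos0 sin0 expR0; field.
Qed.

(** The factor [r] on the left offsets the initial coefficient [r^-1]; each derivative then costs
    [(1 + delta / 2) * r], because [r ^ 2 <= r]. *)
Lemma wave_coef_le r j : 0 < r -> r <= 1 ->
  r * (`|(wave_coef r j).1| + `|(wave_coef r j).2|) <= ((1 + delta / 2) * r) ^+ j.
Proof.
move=> r0 r1; elim: j => [|j IH].
  by rewrite /= normr0 add0r ger0_norm ?invr_ge0 ?(ltW r0)// divff ?gt_eqF.
rewrite /wave_coef iterS -/(wave_coef r j) exprS; set p := (wave_coef r j).1 in IH *; set q := (wave_coef r j).2 in IH *.
rewrite /wave_step -/p -/q /=.
have th0 : 0 <= delta / 2 * r ^+ 2 by rewrite mulr_ge0 ?sqr_ge0// ltW// divr_gt0.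
have h1 : `|- (delta / 2 * r ^+ 2) * p + r * q| <= delta / 2 * r ^+ 2 * `|p| + r * `|q|.
  by rewrite (le_trans (ler_normD _ _))// !normrM normrN (ger0_norm th0) (gtr0_norm r0).
have h2 : `|- (delta / 2 * r ^+ 2) * q - r * p| <= delta / 2 * r ^+ 2 * `|q| + r * `|p|.
  by rewrite (le_trans (ler_normB _ _))// !normrM normrN (ger0_norm th0) (gtr0_norm r0).
apply: (@le_trans _ _ ((1 + delta / 2) * r * (r * (`|p| + `|q|)))); last first.
  by apply: ler_wpM2l => //; rewrite mulr_ge0 ?(ltW r0)// addr_ge0// ltW// divr_gt0.
rewrite [leRHS](_ : _ = r * ((1 + delta / 2) * (r * (`|p| + `|q|)))); last by ring.
rewrite ler_pM2l//; apply: le_trans (lerD h1 h2) _.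
have : delta / 2 * r ^+ 2 <= delta / 2 * r.
  by rewrite ler_pM2l ?divr_gt0// expr2 ler_piMl// ltW.
move=> /(ler_wpM2r (addr_ge0 (normr_ge0 p) (normr_ge0 q))); lra.
Qed.

Lemma dwave_le r Psi j t : 0 < r -> r <= 1 -> 0 <= t ->
  `|r * dwave r Psi j t| <= ((1 + delta / 2) * r) ^+ j * (`|Psi| * expR (- (a * r ^+ 2) * t)).
Proof.
move=> r0 r1 t0; have [a0 _ _ _ ad] := decay_rate_spec tau0 delta0.
rewrite /dwave -mulrA mulrA normrM [`|expR _ * Psi|]normrM [`|expR _|]ger0_norm ?expR_ge0//.
have C0 : 0 <= ((1 + delta / 2) * r) ^+ j.
  by rewrite exprn_ge0// mulr_ge0 ?(ltW r0)// addr_ge0// ltW// divr_gt0.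
apply: ler_pM; [exact: normr_ge0|by apply: mulr_ge0; rewrite ?expR_ge0| |].
  apply: le_trans (wave_coef_le j r0 r1); rewrite normrM gtr0_norm// ler_pM2l//.
  rewrite (le_trans (ler_normD _ _))// !normrM lerD// ler_piMr//.
    by rewrite ler_norml cos_geN1 cos_le1.
  by rewrite ler_norml sin_geN1 sin_le1.
by rewrite mulrC ler_wpM2l// ler_expR !mulNr lerN2 ler_wpM2r// ler_wpM2r// sqr_ge0.
Qed.

Definition wave_time_derivative r (l : nat) t : R :=
  match l with 0 => sin (r * t) | 1 => r * cos (r * t) | _ => - r ^+ 2 * sin (r * t) end.

Lemma derive1n_sin r l t : (l <= 2)%N ->
  derive1n l (fun x : R => sin (r * x)) t = wave_time_derivative r l t.
Proof.
have d1 (x : R) : derive1 (fun x : R => sin (r * x)) x = r * cos (r * x).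
  by rewrite (derE (der_sin (der_Zl r (der_id x)))) mulr1 mulrC.
case: l => [|[|[|//]]] _ //; first by rewrite derive1n1 d1.
rewrite derive1nS derive1n1 /=.
have -> : derive1 (fun x : R => sin (r * x)) = (fun x => r * cos (r * x)) by apply/funext.
by rewrite (derE (der_Zl r (der_cos (der_Zl r (der_id t))))) mulr1; ring.
Qed.

Definition wsymbol r l t : R :=
  r^-1 * expR (- (delta / 2) * r ^+ 2 * t) * wave_time_derivative r l t.

(** The discrepancy consists of the terms in which a derivative falls on the Gaussian. Each such
    derivative brings [r ^ 2] instead of [r], which offsets the initial [r^-1] and leaves order
    [r ^ l]. *)
Lemma dwave_symbol r Psi t : 0 < r -> r <= 1 -> 0 <= t -> let E := expR (- (a * r ^+ 2) * t) in
  [/\ dwave r Psi 0 t = wsymbol r 0 t * Psi,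
     `|dwave r Psi 1 t - wsymbol r 1 t * Psi| <= delta / 2 * (r * (`|Psi| * E)) &
     `|dwave r Psi 2 t - wsymbol r 2 t * Psi| <= (delta + delta ^+ 2 / 4) * (r ^+ 2 * (`|Psi| * E))].
Proof.
move=> r0 r1 t0 E; have rn0 : r != 0 by rewrite gt_eqF.
have [a0 _ _ _ ad] := decay_rate_spec tau0 delta0.
have eE : expR (- (delta / 2 * r ^+ 2) * t) <= E.
  by rewrite ler_expR !mulNr lerN2 ler_wpM2r// ler_wpM2r// sqr_ge0.
have e0 : 0 <= expR (- (delta / 2 * r ^+ 2) * t) by exact: expR_ge0.
have ee : expR (- (delta / 2) * r ^+ 2 * t) = expR (- (delta / 2 * r ^+ 2) * t) by rewrite mulNr.
have s1 : `|sin (r * t)| <= 1 by rewrite ler_norml sin_geN1 sin_le1.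
have c1 : `|cos (r * t)| <= 1 by rewrite ler_norml cos_geN1 cos_le1.
rewrite /wsymbol ee /dwave /=; move: eE e0; set e := expR (- _ * t) => eE e0; split.
- by field.
- rewrite (_ : _ - _ = - (delta / 2) * (r * (Psi * e)) * sin (r * t)); last by field.
  have d2 : 0 < delta / 2 by rewrite divr_gt0.
  rewrite normrM -[leRHS]mulr1 ler_pM// normrM normrN (gtr0_norm d2) ler_pM2l//.
  by rewrite normrM (gtr0_norm r0) ler_pM2l// normrM ler_wpM2l// ger0_norm.
- rewrite (_ : _ - _ = (- delta * cos (r * t) + delta ^+ 2 / 4 * (r * sin (r * t))) * (r ^+ 2 * (Psi * e))); last by field.
  rewrite normrM ler_pM//.
    rewrite (le_trans (ler_normD _ _))// lerD// normrM ?normrN.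
      by rewrite (gtr0_norm delta0) ler_piMr// ltW.
    have d4 : 0 < delta ^+ 2 / 4 by rewrite divr_gt0// exprn_gt0.
    rewrite gtr0_norm// ler_piMr ?(ltW d4)// normrM gtr0_norm// mulr_ile1// ltW//.
  rewrite normrM ger0_norm ?sqr_ge0// ler_wpM2l ?sqr_ge0// normrM ler_wpM2l//.
  by rewrite ger0_norm.
Qed.

End damped_wave_construction.

(** * Fundamental solutions and their bounds *)

Section mgt_solution_formula.
Context {R : realType} (tau delta : R).
Hypotheses (tau0 : 0 < tau) (delta0 : 0 < delta).
Implicit Types (r rho t : R).
Local Notation a := (decay_rate tau delta).
Local Notation b := (delta + tau).
Local Notation mgtk := (mgtk tau b).

(* The j-th derivatives of the solutions with data (1,0,0), (0,1,0), (0,0,1). *)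
Definition mgt_fund (i j : nat) rho t : R :=
  match i with
  | 0 => mgtk j.+2 rho t + tau^-1 * mgtk j.+1 rho t + b * rho / tau * mgtk j rho t
  | 1 => mgtk j.+1 rho t + tau^-1 * mgtk j rho t
  | _ => mgtk j rho t
  end.

Let b0 : 0 <= b. Proof. by rewrite addr_ge0// ltW. Qed.

Lemma mgt_fund_derive i j rho t : 0 <= rho ->
  is_derive t 1 (mgt_fund i j rho) (mgt_fund i j.+1 rho t).
Proof.
move=> h; have d k := @mgtk_derive _ tau b tau0 b0 rho k t h.
case: i => [|[|i]] /=; [|exact: der_D (d j.+1) (der_Zl tau^-1 (d j))|exact: d].
exact: der_D (der_D (d j.+2) (der_Zl tau^-1 (d j.+1))) (der_Zl (b * rho / tau) (d j)).
Qed.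

Lemma mgt_fund_rec i j rho t : 0 <= rho -> tau * mgt_fund i j.+3 rho t =
  - (mgt_fund i j.+2 rho t + b * rho * mgt_fund i j.+1 rho t + rho * mgt_fund i j rho t).
Proof.
move=> h; have e k := @mgtk_rec _ tau b tau0 b0 rho k t h.
case: i => [|[|i]] /=; rewrite ?(e j.+2) ?(e j.+1) ?(e j); field; by rewrite gt_eqF.
Qed.

Lemma mgt_fund0 i j rho : 0 <= rho -> (i <= 2)%N -> (j <= 2)%N -> mgt_fund i j rho 0 = (i == j)%:R.
Proof.
move=> h; have [k0 k1 k2 k3 k4] := @mgtk0 _ tau b tau0 rho h.
case: i => [|[|[|//]]] _; case: j => [|[|[|//]]] _; rewrite /= ?k0 ?k1 ?k2 ?k3 ?k4; field; by rewrite ?gt_eqF.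
Qed.

Definition mgt_sol (rho a0 a1 a2 : R) (j : nat) t : R :=
  a0 * mgt_fund 0 j rho t + a1 * mgt_fund 1 j rho t + a2 * mgt_fund 2 j rho t.

Lemma mgt_sol_ode r a0 a1 a2 : mgt_ode tau delta r (mgt_sol (r ^+ 2) a0 a1 a2).
Proof.
have h : 0 <= r ^+ 2 by exact: sqr_ge0.
split=> j t.
  exact: der_D (der_D (der_Zl a0 (mgt_fund_derive 0 j t h)) (der_Zl a1 (mgt_fund_derive 1 j t h)))
   (der_Zl a2 (mgt_fund_derive 2 j t h)).
rewrite /mgt_sol mulrDr mulrDr !(mulrCA tau) !mgt_fund_rec//; ring.
Qed.

Lemma mgt_sol0 rho a0 a1 a2 : 0 <= rho -> [/\ mgt_sol rho a0 a1 a2 0 0 = a0,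
  mgt_sol rho a0 a1 a2 1 0 = a1 & mgt_sol rho a0 a1 a2 2 0 = a2].
Proof. by move=> h; rewrite /mgt_sol !mgt_fund0//= ; split; ring. Qed.

Lemma mgt_low : exists2 C : R, 0 < C & forall r a0 a1 a2 l t, 0 < r -> r <= 1 -> (l <= 2)%N -> 0 <= t ->
  `|mgt_sol (r ^+ 2) a0 a1 a2 l t - wsymbol delta r l t * (a1 + tau * a2)| <=
  C * ((`|a0| + `|a1| + `|a2|) * (r ^+ l * expR (- (a * r ^+ 2) * t) + expR (- tau^-1 * t))).
Proof.
(* At most four derivatives of the wave occur, each costing a factor [c]; [1 + tau] bounds [Psi] by
   the size of the data. *)
pose c := 1 + delta / 2; pose G := c ^+ 4 * (1 + tau).
have c1 : 1 <= c by rewrite lerDl ltW// divr_gt0.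
have [k0 [k1 [k2 H]]] := low_freq_difference tau0 delta0 G.
pose D := (delta + delta ^+ 2 / 4) * (1 + tau).
have d20 : 0 <= delta ^+ 2 / 4 by rewrite divr_ge0// sqr_ge0.
have D0 : 0 <= D by rewrite mulr_ge0// addr_ge0// ltW.
exists (`|k0| + `|k1| + `|k2| + D + 1); first by rewrite ltr_wpDl// !addr_ge0.
move=> r a0 a1 a2 l t r0 r1 l2 t0.
have h : 0 <= r ^+ 2 by exact: sqr_ge0.
have [y0 y1 y2] := mgt_sol0 a0 a1 a2 h.
have rn0 : r != 0 by rewrite gt_eqF.
have := H _ _ (dwave delta r (a1 + tau * a2)) r0 r1 (mgt_sol_ode r a0 a1 a2).
rewrite /= y0 y1 y2; set N := `|a2| + _ + _; set Psi := a1 + tau * a2.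
have N0 : 0 <= N by rewrite !addr_ge0.
have -> : `|a0| + `|a1| + `|a2| = N by rewrite /N; ring.
have PsiN : `|Psi| <= (1 + tau) * N.
  rewrite (le_trans (ler_normD _ _))// normrM gtr0_norm// mulrDl mul1r lerD//.
    by rewrite /N [`|a2| + _]addrC -addrA lerDl addr_ge0.
  by rewrite ler_pM2l// /N -addrA lerDl addr_ge0.
move=> /(_ (dwave_damped delta Psi rn0)) H'.
have E0 (z : R) : 0 <= expR (- (a * r ^+ 2) * z) by exact: expR_ge0.
have {H'} := H' _ _ t t0; set E := expR (- (a * r ^+ 2) * t); set L := expR (- tau^-1 * t) => H'.
have {H'} [] := H'.
- move=> z z0; apply: le_trans (dwave_le tau0 delta0 Psi 0 r0 r1 z0) _.
  rewrite expr0 mul1r mulrA ler_wpM2r// (le_trans PsiN)// ler_wpM2r// ler_peMl//.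
    by rewrite addr_ge0// ltW.
  by rewrite exprn_ege1.
- move=> j z j3 z0; have := dwave_le tau0 delta0 Psi j.+1 r0 r1 z0.
  rewrite exprMn [r ^+ j.+1]exprS [_ * (r * _)]mulrCA -mulrA -/c normrM gtr0_norm// ler_pM2l// => /le_trans; apply.
  rewrite -!mulrA [leRHS](_ : _ = c ^+ 4 * (r ^+ j * ((1 + tau) * N * expR (- (a * r ^+ 2) * z)))); last by rewrite /G; ring.
  have rj : 0 <= r ^+ j by rewrite exprn_ge0// ltW.
  apply: ler_pM; rewrite ?exprn_ge0 ?(le_trans _ c1)//.
  + by rewrite mulr_ge0// mulr_ge0.
  + by rewrite ler_weXn2l.
  + by rewrite ler_wpM2l// ler_wpM2r.
move=> b0' b1' b2'.
have [s0 s1 s2] := dwave_symbol tau0 delta0 Psi r0 r1 t0.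
have E00 : 0 <= E by exact: E0.
have L0 : 0 <= L by exact: expR_ge0.
have fin (k x y : R) : `|x| <= k * (N * (r ^+ l * E + L)) -> `|k| <= `|k0| + `|k1| + `|k2| ->
   `|y| <= D * (r ^+ l * (N * E)) -> `|x + y| <= (`|k0| + `|k1| + `|k2| + D + 1) * (N * (r ^+ l * E + L)).
  move=> hx hk hy; have rl : 0 <= r ^+ l by rewrite exprn_ge0// ltW.
  have X0 : 0 <= N * (r ^+ l * E + L) by rewrite mulr_ge0// addr_ge0// mulr_ge0.
  have hx' := le_trans hx (ler_wpM2r X0 (ler_norm k)).
  have hy' := le_trans hy (_ : _ <= D * (N * (r ^+ l * E + L))).
  apply: le_trans (ler_normD _ _) _.
  have := ler_wpM2r X0 hk.
  have : D * (r ^+ l * (N * E)) <= D * (N * (r ^+ l * E + L)).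
    by rewrite ler_wpM2l// mulrDr mulrCA lerDl mulr_ge0.
  by move=> /hy' hy''; move: hx' hy'' X0; clear -tau0 delta0; lra.
have dif x : x <= (delta + delta ^+ 2 / 4) * (r ^+ l * (`|Psi| * E)) -> x <= D * (r ^+ l * (N * E)).
  move=> /le_trans; apply; rewrite /D -[leRHS]mulrA ler_wpM2l ?addr_ge0// ?(ltW delta0)//.
  rewrite [leRHS]mulrCA; apply: ler_wpM2l; first by rewrite exprn_ge0// ltW.
  by rewrite mulrA; apply: ler_wpM2r.
case: l l2 fin dif => [|[|[|//]]] _ fin dif.
- rewrite -(subrKA (dwave delta r Psi 0 t)); apply: fin (_ : _ <= k0 * _) _ _.
  + by rewrite expr0 mul1r.
  + by rewrite -addrA lerDl addr_ge0.
  + by rewrite s0 subrr normr0 expr0 mul1r mulr_ge0// mulr_ge0.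
- rewrite -(subrKA (dwave delta r Psi 1 t)); apply: fin (_ : _ <= k1 * _) _ _ => //.
  + by rewrite addrAC lerDr addr_ge0.
  + apply: dif; apply: le_trans s1 _; rewrite expr1 ler_wpM2r//.
      by rewrite !mulr_ge0// ltW.
    by move: delta0 d20; clear -tau0 delta0; lra.
- rewrite -(subrKA (dwave delta r Psi 2 t)); apply: fin (_ : _ <= k2 * _) _ _ => //.
  + by rewrite lerDr addr_ge0.
  + exact: dif.
Qed.

Lemma mgt_high : exists2 C : R, 0 < C & forall r a0 a1 a2 l t, 1 <= r -> (l <= 2)%N -> 0 <= t ->
  r ^+ (2 - l) * `|mgt_sol (r ^+ 2) a0 a1 a2 l t| <=
  C * ((`|a2| + r * `|a1| + r ^+ 2 * `|a0|) * expR (- a * t)).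
Proof.
have [k0 [k1 [k2 H]]] := high_freq_bound tau0 delta0.
exists (`|k0| + `|k1| + `|k2| + 1); first by rewrite ltr_wpDl// !addr_ge0.
move=> r a0 a1 a2 l t r1 l2 t0; have r0 : 0 < r by exact: lt_le_trans r1.
have h : 0 <= r ^+ 2 by exact: sqr_ge0.
have [y0 y1 y2] := mgt_sol0 a0 a1 a2 h.
have := H _ _ r1 (mgt_sol_ode r a0 a1 a2); rewrite /= y0 y1 y2 => /(_ t t0).
set X := _ * expR _ => -[h0 h1 h2].
have X0 : 0 <= X by rewrite mulr_ge0 ?expR_ge0// !addr_ge0// mulr_ge0// ltW.
have fin (k x : R) : `|x| <= k * X -> `|k| <= `|k0| + `|k1| + `|k2| -> `|x| <= (`|k0| + `|k1| + `|k2| + 1) * X.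
  move=> hx hk; apply: le_trans hx _; apply: ler_wpM2r => //.
  by rewrite (le_trans (ler_norm _))// (le_trans hk)// lerDl.
rewrite -[r ^+ _]ger0_norm ?exprn_ge0 ?(ltW r0)// -normrM.
case: l l2 => [|[|[|//]]] _; rewrite ?subn0 ?subnn ?expr0 ?expr1 ?mul1r.
- by apply: fin h0 _; rewrite -addrA lerDl addr_ge0.
- by apply: fin h1 _; rewrite addrAC lerDr addr_ge0.
- by apply: fin h2 _; rewrite lerDr addr_ge0.
Qed.

End mgt_solution_formula.

(** * Fourier transforms of distributions *)

Section fourier_of_distributions.
Context {R : realType} {n : nat}.
Implicit Types (f g h phi : Rn R n -> R[i]) (u v : distr R n) (w : Rn R n -> R).
Local Notation mu := (@lebesgue_Rn R n).

Lemma fourier_is_unique u g h : fourier_is u g -> fourier_is u h -> {ae mu, forall x, g x = h x}.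
Proof.
move=> [mg Ig eg] [mh Ih eh].
have : {ae mu, forall x, (fun x => g x - h x) x = 0}.
  apply: schwartz_total; first exact: cmeasurableB.
    move=> phi Sphi; under [X in cintegrable X]eq_fun do rewrite mulrBl.
    by apply: cintegrableB; [exact: Ig|exact: Ih].
  move=> phi Sphi; under [X in cintegral X]eq_fun do rewrite mulrBl.
  rewrite cintegralB; [|exact: Ig|exact: Ih].
  by rewrite -[cintegral (fun x => g x * phi x)]/(distr_of g phi) -[cintegral _]/(distr_of h phi) -eg// -eh// subrr.
by apply: filterS => x /eqP; rewrite subr_eq0 => /eqP.
Qed.

Lemma fourier_is_eq u v g : distr_eq u v -> fourier_is u g -> fourier_is v g.
Proof.
move=> uv [mg Ig eg]; split=> // phi Sphi.
by rewrite -eg// /distr_fourier uv//; exact: schwartz_fourier.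
Qed.

Lemma fourier_isD u v g h : fourier_is u g -> fourier_is v h ->
  fourier_is (u \+ v) (fun x => g x + h x).
Proof.
move=> [mg Ig eg] [mh Ih eh]; split; first exact: cmeasurableD.
  move=> phi Sphi; under [X in cintegrable X]eq_fun do rewrite mulrDl.
  by apply: cintegrableD; [exact: Ig|exact: Ih].
move=> phi Sphi; rewrite /distr_of; under [X in cintegral X]eq_fun do rewrite mulrDl.
rewrite cintegralD; [|exact: Ig|exact: Ih].
by rewrite /distr_fourier /= -[u _]/(distr_fourier u phi) -[v _]/(distr_fourier v phi) eg// eh.
Qed.

Lemma fourier_isZ (c : R[i]) u g : fourier_is u g -> fourier_is (c \*o u) (fun x => c * g x).
Proof.
move=> [mg Ig eg]; split.
- by apply: cmeasurableM => //; exact: cmeasurable_cst.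
- move=> phi Sphi; under [X in cintegrable X]eq_fun do rewrite -mulrA.
  by apply: cintegrableZl; exact: Ig.
- move=> phi Sphi; rewrite /distr_of; under [X in cintegral X]eq_fun do rewrite -mulrA.
  rewrite cintegralZl; last exact: Ig.
  by rewrite /distr_fourier /= -[u _]/(distr_fourier u phi) eg.
Qed.

Lemma fourier_isB u v g h : fourier_is u g -> fourier_is v h ->
  fourier_is (u \- v) (fun x => g x - h x).
Proof.
move=> ug vh; have := fourier_isD ug (fourier_isZ (-1) vh).
rewrite (_ : (fun x => _ + _) = (fun x => g x - h x)); last by apply/funext => x; rewrite mulN1r.
by apply: fourier_is_eq => phi _ /=; rewrite mulN1r.
Qed.

Lemma fourier_is_laplacian u g : fourier_is u g ->
  fourier_is (distr_laplacian u) (fun x => - (enorm x ^+ 2)%:C * g x).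
Proof.
move=> [mg Ig eg].
have e x phi : - (enorm x ^+ 2)%:C * g x * phi x = g x * (- (enorm x ^+ 2)%:C * phi x).
  by rewrite mulrCA mulrA.
split.
- apply: cmeasurableM => //; under eq_fun do rewrite -real_complexN.
  apply: cmeasurableR; apply: measurableT_comp => //.
  by apply: measurable_funX; exact: measurable_enorm.
- move=> phi Sphi; under [X in cintegrable X]eq_fun do rewrite e.
  by apply: Ig; exact: schwartz_enormM.
- move=> phi Sphi; rewrite /distr_of; under [X in cintegral X]eq_fun do rewrite e.
  rewrite /distr_fourier /distr_laplacian laplacian_fourier//.
  by rewrite -[LHS]/(distr_fourier u _) eg//; exact: schwartz_enormM.
Qed.

(** The integrand is not integrable over pairs of points. A Gaussian factor in the frequency makes
    it so; Fubini then gives measurability and the factor is divided out. *)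
Lemma cmeasurable_fourier f : cintegrable f -> cmeasurable (fourier f).
Proof.
move=> If; have [mr mi] := cintegrable_measurable If.
have nf := cintegrable_normc If.
pose G (xi : Rn R n) := gaussn 1 origin xi.
have G0 xi : 0 < G xi by exact: gaussn_gt0.
have IG : mu.-integrable setT (EFin \o G) by apply: integrable_gaussn; rewrite oner_eq0.
have mG : measurable_fun setT G by exact: measurable_gaussn.
have md : measurable_fun setT (fun p : Rn R n * Rn R n => - dotp p.2 p.1 : R).
  by apply: measurableT_comp => //; exact: measurable_dotp.
have mc : measurable_fun setT (fun p : Rn R n * Rn R n => cos (- dotp p.2 p.1) : R).
  apply: (measurableT_comp (f := @cos R)) => //.
  by apply: continuous_measurable_fun; exact: continuous_cos.
have ms : measurable_fun setT (fun p : Rn R n * Rn R n => sin (- dotp p.2 p.1) : R).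
  apply: (measurableT_comp (f := @sin R)) => //.
  by apply: continuous_measurable_fun; exact: continuous_sin.
have mr2 : measurable_fun setT (fun p : Rn R n * Rn R n => cRe (f p.2)) by exact: (measurableT_comp mr).
have mi2 : measurable_fun setT (fun p : Rn R n * Rn R n => cIm (f p.2)) by exact: (measurableT_comp mi).
have mG1 : measurable_fun setT (fun p : Rn R n * Rn R n => G p.1) by exact: (measurableT_comp mG).
have K (k : Rn R n -> Rn R n -> R) : measurable_fun setT (fun p : Rn R n * Rn R n => k p.1 p.2) ->
    (forall xi x, `|k xi x| <= normc (f x)) ->
    measurable_fun setT (fun xi => \int[mu]_x k xi x).
  move=> mk kf.
  have ik xi : mu.-integrable setT (fun x => (k xi x)%:E).
    apply: (rintegrable_le (k := fun x => normc (f x))) => //.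
    exact: (measurableT_comp mk (measurable_pair1 xi)).
  have Ip : (mu \x mu)%E.-integrable setT (EFin \o (fun p : Rn R n * Rn R n => G p.1 * k p.1 p.2)).
    apply: (integrable_prod_dom (a := G) (b := fun x => normc (f x))) => //.
    - exact: measurable_funM.
    - by move=> p; rewrite normrM (gtr0_norm (G0 _)) ler_wpM2l// ltW.
    - by move=> xi; exact: ltW.
    - by move=> x; exact: normc_ge0.
  have := measurable_fubini_F Ip; rewrite /fubini_F => mF.
  apply/measurable_EFinP.
  rewrite (_ : EFin \o _ = (fun xi => ((G xi)^-1)%:E * \int[mu]_x (G xi * k xi x)%:E)%E); last first.
    apply/funext => xi /=.
    have iGk : mu.-integrable setT (EFin \o (fun x => G xi * k xi x)) by apply: rintegrableZl; exact: ik.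
    rewrite -(fineK (integrable_fin_num measurableT iGk)).
    rewrite -[fine _]/(\int[mu]_x (G xi * k xi x)) RintegralZl//; last exact: ik.
    by rewrite -EFinM mulKf// gt_eqF.
  apply: emeasurable_funM; last exact: mF.
  apply/measurable_EFinP.
  rewrite (_ : (fun x => (G x)^-1) = (fun x => powR (G x) (-1))); last first.
    by apply/funext => x; rewrite powR_inv1// ltW.
  exact: (measurableT_comp (measurable_powR (-1)) mG).
have B xi x : normc (expi (- dotp x xi) * f x) <= normc (f x) by rewrite normcM normc_expi mul1r.
have FR : measurable_fun setT (fun xi => \int[mu]_x cRe (expi (- dotp x xi) * f x)).
  apply: K => [|xi x]; last exact: le_trans (ler_Re_normc _) (B xi x).
  under eq_fun do rewrite cReM /=.
  by apply: measurable_funB; apply: measurable_funM.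
have FI : measurable_fun setT (fun xi => \int[mu]_x cIm (expi (- dotp x xi) * f x)).
  apply: K => [|xi x]; last exact: le_trans (ler_Im_normc _) (B xi x).
  under eq_fun do rewrite cImM /=.
  by apply: measurable_funD; apply: measurable_funM.
by apply: cmeasurableM; [exact: cmeasurable_cst|split].
Qed.

Lemma fourier_is_distr_of f : cintegrable f -> fourier_is (distr_of f) (fourier f).
Proof.
move=> If; split; first exact: cmeasurable_fourier.
  move=> phi /schwartz_integrable Iphi; apply: cintegrable_bddM Iphi _ _; first exact: cmeasurable_fourier.
  by move=> x; exact: fourier_bound.
by move=> phi /schwartz_integrable Iphi; exact: fourier_mult.
Qed.

End fourier_of_distributions.

(** * Weighted L^2 norms *)

Section L2_norms.
Context {R : realType} {n : nat}.
Implicit Types (f g h : Rn R n -> R[i]) (u v : distr R n) (w : Rn R n -> R).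
Local Notation mu := (@lebesgue_Rn R n).

Lemma L2norm_le f (e : R) : 0 <= e ->
  (L2norm f <= e%:E)%E <-> (\int[mu]_x (normc (f x) ^+ 2)%:E <= (e ^+ 2)%:E)%E.
Proof.
move=> e0.
have -> : (\int[mu]_x (normc (f x) ^+ 2)%:E = (L2norm f) `^ 2)%E.
  rewrite /L2norm poweR_Lnorm ?pnatr_eq0//; apply: eq_integral => x _.
  by rewrite abse_EFin poweR_EFin ger0_norm ?normc_ge0// powR_mulrn// normc_ge0.
have : (0 <= L2norm f)%E by exact: Lnorm_ge0.
case: (L2norm f) => [N| |]// N0; last by rewrite poweRyr ?pnatr_eq0.
rewrite poweR_EFin powR_mulrn// !lee_fin ler_sqr// nnegrE.
Qed.

(** Uniqueness of the transform almost everywhere reduces the infimum to a single value. *)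
Lemma weighted_normE w u g : measurable_fun setT w -> fourier_is u g ->
  fourier_weighted_norm w u = L2norm (fun x => (w x)%:C * g x).
Proof.
move=> mw ug; have mC f : cmeasurable f -> measurable_fun setT (fun x => (`|(normc ((w x)%:C * f x))%:E| `^ 2)%E).
  move=> mf; apply: (measurableT_comp (measurable_poweR 2)).
  apply: measurableT_comp => //; apply/measurable_EFinP; apply: cmeasurable_normc.
  by apply: cmeasurableM => //; exact: cmeasurableR.
have e h : fourier_is u h -> L2norm (fun x => (w x)%:C * h x) = L2norm (fun x => (w x)%:C * g x).
  move=> uh; rewrite /L2norm unlock.
  apply: (congr1 (fun z => z `^ _)%E); apply: ae_eq_integral; first exact: measurableT.
  - by case: uh => mh _ _; exact: mC.
  - by case: ug => mg _ _; exact: mC.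
  - by apply: filterS (fourier_is_unique uh ug) => x -> _.
apply/eqP; rewrite eq_le; apply/andP; split; first by apply: ereal_inf_lbound; exists g.
by apply: le_ereal_inf_tmp => _ [h uh <-]; rewrite e.
Qed.

Lemma weighted_norm_lty w u : (fourier_weighted_norm w u < +oo)%E -> exists g, fourier_is u g.
Proof. by move=> /ereal_inf_lt[_ [g ug _] _]; exists g. Qed.

Lemma measurable_sobolev_weight (sigma : R) :
  measurable_fun setT (fun x : Rn R n => (1 + enorm x ^+ 2) `^ (sigma / 2) : R).
Proof.
apply: (measurableT_comp (measurable_powR (sigma / 2))).
by apply: measurable_funD => //; apply: measurable_funX; exact: measurable_enorm.
Qed.

Lemma measurable_homogeneous_weight (k : R) :
  measurable_fun setT (fun x : Rn R n => enorm x `^ k : R).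
Proof. by apply: (measurableT_comp (measurable_powR k)); exact: measurable_enorm. Qed.

End L2_norms.

(** * The Fourier transform of a solution *)

Section local_bound.
Context {R : realType} {n : nat}.
Implicit Types (f g h phi : Rn R n -> R[i]) (u v : distr R n) (k : Rn R n -> R).
Local Notation mu := (@lebesgue_Rn R n).

(** The absolute value covers both signs of the order: the third time derivative of a solution lies
    in H^(s - 1). *)
Lemma sobolev_weight_ge (sigma M : R) (x : Rn R n) : enorm x <= M ->
  (1 + M ^+ 2) `^ (- `|sigma / 2|) <= (1 + enorm x ^+ 2) `^ (sigma / 2).
Proof.
move=> xM; have M0 : 0 <= M by apply: le_trans xM; exact: enorm_ge0.
have x2 : enorm x ^+ 2 <= M ^+ 2 by rewrite lerXn2r ?nnegrE ?enorm_ge0.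
have p1 : 1 <= 1 + enorm x ^+ 2 by rewrite lerDl sqr_ge0.
have p0 : 0 < 1 + enorm x ^+ 2 by exact: lt_le_trans p1.
have q0 : 0 < 1 + M ^+ 2 by rewrite ltr_pwDl// sqr_ge0.
apply: (@le_trans _ _ ((1 + enorm x ^+ 2) `^ (- `|sigma / 2|))).
  rewrite !powRN lef_pV2 ?posrE ?powR_gt0//.
  by apply: ge0_ler_powR; rewrite ?nnegrE ?(ltW p0) ?(ltW q0)// lerD2l.
by apply: ler_powR => //; rewrite lerNl -normrN ler_norm.
Qed.

(** On a ball of frequencies the weight is bounded below, and Young's inequality with the norm bound
    [e] itself as parameter gives an estimate linear in [e]. The unit number [c] serves to select
    real or imaginary parts. *)
Lemma local_bound (sigma M : R) : exists2 C : R, 0 <= C &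
  forall k (K : R) (c : R[i]) u g (e : R), measurable_fun setT k ->
    (forall x, `|k x| <= K) -> (forall x, M < enorm x -> k x = 0) -> normc c = 1 ->
    fourier_is u g -> 0 < e -> (sobolev_norm sigma u <= e%:E)%E ->
    mu.-integrable setT (fun x => (k x * cRe (c * g x))%:E) /\
    `|\int[mu]_x (k x * cRe (c * g x))| <= C * K * e.
Proof.
pose m : R := (1 + M ^+ 2) `^ (- `|sigma / 2|).
have m0 : 0 < m by rewrite powR_gt0// ltr_pwDl// sqr_ge0.
(* An integrable function that is at least 1 on the ball, used in place of its indicator. *)
pose ga (x : Rn R n) : R := expR (M ^+ 2 / 2) * gaussn 1 origin x.
have ga0 x : 0 < ga x by rewrite mulr_gt0// ?expR_gt0// gaussn_gt0.
have Iga : mu.-integrable setT (EFin \o ga).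
  by apply: rintegrableZl; apply: integrable_gaussn; rewrite oner_eq0.
have Ig0 : 0 <= \int[mu]_x ga x by apply: Rintegral_ge0 => x _; exact: ltW.
exists ((m ^- 2 * \int[mu]_x ga x + 1) / 2).
  by rewrite divr_ge0// addr_ge0// mulr_ge0// invr_ge0 sqr_ge0.
move=> k K c u g e mk kK kM c1 ug e0 ue.
have K0 : 0 <= K by apply: le_trans (kK origin).
have [mg _ _] := ug.
have mw := @measurable_sobolev_weight R n sigma.
pose W x := normc (((1 + enorm x ^+ 2) `^ (sigma / 2))%:C * g x) ^+ 2.
have mW : measurable_fun setT W.
  by apply: measurable_funX; apply: cmeasurable_normc; apply: cmeasurableM => //; exact: cmeasurableR.
have W0 x : 0 <= W x by exact: sqr_ge0.
have We : (\int[mu]_x (W x)%:E <= (e ^+ 2)%:E)%E.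
  by apply/L2norm_le; [exact: ltW|rewrite -(weighted_normE mw ug)].
have IW : mu.-integrable setT (EFin \o W).
  apply/integrableP; split; first exact/measurable_EFinP.
  apply: (@le_lt_trans _ _ (e ^+ 2)%:E); last by rewrite ltry.
  by under eq_integral do rewrite /= ger0_norm//.
have rW : \int[mu]_x W x <= e ^+ 2.
  rewrite -lee_fin; apply: le_trans We; rewrite fineK//; exact: integrable_fin_num.
pose H x := K / 2 * (e * m ^- 2 * ga x + e^-1 * W x).
have IH : mu.-integrable setT (EFin \o H).
  by apply: rintegrableZl; apply: rintegrableD; exact: rintegrableZl.
have mp : measurable_fun setT (fun x => cRe (c * g x)).
  by have [] := cmeasurableM (cmeasurable_cst c) mg.
have kH x : `|k x * cRe (c * g x)| <= H x.
  have [xM|Mx] := leP (enorm x) M; last first.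
    rewrite kM// mul0r normr0 mulr_ge0 ?divr_ge0// addr_ge0// mulr_ge0//.
    - by rewrite mulr_ge0 ?(ltW e0)// invr_ge0 sqr_ge0.
    - by rewrite ltW.
    - by rewrite invr_ge0 ltW.
  rewrite normrM /H mulrAC -mulrA; apply: ler_pM => //.
  apply: le_trans (ler_Re_normc _) _; rewrite normcM c1 mul1r.
  have gg : 1 <= ga x.
    rewrite /ga gaussn0E -expRD -[leLHS]expR0 ler_expR.
    have := sqr_enorm x; have : enorm x ^+ 2 <= M ^+ 2 by rewrite lerXn2r ?nnegrE ?(le_trans _ xM) ?enorm_ge0.
    by rewrite expr1n => ? <-; lra.
  have wm : m ^+ 2 * normc (g x) ^+ 2 <= W x.
    rewrite /W normcM normcR ger0_norm ?powR_ge0// exprMn ler_wpM2r ?sqr_ge0//.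
    by rewrite lerXn2r ?nnegrE ?powR_ge0 ?(ltW m0)//; exact: sobolev_weight_ge.
  rewrite ler_pdivlMr//; have := ler_wpM2l (_ : 0 <= e^-1) wm; rewrite invr_ge0 (ltW e0) => /(_ isT) h1.
  have h2 : e * m ^- 2 <= e * m ^- 2 * ga x.
    by rewrite ler_peMr// mulr_ge0 ?(ltW e0)// invr_ge0 sqr_ge0.
  apply: le_trans (lerD h2 h1).
  rewrite -subr_ge0 [leRHS](_ : _ = e * (m^-1 - e^-1 * m * normc (g x)) ^+ 2).
    by rewrite mulr_ge0 ?sqr_ge0 ?(ltW e0).
  by field; rewrite !gt_eqF.
have mkp : measurable_fun setT (fun x => k x * cRe (c * g x)) by exact: measurable_funM.
have Ik : mu.-integrable setT (EFin \o (fun x => k x * cRe (c * g x))).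
  exact: rintegrable_le mkp kH IH.
split; first exact: Ik.
apply: le_trans (le_normr_Rintegral measurableT Ik) _.
apply: (@le_trans _ _ (\int[mu]_x H x)).
  by apply: le_Rintegral => //; exact: (integrable_abse Ik).
rewrite RintegralZl//; last by apply: rintegrableD; exact: rintegrableZl.
rewrite RintegralD//; [|exact: rintegrableZl..].
have -> : \int[mu]_x (e * m ^- 2 * ga x) = e * m ^- 2 * \int[mu]_x ga x by rewrite RintegralZl.
have -> : \int[mu]_x (e^-1 * W x) = e^-1 * \int[mu]_x W x by rewrite RintegralZl.
have h : e^-1 * \int[mu]_x W x <= e.
  by rewrite ler_pdivrMl// -expr2.
have := ler_wpM2l K0 h.
rewrite [X in _ -> _ <= X](_ : _ = K / 2 * (e * m ^- 2 * \int[mu]_x ga x) + K / 2 * e); last by field; rewrite gt_eqF.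
by rewrite mulrDr; lra.
Qed.

End local_bound.

Section eps_derivative.
Context {R : realType}.

(** Suited to strong derivatives in a Sobolev norm, whose remainder is only o(h). *)
Lemma der_eps (f : R -> R) (x d : R) : (forall e : R, 0 < e -> exists2 eta : R, 0 < eta &
    forall h : R, `|h| < eta -> `|f (x + h) - f x - h * d| <= e * `|h|) -> is_derive x 1 f d.
Proof.
move=> H.
have cv : h^-1 *: (f (h *: 1 + x) - f x) @[h --> 0^'] --> d.
  apply/cvgrPdist_le => e e0; have [eta eta0 He] := H e e0; near=> h.
  have h0 : h != 0 by near: h; exact: nbhs_dnbhs_neq.
  have h1 : `|h| < eta by near: h; exact: dnbhs0_lt.
  have := He h h1; rewrite /GRing.scale/= mulr1 (addrC h x) => Hh.
  rewrite -(ler_pM2l (_ : 0 < `|h|)) ?normr_gt0//.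
  by rewrite -normrM mulrBr mulrA divff// mul1r distrC [leRHS]mulrC.
apply: DeriveDef.
  by apply/cvg_ex; exists d; exact: cv.
by apply: cvg_lim => //; exact: cv.
Unshelve. all: by end_near.
Qed.

End eps_derivative.

Section kernel_bounds.
Context {R : realType} (tau delta : R).
Hypotheses (tau0 : 0 < tau) (delta0 : 0 < delta).
Local Notation b := (delta + tau).

Lemma mgtk_bounded_on (j : nat) (P Z : R) : exists2 K : R, 0 <= K & forall rho z : R,
  0 <= rho -> rho <= P -> `|z| <= Z -> `|mgtk tau b j rho z| <= K.
Proof.
have b0 : 0 <= b by rewrite addr_ge0// ltW.
exists (mgt_rate tau b `|P| ^+ j * expR (mgt_rate tau b `|P| * `|Z|)).
  by rewrite mulr_ge0 ?expR_ge0// exprn_ge0// mgt_rate_ge0.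
move=> rho z r0 rP zZ; apply: le_trans (mgtk_le tau0 b0 j z r0) _.
have rP' : rho <= `|P| by exact: le_trans (ler_norm P).
have rate : mgt_rate tau b rho <= mgt_rate tau b `|P|.
  rewrite /mgt_rate lerD2l ler_wpM2r ?invr_ge0 ?(ltW tau0)//.
  by apply: lerD => //; rewrite lerD2l ler_wpM2l.
have p0 := mgt_rate_ge0 tau0 b0 r0.
apply: ler_pM; rewrite ?exprn_ge0 ?expR_ge0//.
  by apply: lerXn2r; rewrite ?nnegrE// (le_trans p0).
by rewrite ler_expR; apply: ler_pM => //; apply: le_trans zZ (ler_norm _).
Qed.

Lemma mgt_fund_bounded_on (i j : nat) (P Z : R) : exists2 K : R, 0 <= K & forall rho z : R,
  0 <= rho -> rho <= P -> `|z| <= Z -> `|mgt_fund tau delta i j rho z| <= K.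
Proof.
have b0 : 0 <= b by rewrite addr_ge0// ltW.
have [K0 K00 H0] := mgtk_bounded_on j P Z.
have [K1 K10 H1] := mgtk_bounded_on j.+1 P Z.
have [K2 K20 H2] := mgtk_bounded_on j.+2 P Z.
have t0 : 0 <= tau^-1 by rewrite invr_ge0 ltW.
have X0 : 0 <= tau^-1 * K1 by exact: mulr_ge0.
have Y0 : 0 <= tau^-1 * K0 by exact: mulr_ge0.
have Z0 : 0 <= b * `|P| / tau * K0 by rewrite !mulr_ge0.
exists (K2 + tau^-1 * K1 + b * `|P| / tau * K0 + K1 + tau^-1 * K0 + K0); first by rewrite !addr_ge0.
move=> rho z r0 rP zZ; have rP' : rho <= `|P| by exact: le_trans (ler_norm P).
have h0 := H0 rho z r0 rP zZ; have h1 := H1 rho z r0 rP zZ; have h2 := H2 rho z r0 rP zZ.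
have n1 : `|tau^-1 * mgtk tau b j.+1 rho z| <= tau^-1 * K1.
  by rewrite normrM ger0_norm// ler_wpM2l.
have n0 : `|tau^-1 * mgtk tau b j rho z| <= tau^-1 * K0.
  by rewrite normrM ger0_norm// ler_wpM2l.
have n2 : `|b * rho / tau * mgtk tau b j rho z| <= b * `|P| / tau * K0.
  rewrite normrM ler_pM// ger0_norm ?mulr_ge0// ler_wpM2r// ler_wpM2l//.
case: i => [|[|i]] /=.
- apply: le_trans (ler_normD _ _) _; have := ler_normD (mgtk tau b j.+2 rho z) (tau^-1 * mgtk tau b j.+1 rho z); lra.
- apply: le_trans (ler_normD _ _) _; lra.
- lra.
Qed.

Lemma measurable_mgt_fund n i j t :
  measurable_fun setT (fun xi : Rn R n => mgt_fund tau delta i j (enorm xi ^+ 2) t).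
Proof.
have b0 : 0 <= b by rewrite addr_ge0// ltW.
have m k := @measurable_mgtk R tau b tau0 b0 n k t.
have me : measurable_fun setT (fun xi : Rn R n => enorm xi ^+ 2 : R).
  by apply: measurable_funX; exact: measurable_enorm.
case: i => [|[|i]] /=; last exact: m.
- apply: measurable_funD; first by apply: measurable_funD => //; exact: measurable_funM.
  apply: measurable_funM => //; apply: measurable_funM => //; exact: measurable_funM.
- by apply: measurable_funD => //; exact: measurable_funM.
Qed.

End kernel_bounds.

(** * Pairing with the adjoint solution *)

Section pairing.
Context {R : realType} {n : nat} (tau delta : R).
Hypotheses (tau0 : 0 < tau) (delta0 : 0 < delta).
Local Notation mu := (@lebesgue_Rn R n).
Local Notation A i j z x := (mgt_fund tau delta i j (enorm x ^+ 2) z).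
Context (M : R) (chi : Rn R n -> R) (c : R[i]).
Hypotheses (mchi : measurable_fun setT chi) (chi1 : forall x, `|chi x| <= 1)
  (chiM : forall x, M < enorm x -> chi x = 0) (c1 : normc c = 1).

Definition pairing i j z (g : Rn R n -> R[i]) : R := \int[mu]_x (chi x * A i j z x * cRe (c * g x)).

Lemma pairing_bound i j sigma Z : exists2 C : R, 0 <= C & forall z u g e, `|z| <= Z ->
  fourier_is u g -> 0 < e -> (sobolev_norm sigma u <= e%:E)%E ->
  mu.-integrable setT (fun x => (chi x * A i j z x * cRe (c * g x))%:E) /\
  `|pairing i j z g| <= C * e.
Proof.
have [C C0 HC] := @local_bound R n sigma M.
have [K K0 HK] := mgt_fund_bounded_on tau0 delta0 i j (M ^+ 2) Z.
exists (C * K); first exact: mulr_ge0.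
move=> z u g e zZ ug e0 ue; apply: HC ue => //.
- by apply: measurable_funM => //; exact: measurable_mgt_fund.
- move=> x; have [xM|Mx] := leP (enorm x) M; last by rewrite chiM// mul0r normr0.
  rewrite normrM -[leRHS]mul1r ler_pM// HK ?sqr_ge0//.
  by rewrite lerXn2r ?nnegrE ?(le_trans _ xM) ?enorm_ge0.
- by move=> x /chiM ->; rewrite mul0r.
Qed.

(** The kernel will be taken at time T - t, hence the increment [z - h]. The first-order bound is
    used against the next derivative of the solution, the second-order one against the solution
    itself. *)
Lemma pairing_increment i j sigma z Z : `|z| + 1 <= Z -> exists2 C : R, 0 <= C & forall u g e (h : R), `|h| <= 1 ->
  fourier_is u g -> 0 < e -> (sobolev_norm sigma u <= e%:E)%E ->
  `|pairing i j (z - h) g - pairing i j z g| <= C * e * `|h| /\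
  `|pairing i j (z - h) g - pairing i j z g + h * pairing i j.+1 z g| <= C * e * h ^+ 2.
Proof.
move=> zZ; have [C C0 HC] := @local_bound R n sigma M.
have [K1 K10 HK1] := mgt_fund_bounded_on tau0 delta0 i j.+1 (M ^+ 2) Z.
have [K2 K20 HK2] := mgt_fund_bounded_on tau0 delta0 i j.+2 (M ^+ 2) Z.
have [P0 _ HP0] := pairing_bound i j sigma Z; have [P1 _ HP1] := pairing_bound i j.+1 sigma Z.
exists (C * (K1 + K2)); first by rewrite mulr_ge0// addr_ge0.
move=> u g e h h1 ug e0 ue.
have z1 : `|z| <= Z by apply: le_trans zZ; rewrite lerDl.
have zh : `|z - h| <= Z by apply: le_trans zZ; rewrite (le_trans (ler_normB _ _))// lerD2l.
have [I1 _] := HP0 _ _ _ _ zh ug e0 ue; have [I0 _] := HP0 _ _ _ _ z1 ug e0 ue.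
have [I2 _] := HP1 _ _ _ _ z1 ug e0 ue.
have dA (k : nat) (x : Rn R n) (w : R) : is_derive w 1 (mgt_fund tau delta i k (enorm x ^+ 2)) (mgt_fund tau delta i k.+1 (enorm x ^+ 2) w).
  by apply: mgt_fund_derive => //; exact: sqr_ge0.
have mA k w := @measurable_mgt_fund R tau delta tau0 delta0 n i k w.
have seg w : `|w - z| <= `|- h| -> `|w| <= Z.
  rewrite normrN => wh; apply: le_trans zZ; rewrite -[w](subrK z) addrC (le_trans (ler_normD _ _))// lerD2l.
  exact: le_trans wh h1.
have xM2 (x : Rn R n) : enorm x <= M -> enorm x ^+ 2 <= M ^+ 2.
  by move=> xM; rewrite lerXn2r ?nnegrE ?(le_trans _ xM) ?enorm_ge0.
split.
  rewrite /pairing -RintegralB//.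
  rewrite [X in `|X|](_ : _ = \int[mu]_x (chi x * (A i j (z - h) x - A i j z x) * cRe (c * g x))); last first.
    by apply: eq_Rintegral => x _; ring.
  have := HC (fun x => chi x * (A i j (z - h) x - A i j z x)) (K1 * `|h|) c u g e.
  case=> //.
  - by apply: measurable_funM => //; exact: measurable_funB.
  - move=> x; have [xM|Mx] := leP (enorm x) M; last by rewrite chiM// mul0r normr0 mulr_ge0.
    rewrite normrM -[leRHS]mul1r ler_pM//.
    have := @MVT_bound _ (mgt_fund tau delta i j (enorm x ^+ 2)) _ z (z - h) K1 (fun w _ => dA j x w).
    rewrite addrAC subrr add0r normrN; apply=> w wh; apply: HK1; rewrite ?sqr_ge0 ?xM2// seg// normrN.
    exact: wh.
  - by move=> x /chiM ->; rewrite mul0r.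
  - move=> _ /le_trans; apply; rewrite mulrA -mulrA (mulrC `|h|) mulrA -!mulrA ler_wpM2l// !mulrA.
    by rewrite ler_wpM2r// ler_wpM2r ?(ltW e0)// lerDl.
rewrite /pairing -RintegralB// -RintegralZl// -RintegralD//; [|exact: rintegrableB|exact: rintegrableZl].
rewrite [X in `|X|](_ : _ = \int[mu]_x (chi x * (A i j (z - h) x - A i j z x + h * A i j.+1 z x) * cRe (c * g x))); last first.
  by apply: eq_Rintegral => x _; ring.
have := HC (fun x => chi x * (A i j (z - h) x - A i j z x + h * A i j.+1 z x)) (K2 * h ^+ 2) c u g e.
case=> //.
- apply: measurable_funM => //; apply: measurable_funD; first exact: measurable_funB.
  exact: measurable_funM.
- move=> x; have [xM|Mx] := leP (enorm x) M; last by rewrite chiM// mul0r normr0 mulr_ge0// sqr_ge0.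
  rewrite normrM -[leRHS]mul1r ler_pM//.
  have := @taylor2_bound _ _ _ _ z (- h) K2 (dA j x) (dA j.+1 x).
  rewrite mulNr opprK sqrrN; apply=> w wh; apply: HK2; rewrite ?sqr_ge0 ?xM2// seg//.
- by move=> x /chiM ->; rewrite mul0r.
- move=> _ /le_trans; apply; rewrite (_ : C * (K2 * h ^+ 2) * e = C * K2 * e * h ^+ 2); last by ring.
  apply: ler_wpM2r; first exact: sqr_ge0.
  by apply: ler_wpM2r; [exact: ltW|apply: ler_wpM2l => //; rewrite lerDr].
Qed.

End pairing.

Lemma ler_norm_sum3 (R : realType) (x0 y0 d0 x1 y1 d1 x2 y2 d2 h e : R) :
  `|x0 - y0 - h * d0| <= e / 3 * `|h| -> `|x1 - y1 - h * d1| <= e / 3 * `|h| ->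
  `|x2 - y2 - h * d2| <= e / 3 * `|h| ->
  `|x0 + x1 + x2 - (y0 + y1 + y2) - h * (d0 + d1 + d2)| <= e * `|h|.
Proof.
rewrite !ler_norml => /andP[a1 a2] /andP[a3 a4] /andP[a5 a6]; apply/andP; split; lra.
Qed.

Lemma ler_norm_increment (R : realType) (p p1 p2 p3 p4 p5 q h k0 k1 k2 : R) :
  q = p - p1 - h * p2 -> `|q| <= k0 -> `|h * (p2 - p3)| <= k1 -> `|p1 - p4 + h * p5| <= k2 ->
  `|p - p4 - h * (p3 - p5)| <= k0 + k1 + k2.
Proof.
move=> -> h0 h1 h2; rewrite (_ : p - p4 - h * (p3 - p5) =
  (p - p1 - h * p2) + h * (p2 - p3) + (p1 - p4 + h * p5)); last by ring.
by rewrite (le_trans (ler_normD _ _))// lerD// (le_trans (ler_normD _ _))// lerD.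
Qed.

Lemma cRe_difference_quotient (R : realType) (c u v w : R[i]) (r : R) :
  cRe (c * (r%:C * (u - v) - w)) = r * (cRe (c * u) - cRe (c * v)) - cRe (c * w).
Proof. by rewrite !cE /=; ring. Qed.

(** * Identification of the transform of a solution *)

Section identification.
Context {R : realType} {n : nat} (tau delta s : R).
Hypotheses (tau0 : 0 < tau) (delta0 : 0 < delta).
Local Notation b := (delta + tau).
Local Notation mu := (@lebesgue_Rn R n).
Local Notation A i j z x := (mgt_fund tau delta i j (enorm x ^+ 2) z).

Lemma sobolev_derivative_eps (sg : R) (u v : R -> distr R n) (t e : R) :
  sobolev_derivative sg u v -> 0 <= t -> 0 < e ->
  exists2 eta : R, 0 < eta & forall h : R, `|h| < eta -> h != 0 -> 0 <= t + h ->
    (sobolev_norm sg (((h^-1)%:C \*o (u (t + h) \- u t)) \- v t)%R < e%:E)%E.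
Proof.
move=> H t0 e0; have := H t t0.
have E0 : nbhs (0%E : \bar R) [set x : \bar R | (x < e%:E)%E].
  exact: (@nbhs_open_ereal_lt R 0 (fun=> e)).
move=> /(_ _ E0) /nbhs_ballP[eta /= eta0 H']; exists eta => // h he h0 th.
have := H' (t + h); rewrite /ball/= opprD addrA subrr sub0r normrN => /(_ he).
rewrite addrAC subrr add0r; apply => //.
by apply: contra_neq h0 => /eqP; rewrite -subr_eq0 addrAC subrr add0r => /eqP.
Qed.

Section fixed_cutoff.
Context (psi : nat -> R -> distr R n) (G : nat -> R -> Rn R n -> R[i]).
Hypotheses (psi_finite : forall j t, (j <= 3)%N -> 0 <= t -> (sobolev_norm (s + 2 - j%:R) (psi j t) < +oo)%E)
  (psi_derivative : forall j, (j < 3)%N -> sobolev_derivative (s + 2 - j.+1%:R) (psi j) (psi j.+1))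
  (GP : forall j t, (j <= 3)%N -> 0 <= t -> fourier_is (psi j t) (G j t)).
Context (M : R) (chi : Rn R n -> R) (c : R[i]).
Hypotheses (mchi : measurable_fun setT chi) (chi1 : forall x, `|chi x| <= 1)
  (chiM : forall x, M < enorm x -> chi x = 0) (c1 : normc c = 1).
Local Notation P := (pairing tau delta chi c).

Lemma psi_norm j t : (j <= 3)%N -> 0 <= t ->
  exists2 e : R, 0 < e & (sobolev_norm (s + 2 - j%:R) (psi j t) <= e%:E)%E.
Proof.
move=> j3 t0; have := psi_finite j3 t0.
case: (sobolev_norm _ _) => [r _| |]//; last by exists 1 => //; exact: leNye.
by exists (`|r| + 1); rewrite ?ltr_wpDl// lee_fin (le_trans (ler_norm r))// lerDl.
Qed.

Lemma psi_integrable i l z j t : (j <= 3)%N -> 0 <= t ->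
  mu.-integrable setT (fun x => (chi x * A i l z x * cRe (c * G j t x))%:E).
Proof.
move=> j3 t0; have [e e0 eN] := psi_norm j3 t0.
have [C _ H] := pairing_bound tau0 delta0 mchi chi1 chiM c1 i l (s + 2 - j%:R) `|z|.
by have [] := H z _ _ _ (lexx _) (GP j3 t0) e0 eN.
Qed.

(** A product rule with three errors: the difference quotient of the solution, which gets [e / 2],
    and the first-order and second-order increments of the kernel, which share the other half. *)
Lemma pairing_derivative i l z j t e : (j < 3)%N -> 0 <= t -> 0 < e ->
  exists2 eta : R, 0 < eta & forall h : R, `|h| < eta -> 0 <= t + h ->
  `|P i l (z - h) (G j (t + h)) - P i l z (G j t) -
    h * (P i l z (G j.+1 t) - P i l.+1 z (G j t))| <= e * `|h|.
Proof.
move=> j3 t0 e0; have j3' := ltnW j3.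
have [e1 e10 N1] := psi_norm j3 t0; have [e2 e20 N2] := psi_norm j3' t0.
have [C0 C00 H0] := pairing_bound tau0 delta0 mchi chi1 chiM c1 i l (s + 2 - j.+1%:R) (`|z| + 1).
have [C1 C10 H1] := pairing_increment tau0 delta0 mchi chi1 chiM c1 i l (s + 2 - j.+1%:R) (lexx (`|z| + 1)).
have [C2 C20 H2] := pairing_increment tau0 delta0 mchi chi1 chiM c1 i l (s + 2 - j%:R) (lexx (`|z| + 1)).
have X0 : 0 <= C1 * e1 by rewrite mulr_ge0// ltW.
have Y0 : 0 <= C2 * e2 by rewrite mulr_ge0// ltW.
have D0 : 0 < C1 * e1 + C2 * e2 + 1 by rewrite ltr_wpDl// addr_ge0.
pose eq := e / (2 * (C0 + 1)).
have eq0 : 0 < eq by rewrite divr_gt0// mulr_gt0// ltr_wpDl.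
have [eta eta0 Heta] := sobolev_derivative_eps (psi_derivative j3) t0 eq0.
exists (Num.min eta (Num.min 1 (e / (2 * (C1 * e1 + C2 * e2 + 1))))).
  by rewrite !lt_min eta0 ltr01 divr_gt0// mulr_gt0.
move=> h; rewrite !lt_min => /and3P[h_eta h1 h_e] th.
have [->|h0] := eqVneq h 0; first by rewrite subr0 addr0 mul0r subrr subr0 normr0 mulr0.
pose Q x := (h^-1)%:C * (G j (t + h) x - G j t x) - G j.+1 t x.
have FQ : fourier_is (((h^-1)%:C \*o (psi j (t + h) \- psi j t)) \- psi j.+1 t) Q.
  by apply: fourier_isB; [apply: fourier_isZ; apply: fourier_isB|]; apply: GP.
have zh : `|z - h| <= `|z| + 1 by rewrite (le_trans (ler_normB _ _))// lerD2l ltW.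
have [_ BQ] := H0 (z - h) _ _ _ zh FQ eq0 (ltW (Heta h h_eta h0 th)).
have [B1 _] := H1 _ _ _ h (ltW h1) (GP j3 t0) e10 N1.
have [_ B2] := H2 _ _ _ h (ltW h1) (GP j3' t0) e20 N2.
have EQ : h * P i l (z - h) Q = P i l (z - h) (G j (t + h)) - P i l (z - h) (G j t) - h * P i l (z - h) (G j.+1 t).
  rewrite /pairing -RintegralB//; [|exact: psi_integrable..].
  rewrite -!RintegralZl//; [|by apply: psi_integrable|]; last first.
    have [/=] := H0 (z - h) _ _ _ zh FQ eq0 (ltW (Heta h h_eta h0 th)); exact.
  rewrite -RintegralB//.
  - apply: eq_Rintegral => x _; rewrite /Q cRe_difference_quotient.
    by field.
  - by apply: rintegrableB; exact: psi_integrable.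
  - by apply: rintegrableZl; exact: psi_integrable.
have Bq : `|h * P i l (z - h) Q| <= e / 2 * `|h|.
  rewrite normrM mulrC ler_wpM2r//; apply: le_trans BQ _.
  rewrite /eq mulrA ler_pdivrMr ?mulr_gt0 ?ltr_wpDl//.
  rewrite [leRHS](_ : _ = (C0 + 1) * e); last by field.
  by rewrite ler_wpM2r ?(ltW e0)// lerDl.
have Bh : C1 * e1 * `|h| * `|h| + C2 * e2 * h ^+ 2 <= e / 2 * `|h|.
  rewrite -[h ^+ 2]real_normK ?num_real// expr2 mulrA -mulrDl -mulrDl ler_wpM2r//.
  rewrite mulrC; apply: (@le_trans _ _ (`|h| * (C1 * e1 + C2 * e2 + 1))); first by rewrite ler_wpM2l// lerDl.
  rewrite -ler_pdivlMr//; apply: le_trans (ltW h_e) _.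
  by rewrite invfM mulrA.
have B1' : `|h * (P i l (z - h) (G j.+1 t) - P i l z (G j.+1 t))| <= C1 * e1 * `|h| * `|h|.
  by rewrite normrM mulrC ler_wpM2r.
apply: le_trans (ler_norm_increment EQ Bq B1' B2) _.
rewrite -addrA (le_trans (lerD (lexx _) Bh))// -mulrDl ler_wpM2r//.
by rewrite [leRHS](splitr e).
Qed.

(** The fundamental matrix commutes with the companion matrix. Multiplying on the other side gives
    relations along a row, which are the adjoint system. *)
Lemma mgt_fund_row (l : nat) rho z : 0 <= rho ->
  [/\ mgt_fund tau delta 0 l.+1 rho z = - (rho / tau) * mgt_fund tau delta 2 l rho z,
      mgt_fund tau delta 1 l.+1 rho z = mgt_fund tau delta 0 l rho z - b * rho / tau * mgt_fund tau delta 2 l rho z &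
      mgt_fund tau delta 2 l.+1 rho z = mgt_fund tau delta 1 l rho z - tau^-1 * mgt_fund tau delta 2 l rho z].
Proof.
move=> r0; have b0 : 0 <= b by rewrite addr_ge0// ltW.
rewrite /mgt_fund; split; [rewrite (mgtk_rec tau0 b0 l z r0)| |]; by field; rewrite gt_eqF.
Qed.

Hypothesis psi_equation : forall t, 0 < t ->
  distr_eq ((tau%:C \*o psi 3%N t) \+ psi 2%N t \- distr_laplacian (psi 0%N t)
             \- ((delta + tau)%:C \*o distr_laplacian (psi 1%N t))) (fun=> 0).

Lemma fourier_is0 : fourier_is (fun=> 0 : R[i]) (fun _ : Rn R n => 0).
Proof.
have e phi : (fun x : Rn R n => 0 * phi x : R[i]) = fun=> 0 by apply/funext => x; rewrite mul0r.
split; first exact: cmeasurable_cst.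
  by move=> phi _; rewrite e; exact: cintegrable0.
by move=> phi _; rewrite /distr_of e cintegral0.
Qed.

Lemma psi_equation_ae t : 0 < t -> {ae mu, forall x,
  tau * cRe (c * G 3 t x) + cRe (c * G 2 t x) + enorm x ^+ 2 * cRe (c * G 0 t x) +
  b * enorm x ^+ 2 * cRe (c * G 1 t x) = 0}.
Proof.
move=> t0; have t0' := ltW t0.
have E := fourier_isB (fourier_isB (fourier_isD (fourier_isZ tau%:C (GP (leqnn 3) t0')) (GP (isT : (2 <= 3)%N) t0'))
  (fourier_is_laplacian (GP (isT : (0 <= 3)%N) t0')))
  (fourier_isZ (delta + tau)%:C (fourier_is_laplacian (GP (isT : (1 <= 3)%N) t0'))).
have := fourier_is_unique (fourier_is_eq (psi_equation t0) E) fourier_is0.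
apply: filterS => x e0.
have := congr1 (fun z => cRe (c * z)) e0; rewrite mulr0 /= => <-.
rewrite mulrBr mulrBr mulrDr !cReB !cReD [c * (tau%:C * _)]mulrCA cReZ.
rewrite [c * (- _ * _)]mulrCA -real_complexN cReZ [c * (_%:C * _)]mulrCA cReZ [c * (_%:C * _)]mulrCA cReZ.
ring.
Qed.

(** The integrand cancels almost everywhere by the row relations and the equation. The exceptional
    set depends on [t], which is harmless under the integral. *)
Lemma pairing_row0 l z t : 0 < t ->
  (P 0 l z (G 1 t) - P 0 l.+1 z (G 0 t)) + (P 1 l z (G 2 t) - P 1 l.+1 z (G 1 t)) +
  (P 2 l z (G 3 t) - P 2 l.+1 z (G 2 t)) = 0.
Proof.
move=> t0; have t0' := ltW t0.
have I i k j : (j <= 3)%N -> mu.-integrable setT (EFin \o (fun x => chi x * A i k z x * cRe (c * G j t x))).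
  by move=> j3; exact: psi_integrable.
pose F i x := chi x * A i l z x * cRe (c * G i.+1 t x) - chi x * A i l.+1 z x * cRe (c * G i t x).
have IF i : (i < 3)%N -> mu.-integrable setT (EFin \o F i).
  by move=> i3; apply: rintegrableB; apply: I => //; exact: ltnW.
have eF i : (i < 3)%N -> P i l z (G i.+1 t) - P i l.+1 z (G i t) = \int[mu]_x F i x.
  by move=> i3; rewrite /pairing -RintegralB//; apply: I => //; exact: ltnW.
rewrite !eF// -RintegralD//; [|exact: IF..].
rewrite -RintegralD//; [|by apply: rintegrableD; exact: IF|exact: IF].
transitivity (\int[mu]_x (fun=> 0 : R) x); last by rewrite Rintegral_cst// mul0r.
apply: ae_eq_Rintegral.
- have mF i : (i < 3)%N -> measurable_fun setT (F i).
    by move=> i3; apply/measurable_EFinP; exact: measurable_int (IF i i3).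
  by apply: measurable_funD; [apply: measurable_funD|]; exact: mF.
- exact: measurable_cst.
- apply: filterS (psi_equation_ae t0) => x e.
  rewrite /F; have [-> -> ->] := mgt_fund_row l z (sqr_ge0 (enorm x)).
  have -> : cRe (c * G 2 t x) = - (tau * cRe (c * G 3 t x) + enorm x ^+ 2 * cRe (c * G 0 t x) +
      b * enorm x ^+ 2 * cRe (c * G 1 t x)).
    by apply/eqP; rewrite -addr_eq0; apply/eqP; rewrite -[RHS]e; ring.
  by field; rewrite gt_eqF.
Qed.

(* The pairing of psi(t) with the adjoint solution at time T - t does not depend on t. *)
Lemma pairing_conserved l T : 0 < T ->
  P 0 l 0 (G 0 T) + P 1 l 0 (G 1 T) + P 2 l 0 (G 2 T) =
  P 0 l T (G 0 0) + P 1 l T (G 1 0) + P 2 l T (G 2 0).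
Proof.
move=> T0; pose S t := P 0 l (T - t) (G 0 t) + P 1 l (T - t) (G 1 t) + P 2 l (T - t) (G 2 t).
pose D' t := (P 0 l (T - t) (G 1 t) - P 0 l.+1 (T - t) (G 0 t)) + (P 1 l (T - t) (G 2 t) - P 1 l.+1 (T - t) (G 1 t)) +
  (P 2 l (T - t) (G 3 t) - P 2 l.+1 (T - t) (G 2 t)).
have expansion t e : 0 <= t -> 0 < e -> exists2 eta : R, 0 < eta & forall h : R, `|h| < eta -> 0 <= t + h ->
   `|S (t + h) - S t - h * D' t| <= e * `|h|.
  move=> t0 e0; have e3 : 0 < e / 3 by rewrite divr_gt0.
  have [n0 n00 H0] := pairing_derivative 0 l (T - t) (isT : (0 < 3)%N) t0 e3.
  have [n1 n10 H1] := pairing_derivative 1 l (T - t) (isT : (1 < 3)%N) t0 e3.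
  have [n2 n20 H2] := pairing_derivative 2 l (T - t) (isT : (2 < 3)%N) t0 e3.
  exists (Num.min n0 (Num.min n1 n2)); first by rewrite !lt_min n00 n10.
  move=> h; rewrite !lt_min => /and3P[h0 h1 h2] th.
  rewrite /S /D' opprD addrA.
  exact: ler_norm_sum3 (H0 h h0 th) (H1 h h1 th) (H2 h h2 th).
have dS (t : R) : 0 < t -> is_derive t 1 S 0.
  move=> t0; apply: der_eps => e e0.
  have [eta eta0 H] := expansion t e (ltW t0) e0.
  exists (Num.min eta t); first by rewrite lt_min eta0.
  move=> h; rewrite lt_min => /andP[h1 h2].
  have th : 0 <= t + h.
    have : - t <= h by rewrite lerNl (le_trans (ler_norm _))// normrN ltW.
    by rewrite lerNl => ?; lra.
  by have := H h h1 th; rewrite /D' pairing_row0.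
have const t : 0 < t -> t < T -> S t = S T.
  move=> t0 tT; have [|w _] := @MVT_derT _ S (fun=> 0) t T tT.
    by move=> w /andP[tw _]; apply: dS; exact: lt_le_trans tw.
  by rewrite mul0r => /eqP; rewrite subr_eq0 => /eqP.
suff : S T = S 0 by rewrite /S subrr subr0.
(* The equation is available only for positive times. Constancy extends to time 0 by the one-sided
   expansion there, taken at a small [h] where [S] already has its value at [T]. *)
have [eta eta0 H] := expansion 0 1 (lexx _) ltr01.
set D := D' 0 in H.
apply/eqP; rewrite -subr_eq0 -normr_le0; apply/ler_addgt0Pl => e e0; rewrite addr0.
pose h := Num.min (Num.min (eta / 2) (T / 2)) (e / (`|D| + 1)).
have D0 : 0 < `|D| + 1 by rewrite ltr_wpDl.
have h0 : 0 < h by rewrite !lt_min !divr_gt0.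
have h1 : h < eta.
  apply: (@le_lt_trans _ _ (eta / 2)); first by rewrite /h !ge_min lexx.
  lra.
have h2 : h < T.
  apply: (@le_lt_trans _ _ (T / 2)); first by rewrite /h !ge_min lexx orbT.
  lra.
have h3 : h * (`|D| + 1) <= e by rewrite -ler_pdivlMr// /h ge_min lexx orbT.
have := H h; rewrite add0r (gtr0_norm h0) => /(_ h1 (ltW h0)); rewrite (const h h0 h2) mul1r => H'.
have -> : S T - S 0 = (S T - S 0 - h * D) + h * D by ring.
apply: le_trans (ler_normD _ _) _; rewrite normrM (gtr0_norm h0); lra.
Qed.

End fixed_cutoff.

(** The difference [D] between the transform and the formula is tested, through the conserved
    pairing, against a truncation of itself on each ball of frequencies. *)
Lemma mgt_fourier_part (f0 f1 f2 : Rn R n -> R[i]) psi (l : nat) (T : R) g (c : R[i]) :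
  cintegrable f0 -> cintegrable f1 -> cintegrable f2 ->
  mgt_solution tau delta s f0 f1 f2 psi -> (l <= 2)%N -> 0 < T -> normc c = 1 ->
  fourier_is (psi l T) g -> {ae mu, forall x, cRe (c * g x) =
    mgt_sol tau delta (enorm x ^+ 2) (cRe (c * fourier f0 x)) (cRe (c * fourier f1 x)) (cRe (c * fourier f2 x)) l T}.
Proof.
move=> If0 If1 If2 [Hc Hd Heq [i0 i1 i2]] l2 T0 c1 lg.
have fin j t : (j <= 3)%N -> 0 <= t -> (sobolev_norm (s + 2 - j%:R) (psi j t) < +oo)%E.
  by move=> j3 t0; have [+ _] := Hc j j3; apply.
have /choice[G' HG'] : forall p : nat * R, exists g, (p.1 <= 3)%N -> 0 <= p.2 -> fourier_is (psi p.1 p.2) g.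
  move=> [j t]; have [j3|j3] := boolP (j <= 3)%N; last by exists (fun=> 0) => h; case/negP: j3.
  have [t0|t0] := boolP (0 <= t); last by exists (fun=> 0) => _ h; case/negP: t0.
  by have [g' Hg'] := weighted_norm_lty (fin j t j3 t0); exists g'.
pose G j t := G' (j, t).
have HG j t : (j <= 3)%N -> 0 <= t -> fourier_is (psi j t) (G j t) by move=> j3 t0; exact: HG'.
have l3 : (l <= 3)%N by exact: leq_trans l2 _.
have eG : {ae mu, forall x, g x = G l T x} by apply: fourier_is_unique lg (HG _ _ l3 (ltW T0)).
have e0 : {ae mu, forall x, G 0 0 x = fourier f0 x}.
  by apply: fourier_is_unique (HG 0%N 0 isT (lexx _)) (fourier_is_eq _ (fourier_is_distr_of If0)) => phi Sphi; rewrite i0.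
have e1 : {ae mu, forall x, G 1 0 x = fourier f1 x}.
  by apply: fourier_is_unique (HG 1%N 0 isT (lexx _)) (fourier_is_eq _ (fourier_is_distr_of If1)) => phi Sphi; rewrite i1.
have e2 : {ae mu, forall x, G 2 0 x = fourier f2 x}.
  by apply: fourier_is_unique (HG 2%N 0 isT (lexx _)) (fourier_is_eq _ (fourier_is_distr_of If2)) => phi Sphi; rewrite i2.
(* At kernel time 0 the fundamental matrix is the identity, so its row [l] selects the [l]-th time
   derivative. *)
have sel (v : nat -> R) : v l = (0%N == l)%:R * v 0%N + (1%N == l)%:R * v 1%N + (2%N == l)%:R * v 2%N.
  by case: (l) l2 => [|[|[|]]]//= _; ring.
pose D x := cRe (c * G l T x) - (A 0 l T x * cRe (c * G 0 0 x) + A 1 l T x * cRe (c * G 1 0 x) + A 2 l T x * cRe (c * G 2 0 x)).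
have mG j t : (j <= 3)%N -> 0 <= t -> measurable_fun setT (fun x => cRe (c * G j t x)).
  move=> j3 t0; have [mg _ _] := HG j t j3 t0.
  by have [] := cmeasurableM (cmeasurable_cst c) mg.
have mD : measurable_fun setT D.
  have mA k := @measurable_mgt_fund R tau delta tau0 delta0 n k l T.
  apply: measurable_funB; first exact: mG (ltW T0).
  by apply: measurable_funD; first apply: measurable_funD; apply: measurable_funM => //; exact: mG.
have D0 (N : nat) : {ae mu, forall x, enorm x <= N%:R -> D x = 0}.
  (* Bounded, supported in a ball, and of the sign of [D]: on the ball [chi * D] is nonnegative and
     vanishes only where [D] does. *)
  pose chi x : R := \1_[set x : Rn R n | enorm x <= N%:R] x * Num.max (-1) (Num.min 1 (D x)).
  have mB : measurable [set x : Rn R n | enorm x <= N%:R].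
    rewrite -[X in measurable X]setTI.
    have := @measurable_enorm R n; move=> /(_ measurableT `]-oo, N%:R]%classic (measurable_itv _)).
    by congr measurable; congr setI; apply/seteqP; split=> x /=; rewrite in_itv.
  have mchi : measurable_fun setT chi.
    apply: measurable_funM; first exact: measurable_indic.
    by apply: measurable_maxr => //; exact: measurable_minr.
  have chiE x : enorm x <= N%:R -> chi x = Num.max (-1) (Num.min 1 (D x)).
    by move=> xN; rewrite /chi indicE mem_set// mul1r.
  have chiM x : N%:R < enorm x -> chi x = 0.
    by move=> Nx; rewrite /chi indicE memNset ?mul0r//= => /le_lt_trans/(_ Nx); rewrite ltxx.
  have chi1 x : `|chi x| <= 1.
    have [xN|/chiM ->] := leP (enorm x) N%:R; last by rewrite normr0.
    rewrite chiE// ler_norml le_max lexx /= ge_max ge_min lexx /= andbT; lra.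
  have cons := pairing_conserved fin Hd HG mchi chi1 chiM c1 Heq l T0.
  have I i z j t : (j <= 3)%N -> 0 <= t ->
      mu.-integrable setT (EFin \o (fun x => chi x * A i l z x * cRe (c * G j t x))).
    by move=> j3 t0; exact: (psi_integrable fin HG mchi chi1 chiM c1).
  have ID : mu.-integrable setT (EFin \o (fun x => chi x * D x)) /\ \int[mu]_x (chi x * D x) = 0.
    have E : (fun x => chi x * D x) = (fun x => (chi x * A 0 l 0 x * cRe (c * G 0 T x) +
      chi x * A 1 l 0 x * cRe (c * G 1 T x) + chi x * A 2 l 0 x * cRe (c * G 2 T x)) -
      (chi x * A 0 l T x * cRe (c * G 0 0 x) + chi x * A 1 l T x * cRe (c * G 1 0 x) + chi x * A 2 l T x * cRe (c * G 2 0 x))).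
      apply/funext => x; rewrite !mgt_fund0 ?sqr_ge0// {1}/D (sel (fun j => cRe (c * G j T x))).
      by ring.
    have I1 : mu.-integrable setT (EFin \o (fun x => chi x * A 0 l 0 x * cRe (c * G 0 T x) +
      chi x * A 1 l 0 x * cRe (c * G 1 T x) + chi x * A 2 l 0 x * cRe (c * G 2 T x))).
      by do 2?[apply: rintegrableD]; apply: I => //; exact: ltW.
    have I2 : mu.-integrable setT (EFin \o (fun x => chi x * A 0 l T x * cRe (c * G 0 0 x) +
      chi x * A 1 l T x * cRe (c * G 1 0 x) + chi x * A 2 l T x * cRe (c * G 2 0 x))).
      by do 2?[apply: rintegrableD]; apply: I.
    rewrite E; split; first exact: rintegrableB.
    rewrite RintegralB// !RintegralD//; do ?[by apply: I => //; exact: ltW | by apply: rintegrableD; apply: I => //; exact: ltW].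
    by move: cons; rewrite /pairing => ->; rewrite subrr.
  have pos x : 0 <= chi x * D x.
    have [xN|/chiM ->] := leP (enorm x) N%:R; last by rewrite mul0r.
    rewrite chiE//; have [h|h] := leP 0 (D x).
      by rewrite mulr_ge0// le_max; apply/orP; right; rewrite le_min ler01.
    rewrite mulr_le0 ?(ltW h)// ge_max ge_min (ltW h) orbT andbT; lra.
  have {}ID : (\int[mu]_x `|(chi x * D x)%:E| = 0)%E.
    case: ID => ID e; under eq_integral do rewrite abse_EFin ger0_norm//.
    by rewrite -[LHS]fineK ?(integrable_fin_num measurableT ID)//; congr EFin.
  have mchiD : measurable_fun setT (EFin \o (fun x => chi x * D x)).
    by apply/measurable_EFinP; exact: measurable_funM.
  have := (ae_eq_integral_abs mu measurableT mchiD).1 ID.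
  apply: filterS => x /(_ Logic.I) [] + xN; rewrite chiE// => /eqP; rewrite mulf_eq0 => /orP[/eqP h|/eqP//].
  move: (D x) h => d; clear -tau0 delta0 s n; case: (leP 1 d) => d1; case: leP => d2 //; lra.
have {}D0 : {ae mu, forall x, D x = 0}.
  have := ae_foralln D0; apply: filterS => x Dx.
  by apply: (Dx (Num.truncn (enorm x)).+1); exact/ltW/truncnS_gt.
apply: filterS3 D0 eG (filterI e0 (filterI e1 e2)) => x Dx -> [h0 [h1 h2]].
move/eqP: Dx; rewrite /D subr_eq0 => /eqP ->; rewrite h0 h1 h2 /mgt_sol.
by congr (_ + _ + _); exact: mulrC.
Qed.

End identification.

(** * Decay *)

Section pointwise.
Context {R : realType} (tau delta : R).
Hypotheses (tau0 : 0 < tau) (delta0 : 0 < delta).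
Implicit Types (r t y q c k : R).

Lemma powRD_gt0 r p q : 0 < r -> r `^ (p + q) = r `^ p * r `^ q.
Proof. by move=> r0; rewrite powRD//; apply/implyP => _; rewrite gt_eqF. Qed.

Lemma powR_le_exp q c : 0 <= q -> 0 < c -> exists2 K : R, 0 < K & forall y, 0 <= y -> y `^ q <= K * expR (c * y).
Proof.
move=> q0 c0; have q1 : 0 < q + 1 by rewrite ltr_wpDl.
(* From [u <= exp u] at [u = c * y / (q + 1)], raised to the power [q]; dividing by [q + 1] rather
   than by [q] covers [q = 0]. *)
exists (((q + 1) / c) `^ q); first by rewrite powR_gt0// divr_gt0.
move=> y y0; have h : y <= (q + 1) / c * expR (c * y / (q + 1)).
  have e : c * y / (q + 1) <= expR (c * y / (q + 1)).
    by apply: le_trans (expR_ge1Dx _); rewrite lerDr.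
  rewrite -ler_pdivrMl ?divr_gt0// (le_trans _ e)// le_eqVlt; apply/orP; left; apply/eqP.
  by field; rewrite !gt_eqF.
apply: (@le_trans _ _ (((q + 1) / c * expR (c * y / (q + 1))) `^ q)).
  by apply: ge0_ler_powR => //; rewrite nnegrE// mulr_ge0 ?expR_ge0// divr_ge0// ltW.
rewrite powRM ?expR_ge0 ?divr_ge0 ?(ltW q1) ?(ltW c0)//.
rewrite ler_wpM2l ?powR_ge0// -expRM ler_expR -mulrA ler_piMr ?mulr_ge0 ?(ltW c0)//.
by rewrite mulrC ler_pdivrMr// mul1r lerDl.
Qed.

(** For [t >= 1] one has [1 + t <= 2 * t], which costs one factor 2. The other one in
    [decay_rate / 4] is due to the half of the profile's Gaussian that [r_gauss_le] spends. *)
Definition time_rate : R := Num.min (decay_rate tau delta / 4) (2 * tau)^-1.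
Local Notation ct := time_rate.
Local Notation a := (decay_rate tau delta).

Lemma time_rate_spec : [/\ 0 < ct, ct <= a / 4 & ct <= (2 * tau)^-1].
Proof.
have [a0 _ _ _ _] := decay_rate_spec tau0 delta0.
by rewrite /time_rate lt_min divr_gt0//= invr_gt0 mulr_gt0//; split => //; rewrite ge_min lexx ?orbT.
Qed.

Local Notation w sigma r := ((1 + r ^+ 2) `^ (sigma / 2)).

Lemma powR_le_weight r sigma p : 1 <= r -> p <= sigma -> 0 <= sigma -> r `^ p <= w sigma r.
Proof.
move=> r1 ps s0; apply: (@le_trans _ _ (r `^ sigma)); first exact: ler_powR.
have r0 : 0 <= r by exact: le_trans r1.
have -> : r `^ sigma = (r ^+ 2) `^ (sigma / 2).
  by rewrite -powR_mulrn// -powRrM; congr (_ `^ _); field.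
apply: ge0_ler_powR; rewrite ?nnegrE ?sqr_ge0 ?divr_ge0 ?addr_ge0 ?sqr_ge0//.
by rewrite lerDr.
Qed.

(** Half of the Gaussian absorbs the factor [r], uniformly for [t >= 1]. *)
Lemma r_gauss_le r t : 0 <= r -> 1 <= t ->
  r * expR (- (delta / 2) * r ^+ 2 * t) <= (1 + 4 / delta) * expR (- (delta / 4 * r ^+ 2 * t)).
Proof.
move=> r0 t1.
have d0 : 0 < 4 / delta by rewrite divr_gt0.
have -> : expR (- (delta / 2) * r ^+ 2 * t) = expR (- (delta / 4 * r ^+ 2 * t)) * expR (- (delta / 4 * r ^+ 2 * t)).
  by rewrite -expRD; congr expR; field.
rewrite mulrA ler_wpM2r ?expR_ge0// expRN ler_pdivrMr ?expR_gt0//.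
have r2 := sqr_ge0 r.
have h1 : r <= (1 + 4 / delta) * (1 + delta / 4 * r ^+ 2).
  have -> : (1 + 4 / delta) * (1 + delta / 4 * r ^+ 2) = 1 + 4 / delta + (delta / 4 * r ^+ 2 + r ^+ 2).
    by field; rewrite gt_eqF.
  have : 0 <= delta / 4 * r ^+ 2 by rewrite mulr_ge0// divr_ge0// ltW.
  have := sqr_ge0 (r - 1); nra.
apply: (le_trans h1); apply: ler_wpM2l; first by rewrite addr_ge0// ltW.
by apply: le_trans (expR_ge1Dx _) _; rewrite ler_expR ler_peMr// mulr_ge0// divr_ge0// ltW.
Qed.

Lemma wsymbol_le r l t : (l <= 2)%N -> 1 <= r -> 0 <= t ->
  `|wsymbol delta r l t| <= r `^ (l%:R - 1) * expR (- (delta / 2) * r ^+ 2 * t).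
Proof.
move=> l2 r1 t0; have r0 : 0 < r by exact: lt_le_trans r1.
have s1 : `|sin (r * t)| <= 1 by rewrite ler_norml sin_geN1 sin_le1.
have c1 : `|cos (r * t)| <= 1 by rewrite ler_norml cos_geN1 cos_le1.
have wl : `|wave_time_derivative r l t| <= r ^+ l.
  case: l l2 => [|[|[|//]]] _ //=.
  - by rewrite expr1 normrM gtr0_norm// ler_piMr// ltW.
  - by rewrite normrM normrN (ger0_norm (sqr_ge0 r)) ler_piMr ?sqr_ge0.
rewrite /wsymbol normrM normrM [`|r^-1|]gtr0_norm ?invr_gt0// [`|expR _|]gtr0_norm ?expR_gt0//.
rewrite powRD_gt0// powR_inv1 ?(ltW r0)// powR_mulrn ?(ltW r0)//.
rewrite mulrAC ler_wpM2r ?expR_ge0// mulrC ler_wpM2r ?invr_ge0 ?(ltW r0)//.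
Qed.

Definition mgt_error (a0 a1 a2 : R) (l : nat) r t : R :=
  mgt_sol tau delta (r ^+ 2) a0 a1 a2 l t - wsymbol delta r l t * (a1 + tau * a2).

(** For [r <= 1] this is the low-frequency comparison. For larger [r] there is no cancellation to
    exploit: solution and profile are each exponentially small and are bounded separately by the
    weighted data. *)
Lemma mgt_error_bound k l : 0 <= k -> (l <= 2)%N ->
  let sigma := Num.max (k - 2 + l%:R) 0 in
  exists2 C : R, 0 < C & forall r t a0 a1 a2, 0 < r -> 1 <= t ->
  r `^ k * `|mgt_error a0 a1 a2 l r t| <=
  C * ((`|a0| + `|a1| + `|a2|) * (r `^ (k + l%:R) * expR (- (ct * r ^+ 2 * (1 + t))) +
        expR (- r ^+ 2 / 2) * expR (- (ct * (1 + t)))) +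
       expR (- (ct * (1 + t))) * (w sigma r * `|a2| + w (sigma + 1) r * `|a1| + w (sigma + 2) r * `|a0|)).
Proof.
move=> k0 l2 sigma.
have s0 : 0 <= sigma by rewrite le_max lexx orbT.
have sk : k - 2 + l%:R <= sigma by rewrite le_max lexx.
have [c0 ca ctau] := time_rate_spec.
have [a0' _ _ _ ad] := decay_rate_spec tau0 delta0.
have [CL CL0 HL] := mgt_low tau0 delta0.
have [CH CH0 HH] := mgt_high tau0 delta0.
have e12 : 0 < expR (1 / 2) :> R by exact: expR_gt0.
pose Cm := 1 + tau * (1 + 4 / delta).
have d40 : 0 < 1 + 4 / delta by rewrite addr_gt0// divr_gt0.
have Cm0 : 0 < Cm by rewrite addr_gt0// mulr_gt0.
exists (CL * (1 + expR (1 / 2)) + CH + Cm).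
  by rewrite !addr_gt0// mulr_gt0// addr_gt0.
move=> r t a0 a1 a2 r0 t1; have t0 : 0 <= t by exact: le_trans t1.
set N := `|a0| + `|a1| + `|a2|; have N0 : 0 <= N by rewrite !addr_ge0.
set W := w sigma r * _ + _ + _.
have W0 : 0 <= W by rewrite !addr_ge0 ?mulr_ge0 ?powR_ge0.
set E1 := expR (- (ct * r ^+ 2 * (1 + t))); set E2 := expR (- (ct * (1 + t))); set E3 := expR (- r ^+ 2 / 2).
have E10 : 0 <= E1 by exact: expR_ge0.
have E20 : 0 <= E2 by exact: expR_ge0.
have E30 : 0 <= E3 by exact: expR_ge0.
have rk : 0 <= r `^ k by exact: powR_ge0.
have rkl : 0 <= r `^ (k + l%:R) by exact: powR_ge0.
have T1 : 0 <= N * (r `^ (k + l%:R) * E1 + E3 * E2) by rewrite mulr_ge0// addr_ge0// mulr_ge0.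
have T2 : 0 <= E2 * W by exact: mulr_ge0.
have tt : 1 + t <= 2 * t by move: t1; clear -tau0 delta0; lra.
have [r1|r1] := leP r 1.
  apply: (@le_trans _ _ (CL * (1 + expR (1 / 2)) * (N * (r `^ (k + l%:R) * E1 + E3 * E2)))); last first.
    have hp := mulr_ge0 (ltW CL0) T2; have hq := mulr_ge0 (ltW (addr_gt0 CH0 Cm0)) (addr_ge0 T1 T2).
    have := mulr_ge0 (mulr_ge0 (ltW CL0) (ltW (addr_gt0 ltr01 e12))) T2.
    move: hp hq; set X1 := N * (_ + _); set X2 := E2 * W; clear -tau0 delta0; lra.
  apply: le_trans (ler_wpM2l rk (HL r a0 a1 a2 l t r0 r1 l2 t0)) _; rewrite -/N.
  rewrite (_ : r `^ k * _ = CL * (N * (r `^ k * r ^+ l * expR (- (a * r ^+ 2) * t) + r `^ k * expR (- tau^-1 * t)))); last by ring.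
  have -> : r `^ k * r ^+ l = r `^ (k + l%:R).
    by rewrite powRD_gt0// powR_mulrn// ltW.
  rewrite -[leRHS]mulrA ler_pM2l// [leRHS]mulrCA; apply: ler_wpM2l => //.
  have h1 : expR (- (a * r ^+ 2) * t) <= E1.
    rewrite ler_expR mulNr lerN2.
    have hh : ct * (1 + t) <= a * t.
      have := ler_wpM2r (addr_ge0 ler01 t0) ca; have := mulr_ge0 (ltW a0') t0.
      have := ler_wpM2l (ltW a0') tt; clear -tau0 delta0; lra.
    have := ler_wpM2r (sqr_ge0 r) hh; set r2 := r ^+ 2; clear -tau0 delta0; lra.
  (* For [r <= 1] the factor [exp(- r^2 / 2)] is inserted at the price [exp(1 / 2)]; it makes the
     layer term square integrable over all frequencies. *)
  have h2 : r `^ k * expR (- tau^-1 * t) <= expR (1 / 2) * (E3 * E2).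
    have hk : r `^ k <= 1.
      have -> : 1 = 1 `^ k :> R by rewrite powR1.
      by apply: ge0_ler_powR; rewrite ?nnegrE// ltW.
    apply: le_trans (ler_wpM2r (expR_ge0 _) hk) _; rewrite [leLHS]mul1r.
    have -> : expR (1 / 2) * (E3 * E2) = expR (1 / 2 + (- r ^+ 2 / 2 + - (ct * (1 + t)))) by rewrite !expRD.
    rewrite ler_expR.
    have r21 : r ^+ 2 <= 1 by rewrite expr_le1// ltW.
    have : ct * (1 + t) <= tau^-1 * t.
      have := ler_wpM2r (addr_ge0 ler01 t0) ctau; rewrite invfM.
      have tv : 0 <= tau^-1 by rewrite invr_ge0 ltW.
      have := ler_wpM2l tv tt; clear -tau0 delta0; lra.
    move: r21; set r2 := r ^+ 2; clear -tau0 delta0; lra.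
  have e120 := ltW e12; move: h2; have := ler_wpM2l rkl h1.
  have := mulr_ge0 e120 (mulr_ge0 rkl E10); have := mulr_ge0 E30 E20; clear -tau0 delta0; lra.
have r1' := ltW r1.
apply: (@le_trans _ _ ((CH + Cm) * (E2 * W))); last first.
  have := mulr_ge0 (mulr_ge0 (ltW CL0) (ltW (addr_gt0 ltr01 e12))) (addr_ge0 T1 T2).
  have := mulr_ge0 (ltW (addr_gt0 CH0 Cm0)) T1.
  set X1 := N * (_ + _); set X2 := E2 * W; clear -tau0 delta0; lra.
have p2 : r `^ (k + l%:R - 2) <= w sigma r by apply: powR_le_weight => //; apply: le_trans sk; clear -tau0 delta0; lra.
have p1 : r `^ (k + l%:R - 1) <= w (sigma + 1) r by apply: powR_le_weight => //; [move: sk; clear -tau0 delta0; lra|rewrite addr_ge0].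
have p0 : r `^ (k + l%:R) <= w (sigma + 2) r by apply: powR_le_weight => //; [move: sk; clear -tau0 delta0; lra|rewrite addr_ge0].
have rn0 : r != 0 by rewrite gt_eqF.
have pow x y' : r `^ (x + y') = r `^ x * r `^ y' by exact: powRD_gt0.
have hW : r `^ (k + l%:R - 2) * (`|a2| + r * `|a1| + r ^+ 2 * `|a0|) <= W.
  rewrite !mulrDr; apply: lerD; first apply: lerD.
  - by rewrite ler_wpM2r.
  - rewrite mulrA ler_wpM2r// (le_trans _ p1)// le_eqVlt; apply/orP; left; apply/eqP.
    by rewrite -{2}(powRr1 (ltW r0)) -pow; congr (_ `^ _); ring.
  - rewrite mulrA ler_wpM2r// (le_trans _ p0)// le_eqVlt; apply/orP; left; apply/eqP.
    by rewrite -powR_mulrn ?(ltW r0)// -pow; congr (_ `^ _); ring.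
have Ea : expR (- a * t) <= E2.
  rewrite ler_expR mulNr lerN2.
  have := ler_wpM2r (addr_ge0 ler01 t0) ca; have := ler_wpM2l (ltW a0') tt; have := mulr_ge0 (ltW a0') t0; clear -tau0 delta0; lra.
have Ed : expR (- (delta / 4 * r ^+ 2 * t)) <= E2.
  rewrite ler_expR lerN2.
  have r21 : 1 <= r ^+ 2 by rewrite exprn_ege1.
  have d4 : 0 <= delta / 4 by rewrite divr_ge0// ltW.
  have : delta / 4 * t <= delta / 4 * r ^+ 2 * t by rewrite ler_wpM2r// ler_peMr.
  have := ler_wpM2r (addr_ge0 ler01 t0) ca; have := ler_wpM2l (ltW a0') tt.
  have := ler_wpM2r t0 ad; clear -tau0 delta0; lra.
have hs : r `^ k * `|mgt_sol tau delta (r ^+ 2) a0 a1 a2 l t| <= CH * (E2 * W).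
  have := HH r a0 a1 a2 l t r1' l2 t0.
  have rp : 0 <= r `^ (k + l%:R - 2) by exact: powR_ge0.
  have e : r `^ (k + l%:R - 2) * r ^+ (2 - l) = r `^ k.
    by rewrite -powR_mulrn ?(ltW r0)// -pow natrB//; congr (_ `^ _); ring.
  move=> /(ler_wpM2l rp); rewrite (mulrA (r `^ _) (r ^+ _)) e.
  move=> /le_trans; apply; rewrite mulrCA ler_pM2l// mulrA mulrC; apply: ler_pM => //.
  by rewrite mulr_ge0// !addr_ge0// mulr_ge0 ?sqr_ge0// ltW.
have hm : r `^ k * `|wsymbol delta r l t * (a1 + tau * a2)| <= Cm * (E2 * W).
  move: (wsymbol delta r l t) (wsymbol_le l2 r1' t0) => ws wb.
  have Wa1 : w (sigma + 1) r * `|a1| <= W.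
    by rewrite /W addrAC lerDr addr_ge0// mulr_ge0 ?powR_ge0.
  have Wa2 : w sigma r * `|a2| <= W.
    by rewrite /W -addrA lerDl addr_ge0// mulr_ge0 ?powR_ge0.
  set E4 := expR (- (delta / 2) * r ^+ 2 * t) in wb.
  have E40 : 0 <= E4 by exact: expR_ge0.
  have rE := r_gauss_le (ltW r0) t1; rewrite -/E4 in rE.
  have rE' : r * E4 <= (1 + 4 / delta) * E2 by apply: le_trans rE _; rewrite ler_pM2l.
  have E4E2 : E4 <= E2.
    apply: le_trans Ed; rewrite ler_expR !mulNr lerN2 ler_wpM2r// ler_wpM2r ?sqr_ge0//; move: delta0; clear -tau0 delta0; lra.
  have b1 : r `^ k * (`|ws| * `|a1|) <= E2 * W.
    apply: (@le_trans _ _ (r `^ (k + l%:R - 1) * E4 * `|a1|)).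
      rewrite mulrA ler_wpM2r// -addrA pow -mulrA ler_wpM2l//.
    rewrite mulrAC mulrC; apply: ler_pM => //; first by rewrite mulr_ge0 ?powR_ge0.
    by apply: le_trans Wa1; rewrite ler_wpM2r.
  have b2 : r `^ k * (`|ws| * `|tau * a2|) <= tau * (1 + 4 / delta) * (E2 * W).
    apply: (@le_trans _ _ (r `^ (k + l%:R - 1) * E4 * (tau * `|a2|))).
      rewrite [`|tau * a2|]normrM (gtr0_norm tau0) (mulrA (r `^ k)); apply: ler_wpM2r; first by rewrite mulr_ge0// ltW.
      by rewrite -addrA pow -mulrA ler_wpM2l.
    (* The norm of the last datum pays for [r ^ (k + l - 2)] only; the remaining factor [r] goes to
       the Gaussian. *)
    rewrite (_ : k + l%:R - 1 = (k + l%:R - 2) + 1); last by ring.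
    rewrite pow powRr1 ?(ltW r0)//.
    rewrite (_ : _ * _ * _ * _ = tau * ((r * E4) * (r `^ (k + l%:R - 2) * `|a2|))); last by ring.
    rewrite -[leRHS]mulrA ler_pM2l// [leRHS]mulrA; apply: ler_pM => //.
    + by rewrite mulr_ge0// ltW.
    + by rewrite mulr_ge0 ?powR_ge0.
    + by apply: le_trans Wa2; rewrite ler_wpM2r.
  rewrite [`|ws * _|]normrM; apply: (@le_trans _ _ (r `^ k * (`|ws| * (`|a1| + `|tau * a2|)))).
    by rewrite ler_wpM2l// ler_wpM2l// ler_normD.
  rewrite [leLHS](_ : _ = r `^ k * (`|ws| * `|a1|) + r `^ k * (`|ws| * `|tau * a2|)); last by ring.
  by apply: le_trans (lerD b1 b2) _; rewrite /Cm [leRHS]mulrDl mul1r.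
apply: (@le_trans _ _ (r `^ k * (`|mgt_sol tau delta (r ^+ 2) a0 a1 a2 l t| + `|wsymbol delta r l t * (a1 + tau * a2)|))).
  by rewrite ler_wpM2l// ler_normB.
by rewrite mulrDr mulrDl lerD.
Qed.

End pointwise.

(** * Multipliers, norms of the data and Gaussian integrals *)

Section fourier_multipliers.
Context {R : realType} {n : nat}.
Implicit Types (f g h phi : Rn R n -> R[i]) (m : Rn R n -> R).
Local Notation mu := (@lebesgue_Rn R n).

(** Boundedness makes the product pair with Schwartz functions, and inversion undoes the inverse
    transform in the definition of the multiplier. *)
Lemma fourier_is_multiplier m f (K : R) : measurable_fun setT m -> (forall x, `|m x| <= K) ->
  cintegrable f -> fourier_is (fourier_multiplier m f) (fun x => (m x)%:C * fourier f x).
Proof.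
move=> mm mK If; have mF : cmeasurable (fun x => (m x)%:C * fourier f x).
  by apply: cmeasurableM; [exact: cmeasurableR|exact: cmeasurable_fourier].
split=> //.
  move=> phi /schwartz_integrable Iphi.
  apply: (cintegrable_bddM (M := K * ((2 * pi) `^ (- (n%:R / 2)) * (2 * \int[mu]_x normc (f x)))) Iphi mF).
  move=> x; rewrite normcM normcR; apply: ler_pM => //; first exact: normc_ge0.
  exact: fourier_bound.
move=> phi Sphi; rewrite /distr_fourier /fourier_multiplier /distr_inv_fourier.
by rewrite inv_fourierK.
Qed.

Lemma measurable_enormV : measurable_fun setT (fun x : Rn R n => (enorm x)^-1 : R).
Proof.
rewrite (_ : (fun x => _) = (fun x : Rn R n => powR (enorm x) (-1))); last first.
  by apply/funext => x; rewrite powR_inv1// enorm_ge0.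
by apply: (measurableT_comp (measurable_powR (-1))); exact: measurable_enorm.
Qed.

Lemma wave_diffusion_symbolE (delta : R) l t (x : Rn R n) : (l <= 2)%N ->
  wave_diffusion_symbol delta l t x = wsymbol delta (enorm x) l t.
Proof. by move=> l2; rewrite /wave_diffusion_symbol derive1n_sin. Qed.

Lemma measurable_wsymbol (delta : R) l t :
  measurable_fun setT (fun x : Rn R n => wsymbol delta (enorm x) l t).
Proof.
have me := @measurable_enorm R n.
have mrt : measurable_fun setT (fun x : Rn R n => enorm x * t) by exact: measurable_funM.
have ms : measurable_fun setT (fun x : Rn R n => sin (enorm x * t) : R).
  apply: (measurableT_comp (f := @sin R)) => //.
  by apply: continuous_measurable_fun; exact: continuous_sin.
have mc : measurable_fun setT (fun x : Rn R n => cos (enorm x * t) : R).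
  apply: (measurableT_comp (f := @cos R)) => //.
  by apply: continuous_measurable_fun; exact: continuous_cos.
have m2 : measurable_fun setT (fun x : Rn R n => enorm x ^+ 2 : R) by exact: measurable_funX.
apply: measurable_funM; first apply: measurable_funM.
- exact: measurable_enormV.
- by apply: (measurableT_comp (@measurable_expR R)); do 2?[apply: measurable_funM => //].
- case: l => [|[|l]] /=; [exact: ms|exact: measurable_funM|].
  by apply: measurable_funM => //; apply: measurableT_comp.
Qed.

(** Needed only at fixed [t], so growth in [t] is allowed: [|sin (r t)| <= r t] absorbs [r^-1] when
    [l = 0], and the Gaussian absorbs [r] when [l = 2]. *)
Lemma wsymbol_bounded (delta r : R) l t : 0 < delta -> 0 <= r -> 1 <= t -> (l <= 2)%N ->
  `|wsymbol delta r l t| <= t + 1 + (1 + 4 / delta).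
Proof.
move=> delta0 r0 t1 l2; have t0 : 0 <= t by exact: le_trans t1.
have d0 : 0 < 4 / delta by rewrite divr_gt0.
have [->|rn0] := eqVneq r 0.
  by rewrite /wsymbol invr0 !mul0r normr0 !addr_ge0// ltW.
have rp : 0 < r by rewrite lt_def rn0.
have e0 : 0 <= expR (- (delta / 2) * r ^+ 2 * t) by exact: expR_ge0.
have e1 : expR (- (delta / 2) * r ^+ 2 * t) <= 1.
  rewrite -expR0 ler_expR -mulrA mulNr oppr_le0 mulr_ge0 ?divr_ge0 ?(ltW delta0)//.
  by rewrite mulr_ge0 ?sqr_ge0.
have s1 : `|sin (r * t)| <= 1 by rewrite ler_norml sin_geN1 sin_le1.
have c1 : `|cos (r * t)| <= 1 by rewrite ler_norml cos_geN1 cos_le1.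
rewrite /wsymbol; case: l l2 => [|[|[|//]]] _ /=.
- have st : `|sin (r * t)| <= r * t.
    have := @MVT_bound _ (fun z => sin z) (fun z => cos z * 1) 0 (r * t) 1.
    rewrite sin0 !subr0 mul1r [`|r * t|]ger0_norm ?mulr_ge0//; apply.
    by move=> z _; rewrite mulr1 ler_norml cos_geN1 cos_le1.
  rewrite !normrM [`|r^-1|]gtr0_norm ?invr_gt0// [`|expR _|]ger0_norm//.
  apply: (@le_trans _ _ t); last by rewrite -addrA lerDl !addr_ge0// ltW.
  apply: (@le_trans _ _ (r^-1 * `|sin (r * t)|)).
    by rewrite -mulrA ler_wpM2l ?invr_ge0// ler_piMl.
  by rewrite ler_pdivrMl.
- rewrite (_ : _ * (r * cos (r * t)) = expR (- (delta / 2) * r ^+ 2 * t) * cos (r * t)); last by field.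
  rewrite normrM [`|expR _|]ger0_norm//; apply: (@le_trans _ _ 1); first by rewrite mulr_ile1.
  by rewrite addrAC lerDr !addr_ge0// ltW.
- rewrite (_ : _ * (_ * sin (r * t)) = - (r * expR (- (delta / 2) * r ^+ 2 * t)) * sin (r * t)); last by field.
  rewrite normrM normrN [`|r * _|]ger0_norm ?mulr_ge0//.
  apply: (@le_trans _ _ (1 + 4 / delta)); last by rewrite lerDr addr_ge0.
  apply: (@le_trans _ _ (r * expR (- (delta / 2) * r ^+ 2 * t))); first by rewrite ler_piMr// mulr_ge0.
  apply: le_trans (r_gauss_le delta0 r0 t1) _.
  rewrite ler_piMr ?addr_ge0 ?(ltW d0)// -expR0 ler_expR oppr_le0 !mulr_ge0 ?sqr_ge0//.
  by rewrite ltW.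
Qed.

Lemma L1norm_fourier_bound f (X : R) : cintegrable f -> (L1norm f <= X%:E)%E ->
  forall x, normc (fourier f x) <= (2 * pi) `^ (- (n%:R / 2)) * 2 * X.
Proof.
move=> If fX x; apply: le_trans (fourier_bound x If) _.
rewrite mulrA ler_wpM2l ?mulr_ge0 ?powR_ge0//.
rewrite -lee_fin (le_trans _ fX)// /L1norm Lnorm1 fineK; last first.
  by apply: integrable_fin_num => //; exact: cintegrable_normc.
by apply: ge0_le_integral => //; [by move=> y _; rewrite lee_fin normc_ge0
  |by apply/measurable_EFinP; apply: cmeasurable_normc; exact: cintegrable_measurable
  |by apply: measurableT_comp => //; apply/measurable_EFinP; apply: cmeasurable_normc; exact: cintegrable_measurable
  |by move=> y _; rewrite abse_EFin lee_fin ler_norm].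
Qed.

Lemma sobolev_norm_integrable (sigma X : R) f : cintegrable f -> 0 <= X ->
  (sobolev_norm sigma (distr_of f) <= X%:E)%E ->
  mu.-integrable setT (EFin \o (fun x => ((1 + enorm x ^+ 2) `^ (sigma / 2) * normc (fourier f x)) ^+ 2)) /\
  \int[mu]_x (((1 + enorm x ^+ 2) `^ (sigma / 2) * normc (fourier f x)) ^+ 2) <= X ^+ 2.
Proof.
move=> If X0 fX; have mw := @measurable_sobolev_weight R n sigma.
pose W x := ((1 + enorm x ^+ 2) `^ (sigma / 2) * normc (fourier f x)) ^+ 2.
have WE x : W x = normc (((1 + enorm x ^+ 2) `^ (sigma / 2))%:C * fourier f x) ^+ 2.
  by rewrite normcM normcR ger0_norm ?powR_ge0.
have mW : measurable_fun setT W.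
  apply: measurable_funX; apply: measurable_funM => //; apply: cmeasurable_normc.
  exact: cmeasurable_fourier.
have We : (\int[mu]_x (W x)%:E <= (X ^+ 2)%:E)%E.
  under eq_integral do rewrite WE.
  by apply/(L2norm_le (fun x => ((1 + enorm x ^+ 2) `^ (sigma / 2))%:C * fourier f x) X0);
    rewrite -(weighted_normE mw (fourier_is_distr_of If)).
have IW : mu.-integrable setT (EFin \o W).
  apply/integrableP; split; first exact/measurable_EFinP.
  apply: (@le_lt_trans _ _ (X ^+ 2)%:E); last by rewrite ltry.
  by under eq_integral do rewrite /= ger0_norm ?sqr_ge0//.
split; first exact: IW.
by rewrite -lee_fin; apply: le_trans We; rewrite fineK//; exact: integrable_fin_num.
Qed.

Lemma scaled_gaussian (c : R) : 0 < c -> exists2 K : R, 0 < K & forall y : R, 0 < y ->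
  mu.-integrable setT (EFin \o (fun x => expR (- (c * enorm x ^+ 2 * y)))) /\
  \int[mu]_x expR (- (c * enorm x ^+ 2 * y)) = K * y `^ (- (n%:R / 2)).
Proof.
move=> c0; exists ((pi / c) `^ (n%:R / 2)); first by rewrite powR_gt0// divr_gt0// pi_gt0.
move=> y y0; have cy : 0 < 2 * c * y by rewrite !mulr_gt0.
pose sg : R := Num.sqrt ((2 * c * y)^-1).
have sg0 : 0 < sg by rewrite sqrtr_gt0 invr_gt0.
have sg2 : sg ^+ 2 = (2 * c * y)^-1 by rewrite sqr_sqrtr// invr_ge0 ltW.
have E : (fun x : Rn R n => expR (- (c * enorm x ^+ 2 * y))) = gaussn sg origin.
  apply/funext => x; rewrite gaussn0E sg2 -sqr_enorm; congr expR.
  by rewrite -mulr_natr; field; rewrite !gt_eqF.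
rewrite E; split; first by apply: integrable_gaussn; rewrite gt_eqF.
rewrite Rintegral_gaussn ?gt_eqF// /normal_peak invrK sg2.
have h0 : 0 <= pi / c :> R by rewrite divr_ge0 ?pi_ge0// ltW.
have yV : y^-1 = y `^ (-1) by rewrite powR_inv1// ltW.
rewrite (_ : (2 * c * y)^-1 * pi *+ 2 = pi / c * y^-1); last first.
  by rewrite -mulr_natr; field; rewrite !gt_eqF.
rewrite -powR12_sqrt; last by rewrite mulr_ge0// invr_ge0 ltW.
rewrite -powR_mulrn ?powR_ge0// -powRrM powRM//; last by rewrite invr_ge0 ltW.
by rewrite yV -powRrM mulN1r; congr (_ `^ _ * _ `^ _); ring.
Qed.

Lemma A_norm_ge (sigma X : R) f0 f1 f2 : A_norm sigma f0 f1 f2 = X%:E ->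
  [/\ 0 <= X, (sobolev_norm (sigma + 2) (distr_of f0) <= X%:E)%E,
    (sobolev_norm (sigma + 1) (distr_of f1) <= X%:E)%E & (sobolev_norm sigma (distr_of f2) <= X%:E)%E] /\
  [/\ (L1norm f0 <= X%:E)%E, (L1norm f1 <= X%:E)%E & (L1norm f2 <= X%:E)%E].
Proof.
have S0 sg (u : distr R n) : (0 <= sobolev_norm sg u)%E.
  by apply: le_ereal_inf_tmp => _ [h _ <-]; exact: Lnorm_ge0.
have L0 f : (0 <= L1norm f)%E by exact: Lnorm_ge0.
have p0 := S0 (sigma + 2) (distr_of f0); have p1 := S0 (sigma + 1) (distr_of f1).
have p2 := S0 sigma (distr_of f2); have q0 := L0 f0; have q1 := L0 f1; have q2 := L0 f2.
have t2 := adde_ge0 p0 p1; have t3 := adde_ge0 t2 p2; have t4 := adde_ge0 t3 q0.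
have t5 := adde_ge0 t4 q1; have t6 := adde_ge0 t5 q2.
rewrite /A_norm => AX; have X0 : 0 <= X by rewrite -lee_fin -AX.
rewrite -AX.
have h5 := leeDl _ q2; have h4 := le_trans (leeDl _ q1) (h5 _).
have h3 := le_trans (leeDl _ q0) (h4 _); have h2 := le_trans (leeDl _ p2) (h3 _).
split; split.
- exact: X0.
- exact: le_trans (leeDl _ p1) (h2 _).
- exact: le_trans (leeDr _ p0) (h2 _).
- exact: le_trans (leeDr _ t2) (h3 _).
- exact: le_trans (leeDr _ t3) (h4 _).
- exact: le_trans (leeDr _ t4) (h5 _).
- exact: leeDr.
Qed.

End fourier_multipliers.

Section decay.
Context {R : realType} {n : nat} (tau delta : R).
Hypotheses (tau0 : 0 < tau) (delta0 : 0 < delta).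
Local Notation mu := (@lebesgue_Rn R n).
Local Notation ct := (time_rate tau delta).
Local Notation w sigma x := ((1 + enorm x ^+ 2) `^ (sigma / 2)).

(** The real bound is applied to the real and imaginary parts, the latter obtained with the unit
    factor -i; hence the constant [C + C]. Positive dimension makes the zero frequency
    negligible. *)
Lemma mgt_complex_error (k : R) (l : nat) : (0 < n)%N -> 0 <= k -> (l <= 2)%N ->
  let sigma := Num.max (k - 2 + l%:R) 0 in
  exists2 C : R, 0 < C & forall s f0 f1 f2 psi t g,
    cintegrable f0 -> cintegrable f1 -> cintegrable f2 ->
    mgt_solution tau delta s f0 f1 f2 psi -> 1 <= t -> fourier_is (psi l t) g ->
  {ae mu, forall x, enorm x `^ k * normc (g x - (wsymbol delta (enorm x) l t)%:C * (fourier f1 x + tau%:C * fourier f2 x)) <=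
  C * ((normc (fourier f0 x) + normc (fourier f1 x) + normc (fourier f2 x)) *
       (enorm x `^ (k + l%:R) * expR (- (ct * enorm x ^+ 2 * (1 + t))) +
        expR (- enorm x ^+ 2 / 2) * expR (- (ct * (1 + t)))) +
       expR (- (ct * (1 + t))) * (w sigma x * normc (fourier f2 x) + w (sigma + 1) x * normc (fourier f1 x)
         + w (sigma + 2) x * normc (fourier f0 x)))}.
Proof.
move=> n0 k0 l2 sigma; have [C C0 HC] := mgt_error_bound tau0 delta0 k0 l2.
exists (C + C); first exact: addr_gt0.
move=> s f0 f1 f2 psi t g If0 If1 If2 sol t1 gt; have t0 : 0 < t by exact: lt_le_trans t1.
have c1 : normc (1 : R[i]) = 1 by rewrite normcE /= expr0n addr0 expr1n sqrtr1.
have ci : normc (0 +i* (- 1) : R[i]) = 1 by rewrite normcE /= expr0n add0r sqrrN expr1n sqrtr1.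
have re := mgt_fourier_part tau0 delta0 If0 If1 If2 sol l2 t0 c1 gt.
have im := mgt_fourier_part tau0 delta0 If0 If1 If2 sol l2 t0 ci gt.
have nz : {ae mu, forall x, enorm x != 0}.
  by apply: negligibleS (negligible_enorm0 n0) => x /= /negP; rewrite negbK => /eqP.
apply: filterS3 re im nz => x.
move: (g x) (fourier f0 x) (fourier f1 x) (fourier f2 x) => G a0 a1 a2; rewrite !mul1r !cReM /= !mul0r !sub0r !mulN1r !opprK => re im nz.
have r0 : 0 < enorm x by rewrite lt_def nz enorm_ge0.
move: (enorm x) r0 re im {nz} => r r0 re im.
have E1 : 0 <= expR (- (ct * r ^+ 2 * (1 + t))) by exact: expR_ge0.
have E2 : 0 <= expR (- (ct * (1 + t))) by exact: expR_ge0.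
have E3 : 0 <= expR (- r ^+ 2 / 2) by exact: expR_ge0.
have mono (p : R[i] -> R) : (forall z, `|p z| <= normc z) ->
    r `^ k * `|mgt_error tau delta (p a0) (p a1) (p a2) l r t| <=
    C * ((normc a0 + normc a1 + normc a2) * (r `^ (k + l%:R) * expR (- (ct * r ^+ 2 * (1 + t))) +
        expR (- r ^+ 2 / 2) * expR (- (ct * (1 + t)))) +
       expR (- (ct * (1 + t))) * ((1 + r ^+ 2) `^ (sigma / 2) * normc a2 + (1 + r ^+ 2) `^ ((sigma + 1) / 2) * normc a1
         + (1 + r ^+ 2) `^ ((sigma + 2) / 2) * normc a0)).
  move=> hp; apply: le_trans (HC r t (p a0) (p a1) (p a2) r0 t1) _.
  rewrite ler_pM2l//; apply: lerD.
    apply: ler_wpM2r; first by apply: addr_ge0; apply: mulr_ge0 => //; exact: powR_ge0.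
    by apply: lerD; [apply: lerD|]; exact: hp.
  apply: ler_wpM2l => //.
  by apply: lerD; [apply: lerD|]; apply: ler_wpM2l; rewrite ?powR_ge0//; exact: hp.
apply: (@le_trans _ _ (r `^ k * (`|mgt_error tau delta (cRe a0) (cRe a1) (cRe a2) l r t| +
   `|mgt_error tau delta (cIm a0) (cIm a1) (cIm a2) l r t|))); last first.
  rewrite mulrDr mulrDl; apply: lerD.
    by apply: (mono (fun z => cRe z)) => z; exact: ler_Re_normc.
  by apply: (mono (fun z => cIm z)) => z; exact: ler_Im_normc.
apply: ler_wpM2l; first exact: powR_ge0.
apply: le_trans (ler_normc_ReIm _) _; rewrite cReB cImB cReZ cImZ cReD cImD cReZ cImZ.
by rewrite re im.
Qed.

End decay.

(** Cauchy-Schwarz for five terms: the gap is the sum of the squares of the ten pairwise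
    differences. *)
Lemma ler_sqr_sum5 (R : realType) (p e a b c d f : R) :
  (p * (a + b) + e * (c + d + f)) ^+ 2 <=
  5 * (p ^+ 2 * (a ^+ 2 + b ^+ 2) + e ^+ 2 * (c ^+ 2 + d ^+ 2 + f ^+ 2)).
Proof.
pose x := p * a; pose y := p * b; pose z := e * c; pose u := e * d; pose v := e * f.
rewrite -subr_ge0 (_ : _ - _ = (x - y) ^+ 2 + (x - z) ^+ 2 + (x - u) ^+ 2 + (x - v) ^+ 2 + (y - z) ^+ 2 +
  (y - u) ^+ 2 + (y - v) ^+ 2 + (z - u) ^+ 2 + (z - v) ^+ 2 + (u - v) ^+ 2); last by rewrite /x /y /z /u /v; ring.
by rewrite !addr_ge0 ?sqr_ge0.
Qed.

(** After squaring, half of each exponential is traded for a power of [y]: the bound at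
    [z = r ^ 2 * y] turns [r ^ (2 q)] into [y ^ (- q)], and the bound at [z = y] gives [y ^ (- Q)].
    The factors 1 in the last Gaussian match the shape of [scaled_gaussian]. *)
Lemma decay_pointwise (R : realType) (c q Q C K1 K2 P y r N W0 W1 W2 : R) :
  0 <= q -> 0 < y -> 0 < c -> 0 <= C -> 0 <= N -> N <= P -> 0 <= r ->
  0 <= W0 -> 0 <= W1 -> 0 <= W2 -> 0 < K2 ->
  (forall z : R, 0 <= z -> z `^ q <= K1 * expR (c * z)) ->
  (forall z : R, 0 <= z -> z `^ Q <= K2 * expR (c * z)) ->
  (C * (N * (r `^ q * expR (- (c * r ^+ 2 * y)) + expR (- r ^+ 2 / 2) * expR (- (c * y))) +
       expR (- (c * y)) * (W2 + W1 + W0))) ^+ 2 <=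
  5 * C ^+ 2 * (P ^+ 2 * (K1 * y `^ (- q) * expR (- (c * r ^+ 2 * y)) + K2 * y `^ (- Q) * expR (- (1 * r ^+ 2 * 1))) +
     K2 * y `^ (- Q) * (W2 ^+ 2 + W1 ^+ 2 + W0 ^+ 2)).
Proof.
move=> q0 y0 c0 C0 N0 NP r0 W00 W10 W20 K20 H1 H2.
set F1 := r `^ q * _; set F2 := expR (- r ^+ 2 / 2) * _; set E := expR (- (c * y)).
have EE : E ^+ 2 <= K2 * y `^ (- Q).
  have := H2 y (ltW y0); have yQ : 0 < y `^ Q by exact: powR_gt0.
  rewrite powRN => h; rewrite ler_pdivlMr//.
  apply: (@le_trans _ _ (E ^+ 2 * (K2 * expR (c * y)))); first by rewrite ler_wpM2l ?sqr_ge0.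
  rewrite (_ : _ * _ = K2 * (E * (E * expR (c * y)))); last by ring.
  rewrite /E -expRD addNr expR0 mulr1 ler_piMr ?(ltW K20)//.
  by rewrite -expR0 ler_expR oppr_le0 mulr_ge0// ltW.
have F1E : F1 ^+ 2 <= K1 * y `^ (- q) * expR (- (c * r ^+ 2 * y)).
  have := H1 (r ^+ 2 * y) (mulr_ge0 (sqr_ge0 r) (ltW y0)).
  rewrite powRM ?sqr_ge0 ?(ltW y0)// powRN => h.
  have yq : 0 < y `^ q by exact: powR_gt0.
  rewrite /F1 exprMn.
  have -> : (r `^ q) ^+ 2 = (r ^+ 2) `^ q.
    by rewrite expr2 [in RHS]expr2 powRM.
  set G := expR (- (c * r ^+ 2 * y)); have G0 : 0 < G by exact: expR_gt0.
  rewrite [K1 / _ * G]mulrAC ler_pdivlMr//.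
  rewrite (_ : _ * _ = G * (G * ((r ^+ 2) `^ q * y `^ q))); last by ring.
  rewrite [K1 * G]mulrC ler_pM2l//.
  apply: le_trans (ler_wpM2l (ltW G0) h) _.
  by rewrite mulrCA /G -expRD [c * (r ^+ 2 * y)]mulrA addNr expR0 mulr1.
have F2E : F2 ^+ 2 <= K2 * y `^ (- Q) * expR (- (1 * r ^+ 2 * 1)).
  rewrite /F2 exprMn mulrC (_ : expR (- r ^+ 2 / 2) ^+ 2 = expR (- (1 * r ^+ 2 * 1))).
    by rewrite ler_wpM2r// expR_ge0.
  by rewrite expr2 -expRD; congr expR; field.
have P0 : 0 <= P by exact: le_trans NP.
have F10 : 0 <= F1 by rewrite mulr_ge0 ?powR_ge0 ?expR_ge0.
have F20 : 0 <= F2 by rewrite mulr_ge0 ?expR_ge0.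
have E0 : 0 <= E by exact: expR_ge0.
have S0 : 0 <= W2 + W1 + W0 by rewrite !addr_ge0.
apply: (@le_trans _ _ (C ^+ 2 * (P * (F1 + F2) + E * (W2 + W1 + W0)) ^+ 2)).
  rewrite exprMn ler_wpM2l ?sqr_ge0//; apply: lerXn2r; rewrite ?nnegrE.
  - by apply: addr_ge0; apply: mulr_ge0 => //; exact: addr_ge0.
  - by apply: addr_ge0; apply: mulr_ge0 => //; exact: addr_ge0.
  - by rewrite lerD2r ler_wpM2r// addr_ge0.
rewrite [5 * _]mulrC -[leRHS]mulrA; apply: ler_wpM2l; first exact: sqr_ge0.
apply: le_trans (ler_sqr_sum5 _ _ _ _ _ _ _) _; rewrite ler_pM2l//.
apply: lerD; first by apply: ler_wpM2l; [exact: sqr_ge0|exact: lerD].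
by apply: ler_wpM2r => //; rewrite !addr_ge0 ?sqr_ge0.
Qed.

(** Lets [A + 1] be the constant for a norm whose square is bounded with constant [A], without
    square roots. *)
Lemma sqrD1_ge (R : realType) (z : R) : 0 <= z -> z <= (z + 1) ^+ 2.
Proof. by move=> z0; rewrite sqrrD expr1n mulr1 -mulr_natl addrAC; have := sqr_ge0 z; lra. Qed.

Unset Implicit Arguments.

Theorem theorem2p1 (R : realType) (n : nat) (tau delta s : R) (l : nat) (k : R) :
  (1 <= n)%N -> 0 < tau -> 0 < delta -> 0 <= s ->
  (l <= 2)%N -> 0 <= k -> k <= s + 2 - l%:R ->
  exists C T : R, 0 < C /\ 1 <= T /\
    forall psi0 psi1 psi2 : Rn R n -> R[i], A_space s psi0 psi1 psi2 ->
    forall psi : nat -> R -> distr R n,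
      mgt_solution tau delta s psi0 psi1 psi2 psi ->
    forall t : R, T <= t ->
      (homogeneous_sobolev_norm k
         (psi l t \- fourier_multiplier (wave_diffusion_symbol delta l t)
                       (fun x => psi1 x + tau%:C * psi2 x))%R
       <= (C * (1 + t) `^ (- (n%:R / 4) - (k + l%:R) / 2))%:E *
          A_norm (Num.max (k - 2 + l%:R)%R 0%R) psi0 psi1 psi2)%E.
Proof.
move=> n1 tau0 delta0 s0 l2 k0 ks.
pose mu := @lebesgue_Rn R n.
set sigma := Num.max _ _.
have [ct0 _ _] := time_rate_spec tau0 delta0.
have [Ce Ce0 HCe] := @mgt_complex_error R n tau delta tau0 delta0 k l n1 k0 l2.
(* [- Q] is the exponent of the square of the claimed rate: [q] comes from the powers of the
   frequency and [n / 2] from the Gaussian integral. *)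
pose q : R := k + l%:R; pose Q : R := n%:R / 2 + q.
have q0 : 0 <= q by rewrite addr_ge0.
have Q0 : 0 <= Q by rewrite addr_ge0// divr_ge0.
have [K1 K10 H1] := powR_le_exp q0 ct0.
have [K2 K20 H2] := powR_le_exp Q0 ct0.
have [Kg Kg0 Hg] := @scaled_gaussian R n _ ct0.
have [Kh Kh0 Hh] := @scaled_gaussian R n 1 ltr01.
pose cF : R := (2 * pi) `^ (- (n%:R / 2)) * 2.
have cF0 : 0 <= cF by rewrite mulr_ge0 ?powR_ge0.
(* The integral of the majorant of [decay_pointwise]: [3 * cF] bounds the three transforms by the
   L^1 norms, and the last 3 counts the Sobolev terms. *)
pose A := 5 * Ce ^+ 2 * ((3 * cF) ^+ 2 * (K1 * Kg + K2 * Kh) + K2 * 3).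
have A0 : 0 <= A.
  apply: mulr_ge0; first by rewrite mulr_ge0 ?sqr_ge0.
  apply: addr_ge0; last by rewrite mulr_ge0// ltW.
  by apply: mulr_ge0; [exact: sqr_ge0|apply: addr_ge0; apply: mulr_ge0; exact: ltW].
have A10 : 0 < A + 1 by rewrite ltr_wpDl.
exists (A + 1), 1; split => //; split => //.
move=> psi0 psi1 psi2 [[I0 I1 I2] _] psi sol t t1; have t0 : 0 <= t by exact: le_trans t1.
pose y := 1 + t; have y0 : 0 < y by rewrite ltr_pwDl.
have yp0 : 0 < y `^ (- (n%:R / 4) - q / 2) by exact: powR_gt0.
have An0 : (0 <= A_norm sigma psi0 psi1 psi2)%E.
  have S0 sg (u : distr R n) : (0 <= sobolev_norm sg u)%E.
    by apply: le_ereal_inf_tmp => _ [h _ <-]; exact: Lnorm_ge0.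
  by rewrite /A_norm !adde_ge0// Lnorm_ge0.
(* An infinite right-hand side makes the bound trivial, so the estimate is carried out for a real
   value [X]. *)
case AX : (A_norm sigma psi0 psi1 psi2) => [X| |].
- have [[X0 S0 S1 S2] [L0 L1 L2]] := A_norm_ge AX.
  have l3 : (l <= 3)%N by exact: leq_trans l2 _.
  have [g gP] : exists g, fourier_is (psi l t) g.
    by case: sol => /(_ l l3)[fin _] _ _ _; apply: weighted_norm_lty (fin t t0).
  have IP : cintegrable (fun x => psi1 x + tau%:C * psi2 x) by apply: cintegrableD => //; exact: cintegrableZl.
  have fP x : fourier (fun x => psi1 x + tau%:C * psi2 x) x = fourier psi1 x + tau%:C * fourier psi2 x.
    by rewrite (fourierD I1 (cintegrableZl tau%:C I2)) (fourierZl tau%:C I2).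
  have fm : fourier_is (fourier_multiplier (wave_diffusion_symbol delta l t) (fun x => psi1 x + tau%:C * psi2 x))
      (fun x => (wsymbol delta (enorm x) l t)%:C * (fourier psi1 x + tau%:C * fourier psi2 x)).
    rewrite (_ : (fun x => _ * _) = (fun x => (wsymbol delta (enorm x) l t)%:C *
       fourier (fun x => psi1 x + tau%:C * psi2 x) x)); last by apply/funext => x; rewrite fP.
    rewrite (_ : wave_diffusion_symbol delta l t = (fun x => wsymbol delta (enorm x) l t)); last first.
      by apply/funext => x; rewrite wave_diffusion_symbolE.
    apply: (fourier_is_multiplier (K := t + 1 + (1 + 4 / delta))) => //; first exact: measurable_wsymbol.
    by move=> x; apply: wsymbol_bounded => //; exact: enorm_ge0.
  have fD := fourier_isB gP fm.
  rewrite /homogeneous_sobolev_norm (weighted_normE (measurable_homogeneous_weight k) fD).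
  rewrite -EFinM; apply/L2norm_le; first by rewrite !mulr_ge0// ltW.
  have [IG1 EG1] := Hg y y0; have [IG2 EG2] := Hh 1 ltr01.
  have [IW0 EW0] := sobolev_norm_integrable I0 X0 S0.
  have [IW1 EW1] := sobolev_norm_integrable I1 X0 S1.
  have [IW2 EW2] := sobolev_norm_integrable I2 X0 S2.
  set G1 := fun x => _ in IG1 EG1; set G2 := fun x => _ in IG2 EG2.
  set W0 := fun x => _ in IW0 EW0; set W1 := fun x => _ in IW1 EW1; set W2 := fun x => _ in IW2 EW2.
  pose P := 3 * cF * X.
  have P0 : 0 <= P by apply: mulr_ge0 => //; exact: mulr_ge0.
  pose k1 := K1 * y `^ (- q); pose k2 := K2 * y `^ (- Q).
  have k10 : 0 <= k1 by rewrite mulr_ge0 ?powR_ge0// ltW.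
  have k20 : 0 <= k2 by rewrite mulr_ge0 ?powR_ge0// ltW.
  (* The right-hand side of [decay_pointwise] at the frequency [x]: two Gaussians and the Sobolev
     densities of the data, all with known integrals. *)
  pose H x := 5 * Ce ^+ 2 * (P ^+ 2 * (k1 * G1 x + k2 * G2 x) + k2 * (W2 x + W1 x + W0 x)).
  have IG : mu.-integrable setT (EFin \o (fun x => k1 * G1 x + k2 * G2 x)).
    by apply: rintegrableD; exact: rintegrableZl.
  have IW : mu.-integrable setT (EFin \o (fun x => W2 x + W1 x + W0 x)).
    by apply: rintegrableD => //; exact: rintegrableD.
  have IGP := rintegrableZl (P ^+ 2) IG; have IWk := rintegrableZl k2 IW.
  have IH : mu.-integrable setT (EFin \o H) by apply: rintegrableZl; exact: rintegrableD.
  have EH : \int[mu]_x H x <= ((A + 1) * y `^ (- (n%:R / 4) - q / 2) * X) ^+ 2.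
    have e1 : \int[mu]_x (k1 * G1 x + k2 * G2 x) = k1 * \int[mu]_x G1 x + k2 * \int[mu]_x G2 x.
      rewrite RintegralD//; [|exact: rintegrableZl..].
      by congr (_ + _); rewrite RintegralZl.
    have e2 : \int[mu]_x (W2 x + W1 x + W0 x) = \int[mu]_x W2 x + \int[mu]_x W1 x + \int[mu]_x W0 x.
      by rewrite RintegralD//; [rewrite RintegralD|exact: rintegrableD].
    have -> : \int[mu]_x H x = 5 * Ce ^+ 2 * (P ^+ 2 * (k1 * \int[mu]_x G1 x + k2 * \int[mu]_x G2 x) +
        k2 * (\int[mu]_x W2 x + \int[mu]_x W1 x + \int[mu]_x W0 x)).
      rewrite /H RintegralZl//; last exact: rintegrableD.
      by rewrite RintegralD// RintegralZl// RintegralZl// e1 e2.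
    rewrite EG1 EG2 powR1 mulr1.
    have yQ : y `^ (- Q) = y `^ (- q) * y `^ (- (n%:R / 2)).
      by rewrite -powRD_gt0//; congr (_ `^ _); rewrite /Q; ring.
    have yQ2 : (y `^ (- (n%:R / 4) - q / 2)) ^+ 2 = y `^ (- Q).
      by rewrite expr2 -powRD_gt0//; congr (_ `^ _); rewrite /Q; field.
    rewrite [leRHS](_ : _ = (A + 1) ^+ 2 * y `^ (- Q) * X ^+ 2); last by rewrite -yQ2; ring.
    apply: (@le_trans _ _ (A * y `^ (- Q) * X ^+ 2)).
      rewrite (_ : A * _ * _ = 5 * Ce ^+ 2 * (P ^+ 2 * (k1 * (Kg * y `^ (- (n%:R / 2))) + k2 * Kh) +
        k2 * (X ^+ 2 + X ^+ 2 + X ^+ 2))); last first.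
        by rewrite /A /P /k1 /k2 yQ; ring.
      apply: ler_wpM2l; first by rewrite mulr_ge0 ?sqr_ge0.
      by apply: lerD; [exact: lexx|apply: (ler_wpM2l k20); exact: lerD (lerD EW2 EW1) EW0].
    apply: ler_wpM2r; first exact: sqr_ge0.
    apply: ler_wpM2r; first exact: powR_ge0.
    exact: sqrD1_ge.
  apply: (@le_trans _ _ (\int[mu]_x (H x)%:E)%E); last first.
    by rewrite -(fineK (integrable_fin_num measurableT IH)) lee_fin.
  have mD : cmeasurable (fun x => g x - (wsymbol delta (enorm x) l t)%:C * (fourier psi1 x + tau%:C * fourier psi2 x)).
    by case: fD.
  have n0 x : 0 <= normc (fourier psi0 x) + normc (fourier psi1 x) + normc (fourier psi2 x).
    by rewrite !addr_ge0// normc_ge0.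
  have nP x : normc (fourier psi0 x) + normc (fourier psi1 x) + normc (fourier psi2 x) <= P.
    rewrite /P (_ : 3 * cF * X = cF * X + cF * X + cF * X); last by ring.
    by apply: lerD; [apply: lerD|]; exact: L1norm_fourier_bound.
  have Hpt x : (Ce * ((normc (fourier psi0 x) + normc (fourier psi1 x) + normc (fourier psi2 x)) *
       (enorm x `^ q * expR (- (time_rate tau delta * enorm x ^+ 2 * y)) +
        expR (- enorm x ^+ 2 / 2) * expR (- (time_rate tau delta * y))) +
       expR (- (time_rate tau delta * y)) * ((1 + enorm x ^+ 2) `^ (sigma / 2) * normc (fourier psi2 x) +
         (1 + enorm x ^+ 2) `^ ((sigma + 1) / 2) * normc (fourier psi1 x)
         + (1 + enorm x ^+ 2) `^ ((sigma + 2) / 2) * normc (fourier psi0 x)))) ^+ 2 <= H x.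
    apply: (decay_pointwise q0 y0 ct0 (ltW Ce0) (n0 x) (nP x) (enorm_ge0 x) _ _ _ K20 H1 H2);
      by rewrite mulr_ge0 ?powR_ge0 ?normc_ge0.
  apply: ae_ge0_le_integral => //.
  - by move=> x _; rewrite lee_fin sqr_ge0.
  - apply/measurable_EFinP; apply: measurable_funX; apply: cmeasurable_normc.
    by apply: cmeasurableM => //; apply: cmeasurableR; exact: measurable_homogeneous_weight.
  - by move=> x _; rewrite lee_fin (le_trans _ (Hpt x))// sqr_ge0.
  - exact: measurable_int IH.
  - apply: filterS (HCe _ _ _ _ _ _ _ I0 I1 I2 sol t1 gP) => x hx _.
    rewrite lee_fin (le_trans _ (Hpt x))//.
    rewrite normcM normcR ger0_norm ?powR_ge0//.
    apply: lerXn2r => //; rewrite nnegrE.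
      by rewrite mulr_ge0 ?powR_ge0 ?normc_ge0.
    by apply: le_trans hx; rewrite mulr_ge0 ?powR_ge0 ?normc_ge0.
- by rewrite gt0_muley ?leey// lte_fin mulr_gt0.
- by rewrite AX in An0.
Qed.
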